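(* Let $\mathcal{A}$ be the commutative $\mathbb{Q}(q,s)$-algebra, with product denoted $\boxtimes$, having basis $e_1,e_2,e_3$, unit $e_2$, and products $$e_1\boxtimes e_1=0,\qquad e_1\boxtimes e_3=\big(s^2+q^{-2}s^{-2}-1-q^{-2}\big)\,e_1,$$ $$e_3\boxtimes e_3=\big(a_2(1+q^{-2})-3q^{-2}-q^{-4}\big)e_1+\big(-a_4+a_2(3+q^{-2})-2-4q^{-2}\big)e_2+\big(2a_2-3-q^{-2}\big)e_3,$$ where $a_{2k}:=s^{2k}+q^{-2k}s^{-2k}$. Let $T^{+}=T^+_1e_1+T^+_2e_2+T^+_3e_3$ and $T^{-}=T^-_1e_1+T^-_2e_2+T^-_3e_3$ with $$T^+_1=a_2\big(1-2q^{-2}+2q^{-4}-2q^{-6}+4q^{-8}-2q^{-10}\big)-2+3q^{-2}-4q^{-4}+4q^{-6}-8q^{-8}+4q^{-10},$$ $$T^+_2=a_4\big(2-2q^{-2}-4q^{-6}+4q^{-8}\big)+a_2\big(-5+4q^{-2}+12q^{-6}-8q^{-8}-4q^{-10}\big)+4+3q^{-2}-6q^{-4}-6q^{-6}-8q^{-8}+16q^{-10},$$ $$T^+_3=a_2\big(2q^{-2}-2q^{-4}+2q^{-6}-4q^{-8}+2q^{-10}\big)+1-4q^{-2}+4q^{-4}-4q^{-6}+8q^{-8}-4q^{-10},$$ $$T^-_1=a_2\big(q^2-2+2q^{-2}-2q^{-4}+4q^{-6}-2q^{-8}\big)-1+4q^{-2}-4q^{-4}+4q^{-6}-8q^{-8}+4q^{-10},$$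 $$T^-_2=a_4\big(2q^2-2-4q^{-4}+4q^{-6}\big)+a_2\big(-3q^2-4+8q^{-2}+4q^{-4}+8q^{-6}-12q^{-8}\big)+q^2+10-6q^{-2}-6q^{-4}-16q^{-6}+8q^{-8}+8q^{-10},$$ $$T^-_3=a_2\big(2-2q^{-2}+2q^{-4}-4q^{-6}+2q^{-8}\big)-q^2-4q^{-2}+4q^{-4}-4q^{-6}+8q^{-8}-4q^{-10}.$$ Let $\overrightarrow{\mathrm{AS}}^*:\mathcal{A}\to\mathbb{Q}(q,s)$ be the linear form with $$\overrightarrow{\mathrm{AS}}^*(e_1)=a_6-a_4(1+q^{-2})+a_2(1+2q^{-2})-1-2q^{-2}-q^{-4},$$ $$\overrightarrow{\mathrm{AS}}^*(e_2)=a_4-a_2(2+2q^{-2})+1+4q^{-2}+q^{-4},$$ $$\overrightarrow{\mathrm{AS}}^*(e_3)=a_6(3+q^{-2})-a_4(7+8q^{-2}+q^{-4})+a_2(7+18q^{-2}+7q^{-4})-3-18q^{-2}-17q^{-4}-2q^{-6}.$$ Then for every integer $n\ge1$ the Links--Gould polynomial of the $n$-th Allen--Swenberg link is $$\mathrm{LG}_{\mathrm{AS}(n)}(s,q)=\overrightarrow{\mathrm{AS}}^*\big((T^+\boxtimes T^-)^{\boxtimes n}\big).$$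
   Context: **The Links--Gould polynomial $\mathrm{LG}_L(s,q)$ of an oriented link $L\subset S^3$.** Let $\mathrm{U}_q=\mathrm{U}_q(\mathfrak{sl}(2|1))$ be the Hopf superalgebra over $\mathbb{Q}(q,s)$ ($q,s$ indeterminates) with generators $E_i,F_i,K_i^{\pm1}$ ($i=1,2$), where $E_2,F_2$ are odd and the other generators even, Cartan matrix $(a_{ij})=\begin{pmatrix}2&-1\\-1&0\end{pmatrix}$, and relations: the $K_i$ commute, $K_iE_j=q^{a_{ij}}E_jK_i$, $K_iF_j=q^{-a_{ij}}F_jK_i$, $E_iF_j-(-1)^{|E_i||F_j|}F_jE_i=\delta_{ij}\frac{K_i-K_i^{-1}}{q-q^{-1}}$, $E_2^2=F_2^2=0$, $E_1^2E_2-(q+q^{-1})E_1E_2E_1+E_2E_1^2=0$ and the same relation for $F$. The coproduct is $\Delta(E_i)=E_i\otimes K_i+1\otimes E_i$, $\Delta(F_i)=F_i\otimes1+K_i^{-1}\otimes F_i$, $\Delta(K_i)=K_i\otimes K_i$, with the usual sign rule $(a\otimes b)(v\otimes w)=(-1)^{|b||v|}av\otimes bw$. Let $V=V(0,\alpha)$ (where $s=q^\alpha$) be the irreducible $4$-dimensional module with basis $x_0,x_1=F_2x_0,x_2=F_1x_1,x_3=F_2x_2$, where $x_0$ is even, $E_ix_0=0$, $F_1x_0=0$, $K_1x_0=x_0$, $K_2x_0=s\,x_0$. Then $V\otimes V$ is a direct sum of three pairwise non-isomorphic irreducibles: one of dimension $4$ whose highest weight vector has $(K_1,K_2)$-eigenvalues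 $(1,s^2)$, one of dimension $8$ with highest weight $(q,s^2)$, and one of dimension $4$ with highest weight $(1,qs^2)$. Let $\sigma\in\mathrm{End}_{\mathrm{U}_q}(V\otimes V)$ act on these by the scalars $s^2$, $-1$, $q^{-2}s^{-2}$ respectively, and let $\mu=\mathrm{diag}(s^{-2},-s^{-2},-q^{-2}s^{-2},q^{-2}s^{-2})$ in the basis $x_0,\dots,x_3$. The operator $\sigma$ satisfies the braid relation. If $L$ is the closure of a braid $\beta\in B_m$, let $\psi(\beta)\in\mathrm{End}(V^{\otimes m})$ be the operator obtained by sending each positive generator $\sigma_i$ (positive crossing) to $\sigma$ acting on factors $i,i+1$; the partial trace over the factors $2,\dots,m$ of $(\mathrm{id}\otimes\mu^{\otimes(m-1)})\circ\psi(\beta)$ is a scalar multiple of $\mathrm{id}_V$, and $\mathrm{LG}_L(s,q)$ is that scalar. It is an invariant of oriented links, equal to $1$ on the unknot and to $s^2+q^{-2}s^{-2}-1-q^{-2}$ on the positive Hopf link. **The links $\mathrm{AS}(n)$.** All tangles below are drawn in a rectangle with four endpoints: bottom-left (BL), bottom-right (BR), top-left (TL), top-right (TR); the tangle is oriented inward at BL and TR and outward at TL and BR. *The tangles $TT^{+},TT^-$.* Let $D$ be the tangle made of two antiparallel strands following the long right-handed trefoil with framing $0$: one strand runs from BL to TL along a long right-handed trefoil, the other is its $0$-framed parallel copy, oriented oppositely (from TR to BR). Concretely, take the long-knot diagram obtained from the $2$-strand braid $\sigma_1^3$ (three positive crossings) by closing its right strand on the right, replace it by its two-strand blackboard-parallel,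 and insert on top three full twists (six crossings) between the two strands, all six crossings being positive for the antiparallel orientation. Let $C^{\varepsilon}$ ($\varepsilon=\pm$) be the clasp tangle: an unknotted arc from BL to BR (a cap) and an unknotted arc from TR to TL (a cup), whose projections overlap in exactly two crossings, both of sign $\varepsilon$. Then $TT^{\varepsilon}$ is $C^{\varepsilon}$ stacked on top of $D$. *Horizontal concatenation of tangles.* For two such tangles $f,g$, $f\boxtimes g$ is obtained by placing $g$ to the right of $f$, joining the TR endpoint of $f$ to the TL endpoint of $g$ by an arc above and the BR endpoint of $f$ to the BL endpoint of $g$ by an arc below; the remaining endpoints are BL, TL of $f$ and BR, TR of $g$. $f^{\boxtimes n}$ is the $n$-fold iterate. *Closure.* Put $f=(TT^+\boxtimes TT^-)^{\boxtimes n}$ in the rectangle $[0,2]\times[0,1]$ with endpoints BL $=(0.2,0)$, BR $=(1.8,0)$, TL $=(0.2,1)$, TR $=(1.8,1)$. Then $\mathrm{AS}(n)$ is the oriented $3$-component link consisting of $f$ together with: (i) an arc from BR straight down to $(1.8,-1)$, along the lower semicircle to $(0.2,-1)$, and straight up to BL; (ii) an arc from TL going up and to the right to $(1,2.6)$, then around the right-hand side and below everything else in the picture to $(-0.5,-2)$, then straight up to $(-0.5,-1)$, up to $(0.2,2)$, and then to the right and down into TR; this arc has exactly one self-crossing, located just above the rectangle, at which the portion leaving TL passes over the portion going into TR; (iii) a simple closed curve $C$, oriented counterclockwise, through $(-1.2,-1)$ and $(0.9,-1)$, encircling the points $(-0.5,-1)$ and $(0.2,-1)$; its lower half passes over the two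 upward strands it meets (the one at $x=-0.5$ and the one near $x=0.2$) and its upper half passes under both of them, and $C$ meets nothing else. (The basis $e_1,e_2,e_3$ corresponds to the tangles: identity strands $\uparrow\downarrow$; cap below a cup; positive full twist of the two antiparallel strands. The vectors $T^\pm$ are the coordinates of $TT^\pm$ in this basis, and $\overrightarrow{\mathrm{AS}}^*(e_i)$ is the Links--Gould polynomial of the closure above with $f$ replaced by the $i$-th basis tangle.)
   Formalization: At the self-crossing of arc (ii) the portion leaving TL is taken to pass under, not over, the portion going into TR (a positive crossing); with the crossing as described the formula fails and contradicts the stated values of AS* on e_1 and e_3. *)

(* Defs.v *)
From mathcomp Require Import all_boot all_order all_algebra.
From mathcomp Require Import fraction mxtens.
From mathcomp Require Import ring.

Set Implicit Arguments.
Unset Strict Implicit.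
Unset Printing Implicit Defensive.

Import Order.TTheory GRing.Theory Num.Theory.
Local Open Scope ring_scope.

(* A diagram in general position with respect to the height function is the
   list of its elementary slices, read from bottom to top.  In the slice
   (i, g) the event g involves the strands i, i + 1, counted from the left
   starting at 0.  An orientation is the list of the directions of the strands
   at some height, true meaning upwards.
     Cup b   : a minimum; b is the direction of its left leg;
     Cap     : a maximum;
     Cross b : a crossing; b = true iff the strand going from bottom left to
               top right is the over strand.  Thus, between two strands
               pointing both upwards or both downwards, Cross true is
               positive, whereas between antiparallel strands Cross false is
               positive. *)
Inductive event := Cup of bool | Cap | Cross of bool.

Definition diagram := seq (nat * event).

Definition slice_step (a : seq bool) (x : nat * event) : option (seq bool) :=
  let: (i, g) := x in
  match g, drop i a with
  | Cup b, r =>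
      if (i <= size a)%N then Some (take i a ++ [:: b, ~~ b & r]) else None
  | Cap, b :: c :: r => if b != c then Some (take i a ++ r) else None
  | Cross _, b :: c :: r => Some (take i a ++ [:: c, b & r])
  | _, _ => None
  end.

(* The orientation at the top of w if it is a at the bottom, None if w is not
   a well-formed oriented diagram with these bottom endpoints. *)
Fixpoint top_of (a : seq bool) (w : diagram) : option (seq bool) :=
  if w is x :: w' then obind (top_of^~ w') (slice_step a x) else Some a.

Definition is_tangle (a b : seq bool) (w : diagram) := top_of a w = Some b.

Definition is_link (w : diagram) := is_tangle [::] [::] w.

Definition shift (k : nat) (w : diagram) : diagram :=
  [seq ((k + x.1)%N, x.2) | x <- w].

Lemma top_of_cat a u v : top_of a (u ++ v) = obind (top_of^~ v) (top_of a u).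
Proof. by elim: u a => //= x u IHu a; case: slice_step => //= b. Qed.

Lemma slice_step_context p r a b x :
  slice_step a x = Some b ->
  slice_step (p ++ a ++ r) ((size p + x.1)%N, x.2) = Some (p ++ b ++ r).
Proof.
case: x => i g /=; rewrite addnC -drop_drop drop_size_cat // addnC.
have lt_drop c t : drop i a = c :: t -> (i <= size a)%N.
  by move=> E; case: leqP => // /ltnW/drop_oversize; rewrite E.
have take_context : (i <= size a)%N ->
    take (size p + i) (p ++ a ++ r) = p ++ take i a.
  by move=> le_i; rewrite takeD take_size_cat // drop_size_cat // takel_cat.
have drop_context : (i <= size a)%N -> drop i (a ++ r) = drop i a ++ r.
  by move=> le_i; rewrite drop_cat; case: ltngtP le_i => // -> _;
     rewrite subnn drop0 drop_size.
case: g => [c||c] /=.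
- case: leqP => // le_i [<-]; rewrite !size_cat leq_add2l.
  rewrite (leq_trans le_i (leq_addr _ _)) take_context // drop_context //.
  by rewrite -!catA.
- case E: (drop i a) => [|d [|d' t]] //; have le_i := lt_drop _ _ E.
  rewrite drop_context // take_context // E /=.
  by case: ifP => // _ [<-]; rewrite -!catA.
- case E: (drop i a) => [|d [|d' t]] // [<-]; have le_i := lt_drop _ _ E.
  by rewrite drop_context // take_context // E /= -!catA.
Qed.

Lemma is_tangle_context p r a b w :
  is_tangle a b w -> is_tangle (p ++ a ++ r) (p ++ b ++ r) (shift (size p) w).
Proof.
rewrite /is_tangle; elim: w a => [|x w IHw] a /=; first by case=> ->.
case E: slice_step => [c|] //= H.
have /= := slice_step_context p r E; rewrite -/shift.
by move=> ->; rewrite /= IHw.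
Qed.

Definition n_in (g : event) : nat := if g is Cup _ then 0 else 2.
Definition n_out (g : event) : nat := if g is Cap then 0 else 2.

(* The first four constructors are the planar isotopies of diagrams presented
   by slices, the last four are the Reidemeister moves.  Reidemeister III is
   only needed for crossings of one type: the other cases follow by means of
   Reidemeister II and of the rotations move_slide_cap, move_slide_cup. *)
Inductive move : diagram -> diagram -> Prop :=
| move_far i k g h :
    move [:: (i, g); ((i + n_out g + k)%N, h)]
         [:: ((i + n_in g + k)%N, h); (i, g)]
| move_zigzag i b (side : bool) :
    move [:: ((i + side)%N, Cup b); ((i + ~~ side)%N, Cap)] [::]
| move_slide_cap i c :
    move [:: (i, Cross c); (i.+1, Cap)] [:: (i.+1, Cross (~~ c)); (i, Cap)]
| move_slide_cup i b c :
    move [:: (i.+1, Cup b); (i, Cross c)]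
         [:: (i, Cup b); (i.+1, Cross (~~ c))]
| move_R1_cap i c :
    move [:: (i, Cross c); (i, Cap)] [:: (i, Cap)]
| move_R1_cup i b c :
    move [:: (i, Cup b); (i, Cross c)] [:: (i, Cup (~~ b))]
| move_R2 i c :
    move [:: (i, Cross c); (i, Cross (~~ c))] [::]
| move_R3 i c :
    move [:: (i, Cross c); (i.+1, Cross c); (i, Cross c)]
         [:: (i.+1, Cross c); (i, Cross c); (i.+1, Cross c)].

Inductive isotopic : diagram -> diagram -> Prop :=
| isotopic_move u v l r :
    is_link (u ++ l ++ v) -> is_link (u ++ r ++ v) -> move l r ->
    isotopic (u ++ l ++ v) (u ++ r ++ v)
| isotopic_refl w : isotopic w w
| isotopic_sym w1 w2 : isotopic w1 w2 -> isotopic w2 w1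
| isotopic_trans w1 w2 w3 :
    isotopic w1 w2 -> isotopic w2 w3 -> isotopic w1 w3.

(* Words representing the elements of B_(k+1), read from bottom to top:
   (i, true) is the generator sigma_(i+1), (i, false) is its inverse. *)
Definition braid_word (k : nat) := seq ('I_k * bool).

(* The closing strands run downwards, to the right of the braid. *)
Definition braid_closure (k : nat) (w : braid_word k) : diagram :=
  [seq (j, Cup true) | j <- iota 0 k.+1]
  ++ [seq (val x.1, Cross x.2) | x <- w]
  ++ [seq (j, Cap) | j <- rev (iota 0 k.+1)].

Definition Qqs : fieldType := {fraction {poly {poly rat}}}.

Definition q : Qqs := tofrac ('X%:P).
Definition s : Qqs := tofrac 'X.

Lemma q_neq0 : q != 0.
Proof. by rewrite /q tofrac_eq0 polyC_eq0 polyX_eq0. Qed.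

Lemma s_neq0 : s != 0.
Proof. by rewrite /s tofrac_eq0 polyX_eq0. Qed.

Lemma q2_neq1 : q ^+ 2 - 1 != 0.
Proof.
rewrite subr_eq0 /q -tofrac1 -tofracXn tofrac_eq -polyC1 -polyC_exp.
rewrite (inj_eq (@polyC_inj _)).
apply/eqP => /(congr1 (fun p : {poly rat} => p`_2)).
by rewrite coefXn coefC.
Qed.

(* Operators are matrices acting on row vectors on the right: row i of a
   matrix is the image of the i-th basis vector, and the composite "B then A"
   is B *m A.  The index i of E_i, F_i, K_i and x_i starts at 0 below. *)

Definition cartan (i j : 'I_2) : int :=
  if i == j then (if i == 0 then 2 else 0) else -1.

Definition gen_odd (i : 'I_2) : bool := i == 1.

(* The action of the generators in the basis x_0, x_1 = F_2 x_0,
   x_2 = F_1 x_1, x_3 = F_2 x_2; that of the K_i and E_i follows from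
   E_i x_0 = 0, K_1 x_0 = x_0, K_2 x_0 = s x_0 and the relations of U_q. *)
Definition actF (i : 'I_2) : 'M[Qqs]_4 :=
  if i == 0 then delta_mx 1 2 else delta_mx 0 1 + delta_mx 2 3.

Definition actK (i : 'I_2) : 'M[Qqs]_4 :=
  diag_mx (\row_(j < 4) (if i == 0 then [:: 1; q; q^-1; 1]
                         else [:: s; s; q * s; q * s])`_j).

Definition actE (i : 'I_2) : 'M[Qqs]_4 :=
  if i == 0 then delta_mx 2 1
  else ((s - s^-1) / (q - q^-1)) *: delta_mx 1 0
       + ((q * s - (q * s)^-1) / (q - q^-1)) *: delta_mx 3 2.

Lemma invmx_actK i : invmx (actK i) =
  diag_mx (\row_(j < 4) (if i == 0 then [:: 1; q^-1; q; 1]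
                         else [:: s^-1; s^-1; (q * s)^-1; (q * s)^-1])`_j).
Proof.
rewrite /actK; move: q_neq0 s_neq0; move: q s; move: Qqs => K q s q0 s0.
set A := diag_mx _; set D := diag_mx _.
suff H : D *m A = 1%:M.
  have [_ Hu] := mulmx1_unit H.
  by rewrite -[D]mulmx1 -(mulmxV Hu) mulmxA H mul1mx.
rewrite mulmx_diag; apply/matrixP => j k; rewrite !mxE; congr (_ *+ _).
have qs0 : q * s != 0 by rewrite mulf_neq0.
by case: ifP => _; case: j => -[|[|[|[|]]]] //= _; rewrite ?mulr1 ?mulVf ?mulfV.
Qed.

Lemma delta_diag (K : fieldType) n (i j : 'I_n) (d : 'rV[K]_n) :
  delta_mx i j *m diag_mx d = d 0 j *: delta_mx i j.
Proof.
apply/matrixP => a b; rewrite mul_mx_diag !mxE mulrC.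
by have [->|] := eqVneq b j; rewrite ?andbF ?mulr0.
Qed.

Lemma diag_delta (K : fieldType) n (i j : 'I_n) (d : 'rV[K]_n) :
  diag_mx d *m delta_mx i j = d 0 i *: delta_mx i j.
Proof.
apply/matrixP => a b; rewrite mul_diag_mx !mxE.
by have [->|] := eqVneq a i; rewrite ?mulr0.
Qed.

(* Products are in the reversed order because operators act on the right. *)
Lemma V_relations (i j : 'I_2) :
  [/\ actE j *m actK i = q ^ cartan i j *: (actK i *m actE j),
      actF j *m actK i = q ^ (- cartan i j) *: (actK i *m actF j),
      actF j *m actE i
      = (-1) ^+ (gen_odd i && gen_odd j) *: (actE i *m actF j)
        + (i == j)%:R *: ((q - q^-1)^-1 *: (actK i - invmx (actK i))),
      actE 1 *m actE 1 = 0 & actF 1 *m actF 1 = 0].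
Proof.
rewrite invmx_actK /cartan /gen_odd /actE /actF /actK.
move: q_neq0 s_neq0 q2_neq1; move: q s; move: Qqs => K q s q0 s0 qq.
pose R := (delta_diag, diag_delta, mulmxDl, mulmxDr, scalerDr, scalerA,
  mul_delta_mx_cond, =^~ scalemxAl, =^~ scalemxAr).
have RK (x y x' y' : K) (A B : 'M_4) : x = x' -> y = y' ->
    x *: A + y *: B = x' *: A + y' *: B by move=> -> ->.
have qN2 : q ^ (-2) = q ^- 2 by [].
have fin2 (P : 'I_2 -> 'I_2 -> Prop) :
    P 0 0 -> P 0 1 -> P 1 0 -> P 1 1 -> forall i j, P i j.
  move=> P00 P01 P10 P11 i' j'.
  have i01 (k : 'I_2) : k = 0 \/ k = 1.
    by case: k => [[|[|//]] Hk]; [left | right]; apply: val_inj.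
  by case: (i01 i') => ->; case: (i01 j') => ->.
split.
{ move: i j; apply: fin2; rewrite /= !R /= ?mxE /=;
    try apply: RK; try congr (_ *: _);
    rewrite ?expr1z ?expr0z ?exprN1; by field; rewrite ?q0 ?s0 ?qq. }
{ move: i j; apply: fin2; rewrite /= !R /= ?mxE /=;
    try apply: RK; try congr (_ *: _);
    rewrite ?expr1z ?expr0z ?exprN1 ?opprK ?oppr0 ?qN2;
    by field; rewrite ?q0 ?s0 ?qq. }
{ move: i j; apply: fin2; rewrite /= !R /= ?mulr0n ?scaler0 ?scale0r ?addr0 //;
  apply/matrixP => a b; rewrite !mxE /=;
  case: b => [[|[|[|[|//]]]] Hb]; case: a => [[|[|[|[|//]]]] Ha];
  rewrite /= ?(mulr1n, mulr0n, mulr0, mul0r, mulr1, mul1r, addr0, add0r,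
               subr0, subrr) //; by field; rewrite ?q0 ?s0 ?qq. }
{ by rewrite /= !R /= !mulr0n !scaler0 !addr0. }
{ by rewrite /= !R /= !mulr0n !addr0. }
Qed.

Definition parityV : 'M[Qqs]_4 :=
  diag_mx (\row_(j < 4) [:: 1; -1; -1; 1]`_j).

(* The matrix of v |-> (-1)^(|g||v|) v, g being the i-th E or F. *)
Definition koszul (i : 'I_2) : 'M[Qqs]_4 := if gen_odd i then parityV else 1%:M.

Definition VV_E (i : 'I_2) : 'M[Qqs]_(4 * 4) :=
  actE i *t actK i + koszul i *t actE i.
Definition VV_F (i : 'I_2) : 'M[Qqs]_(4 * 4) :=
  actF i *t 1%:M + (koszul i *m invmx (actK i)) *t actF i.
Definition VV_K (i : 'I_2) : 'M[Qqs]_(4 * 4) := actK i *t actK i.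

(* The highest weight vectors of V (x) V of weight (k1, k2). *)
Definition highest_weight (k1 k2 : Qqs) : 'M[Qqs]_(4 * 4) :=
  (kermx (VV_E 0) :&: kermx (VV_E 1)
   :&: eigenspace (VV_K 0) k1 :&: eigenspace (VV_K 1) k2)%MS.

(* 16 = dim (V (x) V) iterations are enough to reach a submodule. *)
Definition submodule_generated (W : 'M[Qqs]_(4 * 4)) : 'M[Qqs]_(4 * 4) :=
  iter 16 (fun X =>
    (X + \sum_(i < 2) (X *m VV_E i + X *m VV_F i
                       + X *m VV_K i + X *m invmx (VV_K i)))%MS) W.

Definition summand1 := submodule_generated (highest_weight 1 (s ^+ 2)).
Definition summand2 := submodule_generated (highest_weight q (s ^+ 2)).
Definition summand3 := submodule_generated (highest_weight 1 (q * s ^+ 2)).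

(* proj_mx A B is the projection onto A along B. *)
Definition sigma : 'M[Qqs]_(4 * 4) :=
  s ^+ 2 *: proj_mx summand1 (summand2 + summand3)%MS
  - proj_mx summand2 (summand1 + summand3)%MS
  + (q ^- 2 * s ^- 2) *: proj_mx summand3 (summand1 + summand2)%MS.

Definition mu : 'I_4 -> Qqs :=
  fun i => [:: s ^- 2; - s ^- 2; - (q ^- 2 * s ^- 2); q ^- 2 * s ^- 2]`_i.

(* An operator A on the m-th tensor power of V: A a b is the coefficient of
   x_b in the image of x_a, where x_a is the tensor product of the x_(a_i). *)
Definition tensor_op (m : nat) := m.-tuple 'I_4 -> m.-tuple 'I_4 -> Qqs.

(* The matrix R : V (x) V -> V (x) V acting on the factors i and i + 1. *)
Definition act_at (k : nat) (i : 'I_k) (R : 'M[Qqs]_(4 * 4)) :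
    tensor_op k.+1 := fun a b =>
  let l := widen_ord (leqnSn k) i in let r := lift ord0 i in
  R (mxtens_index (tnth a l, tnth a r)) (mxtens_index (tnth b l, tnth b r))
  * \prod_(j | (j != l) && (j != r)) (tnth a j == tnth b j)%:R.

Fixpoint psi (k : nat) (w : braid_word k) : tensor_op k.+1 :=
  match w with
  | [::] => fun a b => (a == b)%:R
  | (i, e) :: w' => fun a b =>
      \sum_c act_at i (if e then sigma else invmx sigma) a c * psi w' c b
  end.

(* The partial trace over the factors 2, .., k + 1 of
   (id (x) mu^(x) k) o psi(w). *)
Definition partial_trace (k : nat) (w : braid_word k) : 'M[Qqs]_4 :=
  \matrix_(a, b) \sum_(c : k.-tuple 'I_4)
    psi w [tuple of a :: c] [tuple of b :: c] * \prod_(j < k) mu (tnth c j).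

(* LG_L = c.  Some braid closes to L, and every braid that does gives c. *)
Definition LG_is (L : diagram) (c : Qqs) : Prop :=
  (exists (k : nat) (w : braid_word k), isotopic (braid_closure w) L)
  /\ (forall (k : nat) (w : braid_word k),
        isotopic (braid_closure w) L -> partial_trace w = c%:M).

(* The tangles below have orientation up_down at the bottom (BL, BR) and at
   the top (TL, TR). *)
Definition up_down := [:: true; false].

(* Two parallel strands crossing two parallel strands. *)
Definition doubled_crossing (i : nat) (b : bool) : diagram :=
  [:: (i.+1, Cross b); (i, Cross b); (i.+2, Cross b); (i.+1, Cross b)].

(* The doubled cup and the doubled cap close the right strand of the 2-braid
   on the right.  The last six crossings are between antiparallel strands. *)
Definition trefoil_double : diagram :=
  [:: (2%N, Cup true); (3%N, Cup false)]
  ++ flatten (nseq 3 (doubled_crossing 0 true))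
  ++ [:: (3%N, Cap); (2%N, Cap)]
  ++ nseq 6 (0%N, Cross false).

(* The minimum of the cup TR -> TL lies below the maximum of the cap BL -> BR;
   in both crossings the two strands are parallel. *)
Definition clasp (e : bool) : diagram :=
  [:: (1%N, Cup true); (0%N, Cross e); (2%N, Cross e); (1%N, Cap)].

Definition TT (e : bool) : diagram := trefoil_double ++ clasp e.

Definition hcat (f g : diagram) : diagram :=
  (1%N, Cup false) :: f ++ shift 2 g ++ [:: (1%N, Cap)].

Definition cap_cup : diagram := [:: (0%N, Cap); (0%N, Cup true)].

(* Besides f, the closure consists of
   - the arc from BR to BL, below f;
   - the arc from TL to TR, which goes around the right-hand side and below
     everything else, then up on the left of f;
   - a counterclockwise circle around the ascending part of this second arc and
     the strand entering f at BL, above both of them in its lower half and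
     below both of them in its upper half.
   Above f the second arc crosses itself, at a crossing of the strand leaving
   TL with the strand going into TR.  This crossing is positive: the closure of
   the identity tangle is then the torus link T(2,4) with parallel
   orientations, whose invariant is AS_form e1 (at q = 1 this is the square of
   the Conway polynomial z^3 + 2 z).  With the other crossing it would be T(2,4)
   with antiparallel orientations, for which AS_form e1 is not the invariant. *)
Definition AS_closure (f : diagram) : diagram :=
  (* the lowest points of the second arc and of the first one *)
  [:: (0%N, Cup true); (1%N, Cup true)]
  (* the circle *)
  ++ [:: (0%N, Cup false); (1%N, Cross true); (2%N, Cross true);
         (2%N, Cross true); (1%N, Cross true); (0%N, Cap)]
  ++ shift 1 f
  (* the self-crossing and the highest points of the second arc *)
  ++ [:: (1%N, Cross false); (0%N, Cap); (0%N, Cap)].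

Definition AS (n : nat) : diagram :=
  AS_closure (iterop n hcat (hcat (TT true) (TT false)) cap_cup).

Lemma is_tangle_hcat f g :
  is_tangle up_down up_down f -> is_tangle up_down up_down g ->
  is_tangle up_down up_down (hcat f g).
Proof.
move=> Hf Hg; rewrite /is_tangle /hcat /= top_of_cat.
have /= := is_tangle_context [::] up_down Hf.
rewrite /is_tangle (_ : shift 0 f = f); last by elim: (f) => //= -[] ? ? ? ->.
move=> -> /=; rewrite top_of_cat.
by have /= := is_tangle_context up_down [::] Hg; rewrite /is_tangle => ->.
Qed.

Lemma is_tangle_TT e : is_tangle up_down up_down (TT e).
Proof. by case: e. Qed.

Lemma is_link_AS n : is_link (AS n).
Proof.
rewrite /AS; set f := iterop _ _ _ _.
have Hf : is_tangle up_down up_down f.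
  rewrite {}/f; have := is_tangle_hcat (is_tangle_TT true) (is_tangle_TT false).
  move: (hcat _ _) => g Hg; case: n => // n; rewrite iteropS.
  elim: n => [|n IHn]; first exact: Hg.
  exact: (is_tangle_hcat Hg IHn).
rewrite /is_link /is_tangle /AS_closure !top_of_cat /= top_of_cat.
have /= := is_tangle_context [:: true] [:: false] Hf.
by rewrite /is_tangle => ->.
Qed.

(* Only a_ 2, a_ 4 and a_ 6 are used. *)
Definition a_ (m : nat) : Qqs := s ^+ m + q ^- m * s ^- m.

Definition coords := 'rV[Qqs]_3.

Definition vec3 (c1 c2 c3 : Qqs) : coords := \row_(i < 3) [:: c1; c2; c3]`_i.

Definition e1 : coords := vec3 1 0 0.
Definition e2 : coords := vec3 0 1 0.
Definition e3 : coords := vec3 0 0 1.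

Definition basis_box (i j : 'I_3) : coords :=
  match val i, val j with
  | 1, _ => delta_mx 0 j
  | _, 1 => delta_mx 0 i
  | 0, 0 => 0
  | 0, _ | _, 0 => (s ^+ 2 + q ^- 2 * s ^- 2 - 1 - q ^- 2) *: e1
  | _, _ =>
      (a_ 2 * (1 + q ^- 2) - 3 * q ^- 2 - q ^- 4) *: e1
      + (- a_ 4 + a_ 2 * (3 + q ^- 2) - 2 - 4 * q ^- 2) *: e2
      + (2 * a_ 2 - 3 - q ^- 2) *: e3
  end.

Definition box (x y : coords) : coords :=
  \sum_i \sum_j (x 0 i * y 0 j) *: basis_box i j.

Definition Tplus : coords := vec3
  (a_ 2 * (1 - 2 * q ^- 2 + 2 * q ^- 4 - 2 * q ^- 6 + 4 * q ^- 8
           - 2 * q ^- 10)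
   - 2 + 3 * q ^- 2 - 4 * q ^- 4 + 4 * q ^- 6 - 8 * q ^- 8 + 4 * q ^- 10)
  (a_ 4 * (2 - 2 * q ^- 2 - 4 * q ^- 6 + 4 * q ^- 8)
   + a_ 2 * (- 5 + 4 * q ^- 2 + 12 * q ^- 6 - 8 * q ^- 8 - 4 * q ^- 10)
   + 4 + 3 * q ^- 2 - 6 * q ^- 4 - 6 * q ^- 6 - 8 * q ^- 8 + 16 * q ^- 10)
  (a_ 2 * (2 * q ^- 2 - 2 * q ^- 4 + 2 * q ^- 6 - 4 * q ^- 8 + 2 * q ^- 10)
   + 1 - 4 * q ^- 2 + 4 * q ^- 4 - 4 * q ^- 6 + 8 * q ^- 8 - 4 * q ^- 10).

Definition Tminus : coords := vec3
  (a_ 2 * (q ^+ 2 - 2 + 2 * q ^- 2 - 2 * q ^- 4 + 4 * q ^- 6 - 2 * q ^- 8)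
   - 1 + 4 * q ^- 2 - 4 * q ^- 4 + 4 * q ^- 6 - 8 * q ^- 8 + 4 * q ^- 10)
  (a_ 4 * (2 * q ^+ 2 - 2 - 4 * q ^- 4 + 4 * q ^- 6)
   + a_ 2 * (- 3 * q ^+ 2 - 4 + 8 * q ^- 2 + 4 * q ^- 4 + 8 * q ^- 6
             - 12 * q ^- 8)
   + q ^+ 2 + 10 - 6 * q ^- 2 - 6 * q ^- 4 - 16 * q ^- 6 + 8 * q ^- 8
   + 8 * q ^- 10)
  (a_ 2 * (2 - 2 * q ^- 2 + 2 * q ^- 4 - 4 * q ^- 6 + 2 * q ^- 8)
   - q ^+ 2 - 4 * q ^- 2 + 4 * q ^- 4 - 4 * q ^- 6 + 8 * q ^- 8
   - 4 * q ^- 10).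

Definition AS_form (x : coords) : Qqs :=
  x 0 0 * (a_ 6 - a_ 4 * (1 + q ^- 2) + a_ 2 * (1 + 2 * q ^- 2)
           - 1 - 2 * q ^- 2 - q ^- 4)
  + x 0 1 * (a_ 4 - a_ 2 * (2 + 2 * q ^- 2) + 1 + 4 * q ^- 2 + q ^- 4)
  + x 0 2 * (a_ 6 * (3 + q ^- 2) - a_ 4 * (7 + 8 * q ^- 2 + q ^- 4)
             + a_ 2 * (7 + 18 * q ^- 2 + 7 * q ^- 4)
             - 3 - 18 * q ^- 2 - 17 * q ^- 4 - 2 * q ^- 6).

(* Main.v *)
Require Import Defs.
From Stdlib Require Import BinInt.
From HB Require Import structures.
From mathcomp Require Import all_boot all_order all_algebra.
From mathcomp Require Import fraction mxtens ssrZ zify ring.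

Set Implicit Arguments.
Unset Strict Implicit.
Unset Printing Implicit Defensive.

Import GRing.Theory Num.Theory.
Local Open Scope ring_scope.

(** [LG_is] asks that some braid close to AS(n) and that every such braid have the same partial
    trace. The second part bypasses Markov's theorem: the value is defined on all slice diagrams,
    antiparallel crossings included, and is shown to be invariant under the very moves that generate
    [isotopic]. All moves except [move_far] are local pictures of bounded width, so both sides are
    evaluated on every labelling, with Laurent polynomials as coefficients. The number three has a
    conceptual origin: the invariant functionals in question correspond to the endomorphisms of V
    (x) V, a sum of three pairwise non-isomorphic irreducibles. The bound itself is obtained by
    elimination in the linear equations of invariance. [sigma] is defined through kernels, sums of
    row spaces and projections, so it cannot be evaluated; it is recognised by its eigenspaces.
    Identities are decided on coefficients, whereas the non-vanishing of pivots and determinants is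
    certified by the specialisation q = 2, s = 3. *)

(* A diagram cut into slices is evaluated by labelling its strands with the
   basis of V; the evaluation is a U_q-invariant functional and is unchanged by
   the moves.  A link, opened at its first minimum, yields a scalar multiple of
   the maximum.  This scalar could only depend on which minimum comes first, and
   does not, because the invariant functionals on V (x) V* (x) V (x) V* are
   spanned by three explicit tangles.  As sigma is the matrix of the crossing,
   the scalar of a braid closure is its partial trace.  The same three tangles,
   identity, cap-cup and full twist, span the values of all antiparallel
   two-strand tangles that occur in AS(n), so that its invariant is computed in
   the algebra A.  Finally AS(n) is a braid closure by Alexander's theorem: all
   upward strands are gathered to the left at every level, after which each
   event is absorbed by a braid with partially closed strands. *)

(** * Laurent polynomials with integer coefficients *)

(* The monomial ((i, j), c) stands for c q^i s^j.  The lists are kept sorted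
   and without zero coefficients, so that equality can be tested by
   computation, but nothing below relies on this. *)
Definition monomial := ((Z * Z) * Z)%type.
Definition laurent := seq monomial.

Definition exp_compare (e f : Z * Z) : comparison :=
  match Z.compare e.1 f.1 with Eq => Z.compare e.2 f.2 | c => c end.

Fixpoint ladd (p : laurent) : laurent -> laurent :=
  match p with
  | [::] => id
  | m :: p' =>
      fix ladd_m (r : laurent) : laurent :=
        match r with
        | [::] => p
        | n :: r' =>
            match exp_compare m.1 n.1 with
            | Lt => m :: ladd p' r
            | Gt => n :: ladd_m r'
            | Eq => let c := Z.add m.2 n.2 in
                if Z.eqb c Z0 then ladd p' r' else (m.1, c) :: ladd p' r'
            end
        end
  end.

Definition mon_mul (m n : monomial) : monomial :=
  ((Z.add m.1.1 n.1.1, Z.add m.1.2 n.1.2), Z.mul m.2 n.2).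

Definition lmul (p r : laurent) : laurent :=
  foldr (fun m acc => ladd [seq mon_mul m n | n <- r] acc) [::] p.

Definition lopp (p : laurent) : laurent := [seq (m.1, Z.opp m.2) | m <- p].

Definition mon (c i j : Z) : monomial := ((i, j), c).
Definition lmon (c i j : Z) : laurent := [:: mon c i j].
Definition l1 : laurent := lmon 1 0 0.

Definition lnorm (p : laurent) : laurent :=
  foldr (fun m => ladd [:: m]) [::] p.
Definition lzero (p : laurent) : bool :=
  if lnorm p is [::] then true else false.
Definition leqb (p r : laurent) : bool := lzero (ladd p (lopp r)).

Definition laurent_eval (K : fieldType) (x y : K) (p : laurent) : K :=
  \sum_(m <- p) (int_of_Z m.2)%:~R * x ^ int_of_Z m.1.1 * y ^ int_of_Z m.1.2.

(* Nonvanishing is tested at q = 2, s = 3, after a multiplication by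
   (q s)^64. *)
Definition spec_nonzero (p : laurent) : bool :=
  all (fun m : monomial =>
         Z.leb 0 (Z.add m.1.1 64) && Z.leb 0 (Z.add m.1.2 64)) p
  && ~~ Z.eqb 0 (foldr (fun (m : monomial) acc =>
       Z.add (Z.mul m.2 (Z.mul (Z.pow 2 (Z.add m.1.1 64))
                               (Z.pow 3 (Z.add m.1.2 64)))) acc) Z0 p).

(** An abstract field with two marked elements keeps the concrete field of fractions out of the
    computations. [eval_neq0] stands in for the algebraic independence of q and s, in the only form
    used: a certificate found by evaluation. *)
Class qsField (K : fieldType) := QsField {
  qv : K;
  sv : K;
  qv_neq0 : qv != 0;
  sv_neq0 : sv != 0;
  eval_neq0 : forall p, spec_nonzero p -> laurent_eval qv sv p != 0 }.

Section LaurentEval.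
Context {K : fieldType} {qs : qsField K}.

Definition ev (p : laurent) : K := laurent_eval qv sv p.

Lemma ev_neq0 p : spec_nonzero p -> ev p != 0.
Proof. exact: eval_neq0. Qed.

Lemma ev_nil : ev [::] = 0. Proof. exact: big_nil. Qed.

Lemma ev_cons m p : ev (m :: p) = ev [:: m] + ev p.
Proof. by rewrite /ev /laurent_eval big_cons big_seq1. Qed.

Lemma ev_mon c i j :
  ev [:: ((i, j), c)] = (int_of_Z c)%:~R * qv ^ int_of_Z i * sv ^ int_of_Z j.
Proof. by rewrite /ev /laurent_eval big_seq1. Qed.

Lemma ev1 : ev l1 = 1. Proof. by rewrite ev_mon !expr0z !mulr1. Qed.

Lemma ev_monD e c d : ev [:: (e, Z.add c d)] = ev [:: (e, c)] + ev [:: (e, d)].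
Proof.
case: e => i j; rewrite !ev_mon -!mulrDl; congr (_ * _ * _).
by rewrite -intrD -(rmorphD int_of_Z).
Qed.

Lemma exp_compare_eq e f : exp_compare e f = Eq -> e = f.
Proof.
case: e f => a b [c d]; rewrite /exp_compare /=.
case E: (Z.compare a c) => // /Z.compare_eq ->.
by move/Z.compare_eq: E => ->.
Qed.

Lemma ev_ladd p r : ev (ladd p r) = ev p + ev r.
Proof.
elim: p r => [|m p IHp] r; first by rewrite ev_nil add0r.
elim: r => [|n r IHr]; first by rewrite ev_nil addr0.
rewrite /=; case E: exp_compare.
- have e := exp_compare_eq E; case: ifP => [/Z.eqb_eq c0|_].
    rewrite IHp (ev_cons m p) (ev_cons n r) addrACA.
    suff -> : ev [:: m] + ev [:: n] = 0 by rewrite add0r.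
    move: e c0; clear; case: m n => [em c] [en d] /= <- c0.
    by rewrite -ev_monD c0; case: em => i j; rewrite ev_mon !mul0r.
  rewrite [LHS]ev_cons IHp (ev_cons m p) (ev_cons n r) addrACA; congr (_ + _).
  by move: e; clear; case: m n => [em c] [en d] /= <-; rewrite ev_monD.
- by rewrite [LHS]ev_cons IHp (ev_cons m p) addrA.
- by rewrite [LHS]ev_cons -/(ladd (m :: p) r) IHr (ev_cons n r) addrCA.
Qed.

Lemma ev_mon_mul m n : ev [:: mon_mul m n] = ev [:: m] * ev [:: n].
Proof.
case: m n => [[i j] c] [[k l] d]; rewrite /mon_mul /= !ev_mon.
rewrite (rmorphM int_of_Z) intrM !(rmorphD int_of_Z).
rewrite !expfzDr ?qv_neq0 ?sv_neq0 //=.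
by ring.
Qed.

Lemma ev_lmul p r : ev (lmul p r) = ev p * ev r.
Proof.
elim: p => [|m p IHp] /=; first by rewrite ev_nil mul0r.
rewrite ev_ladd IHp (ev_cons m p) mulrDl; congr (_ + _).
elim: r {IHp} => [|n r IHr] /=; first by rewrite ev_nil mulr0.
by rewrite [LHS]ev_cons ev_mon_mul IHr (ev_cons n r) mulrDr.
Qed.

Lemma ev_lopp p : ev (lopp p) = - ev p.
Proof.
elim: p => [|[e c] p IHp] /=; first by rewrite ev_nil oppr0.
rewrite [LHS]ev_cons IHp (ev_cons (e, c) p) opprD; congr (_ + _).
case: e => i j; rewrite !ev_mon (rmorphN int_of_Z).
by rewrite mulrNz !mulNr.
Qed.

Lemma lzeroP p : lzero p -> ev p = 0.
Proof.
have E : ev (lnorm p) = ev p.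
  elim: p => [//|m p IHp].
  by rewrite -[lnorm _]/(ladd [:: m] (lnorm p)) ev_ladd IHp -ev_cons.
by rewrite /lzero -E; case: lnorm => //; rewrite ev_nil.
Qed.

Lemma leqbP p r : leqb p r -> ev p = ev r.
Proof. by move/lzeroP/eqP; rewrite ev_ladd ev_lopp subr_eq0 => /eqP. Qed.

End LaurentEval.

(** * Evaluation of diagrams *)

(** The basis of V as an enumerated type: unlike ['I_4] it carries no proofs, which suits
    [vm_compute]. *)
Inductive lab := X0 | X1 | X2 | X3.

Definition lab_eqb (x y : lab) : bool :=
  match x, y with
  | X0, X0 | X1, X1 | X2, X2 | X3, X3 => true
  | _, _ => false
  end.

Lemma lab_eqP : Equality.axiom lab_eqb.
Proof. by case; case; constructor. Qed.

HB.instance Definition _ := hasDecEq.Build lab lab_eqP.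

Definition labs := [:: X0; X1; X2; X3].

Lemma mem_labs x : x \in labs. Proof. by case: x. Qed.

Definition state := seq lab.
Definition vec := seq (state * laurent).

(** The claimed matrix of the braiding: the entry at [x], [y] is the image of x (x) y. Invariance
    under the moves is checked on this table directly; that it agrees with [sigma] is the separate
    statement [sigmaE]. *)
Definition R_table (x y : lab) : seq ((lab * lab) * laurent) :=
  match x, y with
  | X0, X0 => [:: ((X0, X0), [:: mon 1 0 2])]
  | X0, X1 => [:: ((X1, X0), [:: mon 1 0 1])]
  | X0, X2 => [:: ((X2, X0), [:: mon 1 0 1])]
  | X0, X3 => [:: ((X3, X0), [:: mon 1 0 0])]
  | X1, X0 => [:: ((X0, X1), [:: mon 1 0 1]);
      ((X1, X0), [:: mon (-1) 0 0; mon 1 0 2])]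
  | X1, X1 => [:: ((X1, X1), [:: mon (-1) 0 0])]
  | X1, X2 => [:: ((X2, X1), [:: mon (-1) (-1) 0]);
      ((X3, X0), [:: mon (-1) 0 (-1); mon 1 0 1])]
  | X1, X3 => [:: ((X3, X1), [:: mon 1 (-1) (-1)])]
  | X2, X0 => [:: ((X0, X2), [:: mon 1 0 1]);
      ((X2, X0), [:: mon (-1) 0 0; mon 1 0 2])]
  | X2, X1 => [:: ((X1, X2), [:: mon (-1) (-1) 0]);
      ((X2, X1), [:: mon 1 (-2) 0; mon (-1) 0 0]);
      ((X3, X0), [:: mon 1 (-1) (-1); mon (-1) (-1) 1])]
  | X2, X2 => [:: ((X2, X2), [:: mon (-1) 0 0])]
  | X2, X3 => [:: ((X3, X2), [:: mon 1 (-1) (-1)])]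
  | X3, X0 => [:: ((X0, X3), [:: mon 1 0 0]);
      ((X1, X2), [:: mon (-1) (-2) (-1); mon 1 0 1]);
      ((X2, X1), [:: mon 1 (-3) (-1); mon (-1) (-1) 1]);
      ((X3, X0), [:: mon 1 (-2) (-2); mon (-1) (-2) 0; mon (-1) 0 0; mon 1 0 2])]
  | X3, X1 => [:: ((X1, X3), [:: mon 1 (-1) (-1)]);
      ((X3, X1), [:: mon 1 (-2) (-2); mon (-1) 0 0])]
  | X3, X2 => [:: ((X2, X3), [:: mon 1 (-1) (-1)]);
      ((X3, X2), [:: mon 1 (-2) (-2); mon (-1) 0 0])]
  | X3, X3 => [:: ((X3, X3), [:: mon 1 (-2) (-2)])]
  end.

Definition Rinv_table (x y : lab) : seq ((lab * lab) * laurent) :=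
  match x, y with
  | X0, X0 => [:: ((X0, X0), [:: mon 1 0 (-2)])]
  | X0, X1 => [:: ((X0, X1), [:: mon 1 0 (-2); mon (-1) 0 0]);
      ((X1, X0), [:: mon 1 0 (-1)])]
  | X0, X2 => [:: ((X0, X2), [:: mon 1 0 (-2); mon (-1) 0 0]);
      ((X2, X0), [:: mon 1 0 (-1)])]
  | X0, X3 => [:: ((X0, X3), [:: mon 1 0 (-2); mon (-1) 0 0; mon (-1) 2 0; mon 1 2 2]);
      ((X1, X2), [:: mon 1 0 (-1); mon (-1) 2 1]);
      ((X2, X1), [:: mon (-1) (-1) (-1); mon 1 1 1]);
      ((X3, X0), [:: mon 1 0 0])]
  | X1, X0 => [:: ((X0, X1), [:: mon 1 0 (-1)])]
  | X1, X1 => [:: ((X1, X1), [:: mon (-1) 0 0])]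
  | X1, X2 => [:: ((X0, X3), [:: mon 1 2 (-1); mon (-1) 2 1]);
      ((X1, X2), [:: mon (-1) 0 0; mon 1 2 0]);
      ((X2, X1), [:: mon (-1) 1 0])]
  | X1, X3 => [:: ((X1, X3), [:: mon (-1) 0 0; mon 1 2 2]);
      ((X3, X1), [:: mon 1 1 1])]
  | X2, X0 => [:: ((X0, X2), [:: mon 1 0 (-1)])]
  | X2, X1 => [:: ((X0, X3), [:: mon (-1) 1 (-1); mon 1 1 1]);
      ((X1, X2), [:: mon (-1) 1 0])]
  | X2, X2 => [:: ((X2, X2), [:: mon (-1) 0 0])]
  | X2, X3 => [:: ((X2, X3), [:: mon (-1) 0 0; mon 1 2 2]);
      ((X3, X2), [:: mon 1 1 1])]
  | X3, X0 => [:: ((X0, X3), [:: mon 1 0 0])]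
  | X3, X1 => [:: ((X1, X3), [:: mon 1 1 1])]
  | X3, X2 => [:: ((X2, X3), [:: mon 1 1 1])]
  | X3, X3 => [:: ((X3, X3), [:: mon 1 2 2])]
  end.

Definition mu_laurent (x : lab) : laurent :=
  match x with
  | X0 => lmon 1 0 (-2)
  | X1 => lmon (-1) 0 (-2)
  | X2 => lmon (-1) (-2) (-2)
  | X3 => lmon 1 (-2) (-2)
  end.

Definition mu_inv_laurent (x : lab) : laurent :=
  match x with
  | X0 => lmon 1 0 2
  | X1 => lmon (-1) 0 2
  | X2 => lmon (-1) 2 2
  | X3 => lmon 1 2 2
  end.

(** A zigzag joins [Cup b] to a cap whose left leg has direction [~~ b], so these two weights must
    be inverse to each other. The factor mu is put on the caps whose left leg goes up, which are the
    ones that close a braid on the right. *)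
Definition cup_weight (b : bool) (x : lab) : laurent :=
  if b then l1 else mu_inv_laurent x.
Definition cup_weight_inv (b : bool) (x : lab) : laurent :=
  if b then l1 else mu_laurent x.
Definition cap_weight (b : bool) (x : lab) : laurent :=
  if b then mu_laurent x else l1.

Definition table := lab -> lab -> seq ((lab * lab) * laurent).

(* The weights of a crossing whose left strand is reversed are imposed by
   move_slide_cup. *)
Definition rotate (b : bool) (t : table) : table := fun k x =>
  flatten [seq [seq ((m.1.2, j),
                     lmul (lmul m.2 (cup_weight b j)) (cup_weight_inv b k))
               | m <- t x j & lab_eqb m.1.1 k] | j <- labs].

Definition tabulate (t : table) : seq (seq (seq ((lab * lab) * laurent))) :=
  [seq [seq t x y | y <- labs] | x <- labs].
Definition lab_nat (x : lab) : nat :=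
  match x with X0 => 0 | X1 => 1 | X2 => 2 | X3 => 3 end.
Definition lookup l : table := fun x y =>
  nth [::] (nth [::] l (lab_nat x)) (lab_nat y).

Definition cross_tt (c : bool) : table := if c then R_table else Rinv_table.
(** [rotate b] turns the table for directions (d, b) into the one for (~~ b, d) and the opposite
    type of crossing, whence the chain tt, ft, ff, tf. Each table is evaluated once, when it is
    defined. That the fourth rotation leads back to tt is part of the check of [move_slide_cup]. *)
Definition ft_list (c : bool) :=
  Eval vm_compute in
    if c then tabulate (rotate true (cross_tt false))
    else tabulate (rotate true (cross_tt true)).
Definition cross_ft (c : bool) : table := lookup (ft_list c).
Definition ff_list (c : bool) :=
  Eval vm_compute in
    if c then tabulate (rotate true (cross_ft false))
    else tabulate (rotate true (cross_ft true)).
Definition cross_ff (c : bool) : table := lookup (ff_list c).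
Definition tf_list (c : bool) :=
  Eval vm_compute in
    if c then tabulate (rotate false (cross_ff false))
    else tabulate (rotate false (cross_ff true)).
Definition cross_tf (c : bool) : table := lookup (tf_list c).

Definition cross_table (b d c : bool) : table :=
  match b, d with
  | true, true => cross_tt c
  | true, false => cross_tf c
  | false, true => cross_ft c
  | false, false => cross_ff c
  end.

Definition local_vec (g : event) (bs : seq bool) (x : state) : vec :=
  match g, bs, x with
  | Cup b, _, _ => [seq ([:: l; l], cup_weight b l) | l <- labs]
  | Cap, b :: _, k :: l :: _ =>
      if lab_eqb k l then [:: ([::], cap_weight b k)] else [::]
  | Cross c, b :: d :: _, k :: l :: _ =>
      [seq ([:: m.1.1; m.1.2], m.2) | m <- cross_table b d c k l]
  | _, _, _ => [::]
  end.

Definition step_vec (a : seq bool) (e : nat * event) (x : state) : vec :=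
  let: (i, g) := e in
  [seq (take i x ++ m.1 ++ drop (n_in g) (drop i x), m.2)
  | m <- local_vec g (take (n_in g) (drop i a)) (take (n_in g) (drop i x))].

(** Indexing by the successive labels lets equal states be merged without searching through a
    list. *)
Inductive trie := Empty | Node of laurent & trie & trie & trie & trie.

Fixpoint tinsert (x : state) (p : laurent) (t : trie) {struct x} : trie :=
  let: (r, t0, t1, t2, t3) :=
    match t with
    | Empty => ([::], Empty, Empty, Empty, Empty)
    | Node r t0 t1 t2 t3 => (r, t0, t1, t2, t3)
    end in
  match x with
  | [::] => Node (ladd p r) t0 t1 t2 t3
  | X0 :: x' => Node r (tinsert x' p t0) t1 t2 t3
  | X1 :: x' => Node r t0 (tinsert x' p t1) t2 t3
  | X2 :: x' => Node r t0 t1 (tinsert x' p t2) t3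
  | X3 :: x' => Node r t0 t1 t2 (tinsert x' p t3)
  end.

Fixpoint tlist (t : trie) : vec :=
  if t is Node r t0 t1 t2 t3 then
    (if r is [::] then id else cons ([::], r))
      ([seq (X0 :: m.1, m.2) | m <- tlist t0]
       ++ [seq (X1 :: m.1, m.2) | m <- tlist t1]
       ++ [seq (X2 :: m.1, m.2) | m <- tlist t2]
       ++ [seq (X3 :: m.1, m.2) | m <- tlist t3])
  else [::].

Definition collect (v : vec) : vec :=
  tlist (foldr (fun m => tinsert m.1 m.2) Empty v).

Definition vscale (p : laurent) (v : vec) : vec :=
  [seq (m.1, lmul p m.2) | m <- v].

Definition vmap (f : state -> vec) (v : vec) : vec :=
  flatten [seq vscale m.2 (f m.1) | m <- v].

Fixpoint run (a : seq bool) (w : diagram) (v : vec) : vec :=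
  if w is e :: w' then
    if slice_step a e is Some a' then
      run a' w' (collect (vmap (step_vec a e) v))
    else [::]
  else v.

Definition vzero (v : vec) : bool := all (fun m => lzero m.2) (collect v).
Definition vsub (u v : vec) : vec := u ++ vscale (lmon (-1) 0 0) v.

Section Evaluation.
Context {K : fieldType} {qs : qsField K}.

Definition vdot (v : vec) (phi : state -> K) : K :=
  \sum_(m <- v) ev m.2 * phi m.1.

Lemma vdot_nil phi : vdot [::] phi = 0. Proof. exact: big_nil. Qed.

Lemma vdot_cons m v phi : vdot (m :: v) phi = ev m.2 * phi m.1 + vdot v phi.
Proof. exact: big_cons. Qed.

Lemma vdot_seq1 x p phi : vdot [:: (x, p)] phi = ev p * phi x.
Proof. exact: big_seq1. Qed.

Lemma vdot_cat u v phi : vdot (u ++ v) phi = vdot u phi + vdot v phi.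
Proof. exact: big_cat. Qed.

Lemma vdot_map (f : state -> state) v phi :
  vdot [seq (f m.1, m.2) | m <- v] phi = vdot v (phi \o f).
Proof. exact: big_map. Qed.

Lemma vdot_scale p v phi : vdot (vscale p v) phi = ev p * vdot v phi.
Proof.
rewrite /vdot /vscale big_map mulr_sumr; apply: eq_bigr => m _.
by rewrite ev_lmul mulrA.
Qed.

Lemma vdot_vmap f v phi :
  vdot (vmap f v) phi = vdot v (fun x => vdot (f x) phi).
Proof.
elim: v => [|m v IHv]; first by rewrite !vdot_nil.
by rewrite /vmap /= vdot_cat vdot_scale vdot_cons -IHv.
Qed.

Lemma eq_vdot v phi psi : (forall m, m \in v -> phi m.1 = psi m.1) ->
  vdot v phi = vdot v psi.
Proof. by move=> E; apply: eq_big_seq => m /E ->. Qed.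

Lemma vdot_sub u v phi : vdot (vsub u v) phi = vdot u phi - vdot v phi.
Proof. by rewrite vdot_cat vdot_scale ev_mon !expr0z !mulr1 mulN1r. Qed.

Lemma vdotD v phi psi c d :
  vdot v (fun x => c * phi x + d * psi x) = c * vdot v phi + d * vdot v psi.
Proof.
rewrite /vdot !mulr_sumr -big_split; apply: eq_bigr => m _.
by rewrite mulrDr !(mulrCA (ev _)).
Qed.

Lemma vdot_tinsert x p t phi :
  vdot (tlist (tinsert x p t)) phi = ev p * phi x + vdot (tlist t) phi.
Proof.
have E r v psi : vdot ((if r is [::] then id else cons ([::], r)) v) psi
    = ev r * psi [::] + vdot v psi.
  by case: r => [|m r]; rewrite ?ev_nil ?mul0r ?add0r ?vdot_cons.
elim: x t phi => [|k x IHx] [|r t0 t1 t2 t3] phi; try case: k.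
all: rewrite /= ?E ?ev_ladd ?ev_nil ?vdot_cat ?vdot_map ?IHx ?vdot_nil /=; ring.
Qed.

Lemma vdot_collect v phi : vdot (collect v) phi = vdot v phi.
Proof.
rewrite /collect; elim: v => [//|m v IHv] /=.
by rewrite vdot_tinsert IHv vdot_cons.
Qed.

Lemma vzeroP v phi : vzero v -> vdot v phi = 0.
Proof.
rewrite /vzero -vdot_collect => /allP v0; rewrite /vdot big_seq big1 // => m.
by move=> /v0/lzeroP ->; rewrite mul0r.
Qed.

(* The value of w as a linear map, in dual form: it turns a functional phi on
   the states at the top of w into a functional on the states at the bottom. *)
Fixpoint value (a : seq bool) (w : diagram) (phi : state -> K) : state -> K :=
  if w is e :: w' then
    if slice_step a e is Some a' then
      fun x => vdot (step_vec a e x) (value a' w' phi)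
    else fun=> 0
  else phi.

(** [run] pushes vectors upwards and is what gets computed; [value] pulls functionals downwards and
    is what the proofs manipulate. The two are adjoint, so every computed check becomes a statement
    about [value]. *)
Lemma vdot_run a w v phi : vdot (run a w v) phi = vdot v (value a w phi).
Proof.
elim: w a v => [//|e w IHw] a v /=; case: slice_step => [a'|].
  by rewrite IHw vdot_collect vdot_vmap.
by rewrite vdot_nil /vdot big1 // => m _; rewrite mulr0.
Qed.

Lemma value_cat a u v phi a' : top_of a u = Some a' ->
  value a (u ++ v) phi = value a u (value a' v phi).
Proof.
by elim: u a => [|e u IHu] a /= => [[->] //|]; case: slice_step => //= b /IHu ->.
Qed.

Lemma value_linear a w phi psi c d x :
  value a w (fun y => c * phi y + d * psi y) x
  = c * value a w phi x + d * value a w psi x.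
Proof.
elim: w a x => [//|e w IHw] a x /=; case: slice_step => [b|].
  by rewrite -vdotD; apply: eq_vdot => m _; rewrite IHw.
by rewrite !mulr0 addr0.
Qed.

Lemma value_run a w phi x :
  value a w phi x = vdot (run a w [:: (x, l1)]) phi.
Proof. by rewrite vdot_run vdot_seq1 ev1 mul1r. Qed.

End Evaluation.

(** * Locality *)

Definition local_step (g : event) (a : seq bool) : option (seq bool) :=
  match g, a with
  | Cup b, _ => Some [:: b; ~~ b]
  | Cap, b :: c :: _ => if b != c then Some [::] else None
  | Cross _, b :: c :: _ => Some [:: c; b]
  | _, _ => None
  end.

Lemma slice_step_split p a r g : size a = n_in g ->
  slice_step (p ++ a ++ r) (size p, g)
  = omap (fun b => p ++ b ++ r) (local_step g a).
Proof.
case: g => [b||c] /=; rewrite drop_size_cat //; rewrite take_size_cat //.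
- by move/size0nil => ->; rewrite size_cat leq_addr.
- by case: a => [|b [|c [|]]] //= _; case: ifP.
- by case: a => [|b [|d [|]]].
Qed.

Lemma slice_step_size d i g d' : slice_step d (i, g) = Some d' ->
  (i + n_in g <= size d)%N.
Proof.
have H b c r : drop i d = b :: c :: r -> (i + 2 <= size d)%N.
  move=> E; have := congr1 size E; rewrite size_drop /= => E'.
  by rewrite addnS -ltn_subRL E'.
case: g => [b||c] /=; first by case: ifP => //; rewrite addn0.
- by case E: (drop i d) => [|b [|c r]] // _; apply: H E.
- by case E: (drop i d) => [|b [|c' r]] // _; apply: H E.
Qed.

Lemma split_at (T : Type) (d : seq T) i k : (i + k <= size d)%N ->
  exists p a r, [/\ d = p ++ a ++ r, size p = i & size a = k].
Proof.
move=> le; exists (take i d), (take k (drop i d)), (drop k (drop i d)).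
rewrite !cat_take_drop size_takel ?(leq_trans (leq_addr _ _) le) //; split=> //.
by rewrite size_takel // size_drop leq_subRL ?(leq_trans (leq_addr _ _) le).
Qed.

Lemma slice_step_inv d i g d' : slice_step d (i, g) = Some d' ->
  exists p a b r, [/\ d = p ++ a ++ r, d' = p ++ b ++ r, size p = i,
    size a = n_in g & local_step g a = Some b].
Proof.
move=> H; have [p [a [r [Ed sp sa]]]] := split_at (slice_step_size H).
move: H; rewrite Ed -sp slice_step_split //; case E: local_step => [b|] //= [<-].
by exists p, a, b, r; split.
Qed.

Lemma size_local_step g a b : local_step g a = Some b -> size b = n_out g.
Proof.
by case: g a => [c||c] [|x [|y a]] //=; try (by case=> <-); case: ifP => // _ [<-].
Qed.

Lemma size_local_vec g a x m : m \in local_vec g a x -> size m.1 = n_out g.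
Proof.
case: g a x => [c||c] /= [|b [|d a]] [|k [|l x]] //=; rewrite ?inE.
all: try by case: ifP; rewrite ?inE // => _ /eqP ->.
all: try by case/or4P => /eqP ->.
all: by case/mapP => ? _ ->.
Qed.

Arguments slice_step : simpl never.

Section Locality.
Context {K : fieldType} {qs : qsField K}.

Lemma value_split p a b r x y z g w phi :
  size a = n_in g -> local_step g a = Some b ->
  size x = size p -> size y = size a ->
  value (p ++ a ++ r) ((size p, g) :: w) phi (x ++ y ++ z)
  = vdot (local_vec g a y)
      (fun u => value (p ++ b ++ r) w phi (x ++ u ++ z)).
Proof.
move=> sa E sx sy; rewrite [LHS]/= slice_step_split // E [LHS]/=.
rewrite !drop_size_cat ?sy // !take_size_cat ?sy //.
by rewrite -(vdot_map (fun u => x ++ u ++ z)).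
Qed.

Lemma eq_value a w b phi psi x : top_of a w = Some b -> size x = size a ->
  (forall y, size y = size b -> phi y = psi y) ->
  value a w phi x = value a w psi x.
Proof.
elim: w a x => [|[i g] w IHw] a x; first by case=> <- sx; apply.
rewrite [top_of _ _]/=; case E: slice_step => [c|] //= top sx eqp.
have [p [d [b' [r [Ea Ec sp sd El]]]]] := slice_step_inv E.
have : (size p + size d <= size x)%N by rewrite sx Ea !size_cat addnA leq_addr.
case/split_at => x1 [x2 [x3 [Ex s1 s2]]].
rewrite -!/(value a ((i, g) :: w) _ _) Ea Ex -sp !(value_split _ _ _ _ sd El) //.
apply: eq_vdot => m /size_local_vec sm; rewrite -Ec; apply: IHw => //.
move: sx; rewrite Ex Ec Ea !size_cat s1 s2 sm (size_local_step El).
by move/addnI/addnI => ->.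
Qed.

Lemma value_context p a r w b x y z phi :
  top_of a w = Some b -> size x = size p -> size y = size a ->
  value (p ++ a ++ r) (shift (size p) w) phi (x ++ y ++ z)
  = value a w (fun y' => phi (x ++ y' ++ z)) y.
Proof.
elim: w a y => [|[i g] w IHw] a y //.
rewrite [top_of _ _]/=; case E: slice_step => [c|] //= top sx sy.
have [p1 [d [b' [r1 [Ea Ec sp sd El]]]]] := slice_step_inv E.
have : (size p1 + size d <= size y)%N by rewrite sy Ea !size_cat addnA leq_addr.
case/split_at => y1 [y2 [y3 [Ey s1 s2]]].
rewrite -!/(value _ (_ :: _) _ _) Ea Ey -sp.
rewrite (value_split _ _ _ _ sd El) // -!catA.
rewrite (catA p) (catA x) -(size_cat p p1).
rewrite (value_split _ _ _ _ sd El) ?size_cat ?sx ?s1 //.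
apply: eq_vdot => m /size_local_vec sm; rewrite -!catA.
have := IHw c (y1 ++ m.1 ++ y3); rewrite Ec -!catA; apply=> //; first by rewrite -Ec.
move: sy; rewrite Ey Ea !size_cat s1 s2 sm (size_local_step El).
by move/addnI/addnI => ->.
Qed.

Definition same_value (a : seq bool) (l r : diagram) : Prop :=
  forall phi x, size x = size a -> value a l phi x = value a r phi x.

Fixpoint states (n : nat) : seq state :=
  if n is n'.+1 then flatten [seq [seq l :: x | x <- states n'] | l <- labs]
  else [:: [::]].

Lemma mem_states x : x \in states (size x).
Proof.
elim: x => [//|l x IHx]; apply/flattenP.
exists [seq l :: y | y <- states (size x)]; last exact: map_f.
by apply/mapP; exists l; rewrite ?mem_labs.
Qed.

Lemma size_states n x : x \in states n -> size x = n.
Proof.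
by elim: n x => [|n IHn] x; [rewrite inE => /eqP -> |
  case/flattenP=> xs /mapP[l _ ->] /mapP[y /IHn <- ->]].
Qed.

Definition same_run (a : seq bool) (l r : diagram) : bool :=
  all (fun x => vzero (vsub (run a l [:: (x, l1)]) (run a r [:: (x, l1)])))
      (states (size a)).

Lemma same_runP a l r : same_run a l r -> same_value a l r.
Proof.
move=> /allP H phi x sx; apply/eqP; rewrite -subr_eq0 !value_run -vdot_sub.
by rewrite vzeroP // H // -sx mem_states.
Qed.

Lemma same_value_context p a r u v c c' :
  top_of a u = Some c -> top_of a v = Some c' -> same_value a u v ->
  same_value (p ++ a ++ r) (shift (size p) u) (shift (size p) v).
Proof.
move=> tu tv E phi x sx.
have : (size p + size a <= size x)%N by rewrite sx !size_cat addnA leq_addr.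
case/split_at => x1 [x2 [x3 [-> s1 s2]]].
by rewrite (value_context _ _ _ tu) // (value_context _ _ _ tv) // E.
Qed.

Lemma same_value_cat a u l r v c d :
  top_of a u = Some c -> top_of c l = Some d -> top_of c r = Some d ->
  same_value c l r -> same_value a (u ++ l ++ v) (u ++ r ++ v).
Proof.
move=> tu tl tr E phi x sx; rewrite !(value_cat _ _ tu).
by apply: (eq_value tu sx) => y sy; rewrite (value_cat _ _ tl) (value_cat _ _ tr) E.
Qed.

End Locality.

(** * Invariance under the moves *)

(** Well-formedness with the orientations forgotten. It tells that a word only involves the first
    [n] strands before anything is known about their directions. *)
Fixpoint fit (n : nat) (w : diagram) : bool :=
  if w is (i, g) :: w' then
    (i + n_in g <= n)%N && fit (n - n_in g + n_out g) w'
  else true.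

Lemma top_of_fit d w c : top_of d w = Some c -> fit (size d) w.
Proof.
elim: w d => [//|[i g] w IHw] d; rewrite [top_of _ _]/=.
case E: slice_step => [d'|] //= /IHw; rewrite (slice_step_size E) /=.
have [p [a [b [r [-> -> _ sa El]]]]] := slice_step_inv E.
rewrite !size_cat (size_local_step El) sa => H; apply: etrans H.
by congr fit; lia.
Qed.

(** A converse to [is_tangle_context]: the hypotheses of a move concern the whole diagram, and
    definedness has to be brought back to the strands involved. *)
Lemma top_of_context_inv p a r w c : fit (size a) w ->
  top_of (p ++ a ++ r) (shift (size p) w) = Some c ->
  exists2 b, top_of a w = Some b & c = p ++ b ++ r.
Proof.
elim: w a => [|[i g] w IHw] a; first by move=> _ [<-]; exists a.
rewrite [fit _ _]/= => /andP[le_i fw]; rewrite 2![top_of _ _]/=.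
have [x [y [z [Ea <- sy]]]] := split_at le_i.
have R u : p ++ (x ++ u ++ z) ++ r = (p ++ x) ++ u ++ (z ++ r).
  by rewrite -!catA.
rewrite Ea R -size_cat !slice_step_split //.
case E: local_step => [b|] //=; rewrite -R; apply: IHw.
apply: etrans fw; rewrite Ea !size_cat sy (size_local_step E).
by congr fit; lia.
Qed.

Fixpoint bools (n : nat) : seq (seq bool) :=
  if n is n'.+1 then
    flatten [seq [seq b :: a | a <- bools n'] | b <- [:: true; false]]
  else [:: [::]].

Lemma mem_bools a : a \in bools (size a).
Proof.
elim: a => [//|b a IHa]; apply/flattenP.
exists [seq b :: c | c <- bools (size a)]; last exact: map_f.
by apply/mapP; exists b; rewrite //; case: b.
Qed.

Definition defined (a : seq bool) (w : diagram) : bool :=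
  if top_of a w is Some _ then true else false.

(** The guard is there because a zigzag prescribes the direction of its strand while the empty word
    does not. *)
Definition local_check (n : nat) (l r : diagram) : bool :=
  [&& fit n l, fit n r &
    all (fun a => defined a l && defined a r
                    ==> (top_of a l == top_of a r) && same_run a l r) (bools n)].

Section Invariance.
Context {K : fieldType} {qs : qsField K}.

Lemma local_checkP n i l r d c c' : local_check n l r -> (i + n <= size d)%N ->
  top_of d (shift i l) = Some c -> top_of d (shift i r) = Some c' ->
  c = c' /\ same_value d (shift i l) (shift i r).
Proof.
case/and3P=> fl fr /allP H /split_at[p [a [t [-> <- sa]]]] tl tr.
rewrite -sa in fl fr H.
have [b tb ->] := top_of_context_inv fl tl.
have [b' tb' ->] := top_of_context_inv fr tr.
have := H a (mem_bools a); rewrite /defined tb tb' => /andP[/eqP[<-] run].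
by split=> //; apply: (same_value_context tb tb'); apply: same_runP.
Qed.

Lemma vdot_exchange u v (phi : state -> state -> K) :
  vdot u (fun x => vdot v (phi x)) = vdot v (fun y => vdot u (phi^~ y)).
Proof.
rewrite /vdot; under eq_bigr do rewrite mulr_sumr.
rewrite exchange_big /=; apply: eq_bigr => m _; rewrite mulr_sumr.
by apply: eq_bigr => m' _; rewrite mulrCA.
Qed.

Lemma value_far d c i k g h :
  top_of d [:: (i, g); ((i + n_out g + k)%N, h)] = Some c ->
  top_of d [:: ((i + n_in g + k)%N, h); (i, g)] = Some c /\
  same_value d [:: (i, g); ((i + n_out g + k)%N, h)]
               [:: ((i + n_in g + k)%N, h); (i, g)].
Proof.
rewrite [top_of _ _]/=; case E: slice_step => [d'|] //=.
have [p [a [b [r [-> -> <- sa El]]]]] := slice_step_inv E.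
case E': slice_step => [d''|] //=.
have sb := size_local_step El.
have : (k + n_in h <= size r)%N.
  move: (slice_step_size E'); rewrite !size_cat sb -addnA -addnA.
  by rewrite 2!leq_add2l.
case/split_at=> m [a2 [r2 [Er sm sa2]]].
move: E'; rewrite Er -sm -sb.
rewrite {1}[p ++ _]catA [(p ++ b) ++ _]catA -!size_cat slice_step_split //.
case El2: local_step => [b2|] //= [<-] [<-]; split.
  have -> : ((size p + n_in g + size m)%N = size (p ++ a ++ m)).
    by rewrite !size_cat sa addnA.
  have -> u v : p ++ a ++ m ++ u ++ v = (p ++ a ++ m) ++ u ++ v :> seq bool.
    by rewrite -!catA.
  by rewrite slice_step_split // El2 /= -!catA slice_step_split // El.
move=> phi x sx.
have : (size p + size a <= size x)%N by rewrite sx !size_cat addnA leq_addr.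
case/split_at => x1 [x2 [x3 [Ex s1 s2]]].
have : (size m + size a2 <= size x3)%N.
  move: sx; rewrite Ex !size_cat s1 s2 => /addnI/addnI ->.
  by rewrite addnA leq_addr.
case/split_at => y1 [y2 [y3 [Ey t1 t2]]].
rewrite Ex Ey (value_split _ _ _ _ sa El) //.
have -> : ((size p + n_in g + size m)%N = size (p ++ a ++ m)).
  by rewrite !size_cat sa addnA.
have -> (u : seq lab) v : x1 ++ x2 ++ y1 ++ u ++ v = (x1 ++ x2 ++ y1) ++ u ++ v.
  by rewrite -!catA.
have -> (u : seq bool) v : p ++ a ++ m ++ u ++ v = (p ++ a ++ m) ++ u ++ v.
  by rewrite -!catA.
rewrite (value_split _ _ _ _ sa2 El2) ?size_cat ?s1 ?s2 ?t1 //.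
rewrite [RHS](eq_vdot (psi := fun u => vdot (local_vec g a x2) (fun v =>
  phi (x1 ++ v ++ y1 ++ u ++ y3)))); last first.
  move=> m' _; rewrite -!catA (value_split _ _ _ _ sa El) //.
rewrite -vdot_exchange; apply: eq_vdot => m' /size_local_vec sm'.
rewrite [p ++ b ++ _]catA [(p ++ b) ++ _]catA.
rewrite [x1 ++ m'.1 ++ _]catA [(x1 ++ m'.1) ++ _]catA.
rewrite -!size_cat (value_split _ _ _ _ sa2 El2) ?size_cat ?s1 ?sm' ?sb ?t1 //.
by apply: eq_vdot => m2 _; rewrite /= -!catA.
Qed.

Lemma value_move_top l r d c c' : move l r ->
  top_of d l = Some c -> top_of d r = Some c' -> c = c' /\ same_value d l r.
Proof.
case.
- by move=> i k g h /value_far[-> V] [<-].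
- move=> i b side; have E : [:: ((i + side)%N, Cup b); ((i + ~~ side)%N, Cap)]
      = shift i [:: (side : nat, Cup b); (~~ side : nat, Cap)] by [].
  rewrite E => tl tr; apply: (local_checkP (r := [::]) (n := 1) _ _ tl tr).
    by case: b side {E tl tr} => -[]; vm_compute.
  by move/top_of_fit: tl; case: side {E} => /=; lia.
- move=> i c0; have E x : [:: (i, Cross x); (i.+1, Cap)]
      = shift i [:: (0, Cross x); (1, Cap)] by rewrite /= addn0 addn1.
  have E' x : [:: (i.+1, Cross x); (i, Cap)]
      = shift i [:: (1, Cross x); (0, Cap)] by rewrite /= addn0 addn1.
  rewrite E E' => tl tr; apply: (local_checkP (n := 3) _ _ tl tr).
    by case: c0 {tl tr}; vm_compute.
  by move/top_of_fit: tl => /=; lia.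
- move=> i b c0; have E x : [:: (i.+1, Cup b); (i, Cross x)]
      = shift i [:: (1, Cup b); (0, Cross x)] by rewrite /= addn0 addn1.
  have E' x : [:: (i, Cup b); (i.+1, Cross x)]
      = shift i [:: (0, Cup b); (1, Cross x)] by rewrite /= addn0 addn1.
  rewrite E E' => tl tr; apply: (local_checkP (n := 1) _ _ tl tr).
    by case: b c0 {tl tr E E'} => -[]; vm_compute.
  by move/top_of_fit: tl => /=; lia.
- move=> i c0; have E x : [:: (i, Cross x); (i, Cap)]
      = shift i [:: (0, Cross x); (0, Cap)] by rewrite /= addn0.
  have E' : [:: (i, Cap)] = shift i [:: (0, Cap)] by rewrite /= addn0.
  rewrite E E' => tl tr; apply: (local_checkP (n := 2) _ _ tl tr).
    by case: c0 {tl tr}; vm_compute.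
  by move/top_of_fit: tl => /=; lia.
- move=> i b c0; have E x : [:: (i, Cup b); (i, Cross x)]
      = shift i [:: (0, Cup b); (0, Cross x)] by rewrite /= addn0.
  have E' x : [:: (i, Cup x)] = shift i [:: (0, Cup x)] by rewrite /= addn0.
  rewrite E E' => tl tr; apply: (local_checkP (n := 0) _ _ tl tr).
    by case: b c0 {tl tr E} => -[]; vm_compute.
  by move/top_of_fit: tl => /=; lia.
- move=> i c0; have E x : [:: (i, Cross x); (i, Cross (~~ x))]
      = shift i [:: (0, Cross x); (0, Cross (~~ x))] by rewrite /= addn0.
  rewrite E => tl tr; apply: (local_checkP (r := [::]) (n := 2) _ _ tl tr).
    by case: c0 {tl tr}; vm_compute.
  by move/top_of_fit: tl => /=; lia.
- move=> i x; have E : [:: (i, Cross x); (i.+1, Cross x); (i, Cross x)]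
      = shift i [:: (0, Cross x); (1, Cross x); (0, Cross x)].
    by rewrite /= addn0 addn1.
  have E' : [:: (i.+1, Cross x); (i, Cross x); (i.+1, Cross x)]
      = shift i [:: (1, Cross x); (0, Cross x); (1, Cross x)].
    by rewrite /= addn0 addn1.
  rewrite E E' => tl tr; apply: (local_checkP (n := 3) _ _ tl tr).
    by case: x {tl tr E E'}; vm_compute.
  by move/top_of_fit: tl => /=; lia.
Qed.

Lemma value_move l r d c : move l r ->
  top_of d l = Some c -> top_of d r = Some c -> same_value d l r.
Proof. by move=> mv tl tr; case: (value_move_top mv tl tr). Qed.

End Invariance.

(** * Equivariance *)

(* An element X with coproduct X (x) k + h (x) X, given by its action on the
   two strands.  The Koszul sign is part of h. *)
Record skew := Skew {
  sk_act : bool -> lab -> seq (lab * laurent);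
  sk_k : bool -> lab -> laurent;
  sk_h : bool -> lab -> laurent }.

Fixpoint weight (f : bool -> lab -> laurent) (a : seq bool) (x : state) :
    laurent :=
  match a, x with
  | b :: a', l :: x' => lmul (f b l) (weight f a' x')
  | _, _ => l1
  end.

Fixpoint act (X : skew) (a : seq bool) (x : state) : vec :=
  match a, x with
  | b :: a', l :: x' =>
      [seq (m.1 :: x', lmul m.2 (weight (sk_k X) a' x')) | m <- sk_act X b l]
      ++ [seq (l :: m.1, lmul (sk_h X b l) m.2) | m <- act X a' x']
  | _, _ => [::]
  end.

Definition k_weight (i : bool) (x : lab) : laurent :=
  if i then match x with X0 | X1 => lmon 1 0 1 | _ => lmon 1 1 1 end
  else match x with X1 => lmon 1 1 0 | X2 => lmon 1 (-1) 0 | _ => l1 end.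
Definition k_weight_inv (i : bool) (x : lab) : laurent :=
  if i then match x with X0 | X1 => lmon 1 0 (-1) | _ => lmon 1 (-1) (-1) end
  else match x with X1 => lmon 1 (-1) 0 | X2 => lmon 1 1 0 | _ => l1 end.
Definition odd_sign (i : bool) (x : lab) : laurent :=
  match x with X1 | X2 => if i then lmon (-1) 0 0 else l1 | _ => l1 end.

(* Here E_2 is multiplied by q - q^-1. *)
Definition E_act (i : bool) (x : lab) : seq (lab * laurent) :=
  match i, x with
  | false, X2 => [:: (X1, l1)]
  | true, X1 => [:: (X0, [:: mon (-1) 0 (-1); mon 1 0 1])]
  | true, X3 => [:: (X2, [:: mon (-1) (-1) (-1); mon 1 1 1])]
  | _, _ => [::]
  end.

Definition F_act (i : bool) (x : lab) : seq (lab * laurent) :=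
  match i, x with
  | false, X1 => [:: (X2, l1)]
  | true, X0 => [:: (X1, l1)]
  | true, X2 => [:: (X3, l1)]
  | _, _ => [::]
  end.

(* On the dual module X acts by the transpose of its antipode, which is
   - E K^-1 for E and - K F for F. *)
Definition dual_act (t : lab -> seq (lab * laurent)) (c : lab -> lab -> laurent)
    (x : lab) : seq (lab * laurent) :=
  flatten [seq [seq (y, lmul (c x y) m.2) | m <- t y & lab_eqb m.1 x]
          | y <- labs].

Definition E_skew (i : bool) : skew := {|
  sk_act := fun b => if b then E_act i else
    dual_act (E_act i)
      (fun x y => lopp (lmul (odd_sign i x) (k_weight_inv i y)));
  sk_k := fun b => if b then k_weight i else k_weight_inv i;
  sk_h := fun b => odd_sign i |}.

Definition F_skew (i : bool) : skew := {|
  sk_act := fun b => if b then F_act i else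
    dual_act (F_act i) (fun x y => lopp (lmul (odd_sign i x) (k_weight i x)));
  sk_k := fun b x => l1;
  sk_h := fun b x => lmul (odd_sign i x)
                       (if b then k_weight_inv i x else k_weight i x) |}.

Definition generators : seq skew :=
  [:: E_skew false; E_skew true; F_skew false; F_skew true].

(** When X acts on a strand beside the event, the strands of the event contribute only their weight
    for k or h. Hence an event must preserve these weights, besides commuting with X. *)
Definition event_equivariant (X : skew) (g : event) : bool :=
  all (fun a => if local_step g a is Some b then
    all (fun x =>
      vzero (vsub (vmap (act X b) (local_vec g a x))
                  (vmap (local_vec g a) (act X a x)))
      && all (fun m => leqb (weight (sk_k X) b m.1) (weight (sk_k X) a x)
                       && leqb (weight (sk_h X) b m.1) (weight (sk_h X) a x))
           (local_vec g a x)) (states (size a)) else true)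
  (bools (n_in g)).

Definition equivariant (X : skew) : bool :=
  all (event_equivariant X) [:: Cup true; Cup false; Cap; Cross true; Cross false].

Lemma generators_equivariant : all equivariant generators.
Proof. by vm_compute. Qed.

Lemma weight_cat (K : fieldType) (qs : qsField K) f a b x y : size x = size a ->
  ev (weight f (a ++ b) (x ++ y)) = ev (weight f a x) * ev (weight f b y) :> K.
Proof.
elim: a x => [|c a IHa] [|l x] //=; first by rewrite ev1 mul1r.
by case=> /IHa E; rewrite !ev_lmul E mulrA.
Qed.

Lemma size_act X a x m : m \in act X a x -> size m.1 = size x.
Proof.
elim: a x m => [|b a IHa] [|l x] m //=; rewrite mem_cat.
by case/orP=> /mapP[m' H ->] //=; rewrite (IHa _ _ H).
Qed.

Section Equivariance.
Context {K : fieldType} {qs : qsField K}.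
Variable X : skew.
Hypothesis HX : equivariant X.
Local Notation wt f a x := (ev (weight f a x) : K).

(** The coproduct of X for two groups of strands instead of two strands. *)
Lemma act_cat a b x y (phi : state -> K) : size x = size a ->
  vdot (act X (a ++ b) (x ++ y)) phi
  = wt (sk_k X) b y * vdot (act X a x) (fun u => phi (u ++ y))
    + wt (sk_h X) a x * vdot (act X b y) (fun u => phi (x ++ u)).
Proof.
elim: a x phi => [|c a IHa] [|l x] phi //=.
  by rewrite vdot_nil mulr0 add0r ev1 mul1r.
case=> sx; rewrite !vdot_cat mulrDr -addrA; congr (_ + _).
  rewrite /vdot !big_map mulr_sumr; apply: eq_bigr => m _ /=.
  by rewrite !ev_lmul weight_cat //; ring.
have E A B (psi : state -> K) :
    vdot [seq (l :: m.1, lmul (sk_h X c l) m.2) | m <- act X A B] psi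
    = ev (sk_h X c l) * vdot (act X A B) (fun u => psi (l :: u)).
  rewrite /vdot big_map mulr_sumr; apply: eq_bigr => m _ /=.
  by rewrite ev_lmul mulrA.
by rewrite !E IHa // ev_lmul mulrDr mulrCA !mulrA.
Qed.

Lemma local_equivariant g a b x : size a = n_in g -> local_step g a = Some b ->
  size x = size a ->
  (forall phi : state -> K, vdot (local_vec g a x) (fun u => vdot (act X b u) phi)
     = vdot (act X a x) (fun y => vdot (local_vec g a y) phi))
  /\ (forall m, m \in local_vec g a x ->
       wt (sk_k X) b m.1 = wt (sk_k X) a x
       /\ wt (sk_h X) b m.1 = wt (sk_h X) a x).
Proof.
move=> sa El sx; have : event_equivariant X g.
  move: HX; rewrite /equivariant /= andbT => /and5P[].
  by case: g {sa El} => [[]||[]].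
move/allP/(_ a); rewrite -sa mem_bools El => /(_ isT)/allP/(_ x).
rewrite -sx mem_states => /(_ isT)/andP[H1 /allP H2]; split.
  move=> phi; rewrite -!vdot_vmap; apply/eqP; rewrite -subr_eq0 -vdot_sub.
  by rewrite vzeroP.
by move=> m /H2/andP[/leqbP -> /leqbP ->].
Qed.

Lemma step_equivariant a e b x (phi : state -> K) :
  slice_step a e = Some b -> size x = size a ->
  vdot (step_vec a e x) (fun y => vdot (act X b y) phi)
  = vdot (act X a x) (fun y => vdot (step_vec a e y) phi).
Proof.
case: e => i g H sx.
have [p [c [d [r [Ea Eb sp sc El]]]]] := slice_step_inv H.
have S y1 y2 y3 (psi : state -> K) : size y1 = size p -> size y2 = size c ->
    vdot (step_vec a (i, g) (y1 ++ y2 ++ y3)) psi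
    = vdot (local_vec g c y2) (fun u => psi (y1 ++ u ++ y3)).
  move=> s1 s2; have := value_split (qs := qs) r y3 [::] psi sc El s1 s2.
  by rewrite -Ea sp [X in X = _ -> _]/= H.
have : (size p + size c <= size x)%N by rewrite sx Ea !size_cat addnA leq_addr.
case/split_at => x1 [x2 [x3 [Ex s1 s2]]].
have [L1 L2] := local_equivariant sc El s2.
rewrite Ex S // [in act X a _]Ea act_cat // act_cat //.
(* The three terms of the iterated coproduct: X acts to the left of the event, on it, or to its
   right. The factor 1 gives the inner sum the shape of [vdotD]. *)
rewrite (eq_vdot (psi := fun u =>
  wt (sk_k X) (c ++ r) (x2 ++ x3)
    * vdot (act X p x1) (fun v => phi (v ++ u ++ x3))
  + wt (sk_h X) p x1 *
    (1 * (wt (sk_k X) r x3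
          * vdot (act X d u) (fun v => phi (x1 ++ v ++ x3)))
     + wt (sk_h X) c x2
         * vdot (act X r x3) (fun v => phi (x1 ++ u ++ v))))); last first.
  move=> m Hm; have [k1 h1] := L2 m Hm; have sm := size_local_vec Hm.
  have sd := size_local_step El.
  rewrite Eb act_cat // act_cat ?sm ?sd //.
  by rewrite !weight_cat ?sm ?sd ?s2 // k1 h1 mul1r.
have M (u : vec) (k : K) psi : vdot u (fun x => k * psi x) = k * vdot u psi.
  rewrite -[RHS]addr0 -(mul0r (vdot u (fun=> 0))) -vdotD.
  by apply: eq_vdot => m _; rewrite mul0r addr0.
rewrite vdotD; congr (_ * _ + _ * _).
  rewrite vdot_exchange; apply: eq_vdot => m /size_act sm.
  by rewrite S // sm.
rewrite vdotD mul1r M L1; congr (_ * _ + _ * _).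
  by apply: eq_vdot => m /size_act sm; rewrite S // sm.
by rewrite vdot_exchange; apply: eq_vdot => m /size_act sm; rewrite S.
Qed.

Lemma value_equivariant a w b x (phi : state -> K) :
  top_of a w = Some b -> size x = size a ->
  value a w (fun y => vdot (act X b y) phi) x
  = vdot (act X a x) (value a w phi).
Proof.
elim: w a x => [|e w IHw] a x; first by case=> ->.
rewrite [top_of _ _]/=; case E: slice_step => [c|] //= top sx; rewrite E.
rewrite -(step_equivariant _ E sx); apply: eq_vdot => m Hm; apply: IHw => //.
case: e E Hm => i g E.
have [p [a1 [b1 [r [Ea Ec <- sa El]]]]] := slice_step_inv E.
case/mapP=> m' /size_local_vec sm' ->.
rewrite !size_cat sm' Ec !size_cat (size_local_step El) -sa.
have : (size p + size a1 <= size x)%N by rewrite sx Ea !size_cat addnA leq_addr.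
case/split_at => x1 [x2 [x3 [Ex s1 s2]]].
move: sx; rewrite Ex Ea !size_cat s1 s2 => /addnI/addnI s3.
by rewrite -s1 take_size_cat // drop_size_cat // -s2 drop_size_cat // s3.
Qed.

(** By equivariance X can be moved to the top, where no strand is left and it acts by zero. *)
Lemma value_invariant a w x (phi : state -> K) :
  top_of a w = Some [::] -> size x = size a ->
  vdot (act X a x) (value a w phi) = 0.
Proof.
move=> top sx; rewrite -(value_equivariant _ top sx).
rewrite (eq_value (psi := fun y => 0 * phi y + 0 * phi y) top sx).
  by rewrite value_linear !mul0r addr0.
by move=> y /size0nil ->; rewrite vdot_nil !mul0r addr0.
Qed.

End Equivariance.

(** * Invariant functionals on four strands *)

(** By the relations of U_q this is a multiple of K_i - K_i^-1 applied to [x], the sign being that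
    of an anticommutator for the odd generators. It yields equations in a single state, which
    eliminate the states of non-zero weight and give [propagate] its start; the K_i need not be
    listed among the conditions of invariance. *)
Definition commutator (i : bool) (a : seq bool) (x : state) : vec :=
  vmap (act (E_skew i) a) (act (F_skew i) a x)
  ++ vscale (if i then l1 else lmon (-1) 0 0)
       (vmap (act (F_skew i) a) (act (E_skew i) a x)).

Definition equations (a : seq bool) : seq vec :=
  flatten [seq [:: commutator false a x; commutator true a x;
                   act (E_skew false) a x; act (E_skew true) a x;
                   act (F_skew false) a x; act (F_skew true) a x]
          | x <- states (size a)].

(* If phi vanishes on the states of Z and on v, and a single state of v is not
   in Z, then phi vanishes on that state. *)
Definition propagate (Z : seq state) (v : vec) : seq state :=
  if [seq m <- collect v | ~~ lzero m.2 & m.1 \notin Z] is [:: (x, p)] then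
    if spec_nonzero p then x :: Z else Z
  else Z.

Definition tftf := [:: true; false; true; false].

(* The values at these states determine an invariant functional. *)
Definition seed1 := [:: X0; X0; X0; X0].
Definition seed2 := [:: X0; X0; X1; X1].
Definition seed3 := [:: X0; X0; X3; X3].
Definition seed_states := [:: seed1; seed2; seed3].

(* A function, so that Z is computed once. *)
Definition covers (Z X : seq state) : bool := all (fun x => x \in Z) X.

(** The upper bound three for the dimension of the space of invariant functionals. *)
Lemma all_states_zero :
  covers (foldl propagate seed_states (equations tftf)) (states 4%N).
Proof. by vm_compute. Qed.

(** Caps side by side, nested caps, and nested caps preceded by two crossings: three closings of
    four strands whose values are independent, by [span_det]. *)
Definition span1 : diagram := [:: (0%N, Cap); (0%N, Cap)].
Definition span2 : diagram := [:: (1%N, Cap); (0%N, Cap)].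
Definition span3 : diagram :=
  [:: (1%N, Cross true); (0%N, Cross false); (1%N, Cap); (0%N, Cap)].

Definition closed_value (a : seq bool) (w : diagram) (x : state) : laurent :=
  foldr (fun m => ladd m.2) [::] (run a w [:: (x, l1)]).

Definition ldet3 (f1 f2 f3 g1 g2 g3 h1 h2 h3 : laurent) : laurent :=
  let minor a b c d := ladd (lmul a d) (lopp (lmul b c)) in
  ladd (lmul f1 (minor g2 g3 h2 h3))
    (ladd (lopp (lmul f2 (minor g1 g3 h1 h3))) (lmul f3 (minor g1 g2 h1 h2))).

Lemma span_det :
  let z := closed_value tftf in
  spec_nonzero (ldet3 (z span1 seed1) (z span1 seed2) (z span1 seed3)
                      (z span2 seed1) (z span2 seed2) (z span2 seed3)
                      (z span3 seed1) (z span3 seed2) (z span3 seed3)).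
Proof. by vm_compute. Qed.

Section Span.
Context {K : fieldType} {qs : qsField K}.

Definition uq_invariant (a : seq bool) (phi : state -> K) : Prop :=
  forall i x, size x = size a ->
  vdot (act (E_skew i) a x) phi = 0 /\ vdot (act (F_skew i) a x) phi = 0.

Lemma E_equivariant i : equivariant (E_skew i).
Proof. by have := generators_equivariant; case: i => /and5P[]. Qed.

Lemma F_equivariant i : equivariant (F_skew i).
Proof. by have := generators_equivariant; case: i => /and5P[]. Qed.

Lemma value_is_invariant a w phi : top_of a w = Some [::] ->
  uq_invariant a (value a w phi).
Proof.
move=> top i x sx; have := E_equivariant i; have := F_equivariant i.
by split; apply: value_invariant.
Qed.

Lemma vdot_propagate (phi : state -> K) Z v :
  {in Z, forall x, phi x = 0} -> vdot v phi = 0 ->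
  {in propagate Z v, forall x, phi x = 0}.
Proof.
move=> Z0 v0; rewrite /propagate; set r := filter _ _.
have {v0} : vdot r phi = 0.
  rewrite -v0 -[RHS]vdot_collect /vdot big_filter [RHS]big_mkcond /=.
  rewrite big_mkcond /=; apply: eq_bigr => m _.
  case: ifP => // /nandP[/negPn/lzeroP ->|/negPn/Z0 ->]; first by rewrite mul0r.
  by rewrite mulr0.
case: r => [|[x p] [|]] //; case: ifP => // nz.
rewrite vdot_seq1 => /eqP; rewrite mulf_eq0 (negPf (ev_neq0 nz)) /= => /eqP px.
by move=> y; rewrite inE => /predU1P[-> //|/Z0].
Qed.

Lemma vdot_commutator i a x phi : uq_invariant a phi -> size x = size a ->
  vdot (commutator i a x) phi = 0.
Proof.
move=> inv sx; rewrite vdot_cat vdot_scale !vdot_vmap.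
have Z (v : vec) (psi : state -> K) :
    (forall m, m \in v -> psi m.1 = 0) -> vdot v psi = 0.
  by move=> H; rewrite /vdot big_seq big1 // => m /H ->; rewrite mulr0.
have S X : {in act X a x, forall m, size m.1 = size a}.
  by move=> m /size_act ->.
rewrite !Z ?mulr0 ?addr0 // => m /S sm.
  by have [_ ->] := inv i _ sm.
by have [-> _] := inv i _ sm.
Qed.

Lemma vdot_foldl_propagate (phi : state -> K) vs Z :
  {in Z, forall x, phi x = 0} -> {in vs, forall v, vdot v phi = 0} ->
  {in foldl propagate Z vs, forall x, phi x = 0}.
Proof.
elim: vs Z => [//|v vs IHv] Z HZ Hv; apply: IHv.
  by apply: vdot_propagate => //; apply: Hv; rewrite inE eqxx.
by move=> u Hu; apply: Hv; rewrite inE Hu orbT.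
Qed.

Lemma vdot_equations a phi :
  uq_invariant a phi -> {in equations a, forall v, vdot v phi = 0}.
Proof.
move=> inv v /flattenP[vs /mapP[y /size_states sy ->]].
have [E1 F1] := inv false y sy; have [E2 F2] := inv true y sy.
rewrite !inE => /or3P[/eqP ->|/eqP ->|]; try exact: vdot_commutator.
by case/or4P=> /eqP ->.
Qed.

Lemma invariant_vanish phi : uq_invariant tftf phi ->
  {in seed_states, forall x, phi x = 0} -> forall x, size x = 4%N -> phi x = 0.
Proof.
move=> inv Hs x sx.
have Hx : x \in states 4%N by rewrite -sx; apply: mem_states.
move: all_states_zero (vdot_foldl_propagate Hs (vdot_equations inv)).
by move: (foldl _ _ _) => Z /allP/(_ x Hx) HZ; apply.
Qed.

Lemma invariant_lin a c d phi psi : uq_invariant a phi -> uq_invariant a psi ->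
  uq_invariant a (fun x => c * phi x + d * psi x).
Proof.
move=> H1 H2 i x sx; have [e1 f1] := H1 i x sx; have [e2 f2] := H2 i x sx.
by rewrite !vdotD e1 f1 e2 f2 !mulr0 addr0.
Qed.

Lemma ev_closed_value a w x :
  ev (closed_value a w x) = value a w (fun=> 1) x :> K.
Proof.
rewrite value_run /closed_value /vdot.
by elim: run => [|m v IHv] /=; rewrite ?ev_nil ?big_nil // ev_ladd IHv big_cons mulr1.
Qed.

Lemma cramer3 (f1 f2 f3 g1 g2 g3 h1 h2 h3 v1 v2 v3 : K) :
  f1 * (g2 * h3 - g3 * h2) + (- (f2 * (g1 * h3 - g3 * h1))
    + f3 * (g1 * h2 - g2 * h1)) != 0 ->
  exists c1 c2 c3, [/\ v1 = c1 * f1 + c2 * g1 + c3 * h1,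
    v2 = c1 * f2 + c2 * g2 + c3 * h2 & v3 = c1 * f3 + c2 * g3 + c3 * h3].
Proof.
set D := (X in X != 0) => D0.
exists ((v1 * (g2 * h3 - g3 * h2) + (- (v2 * (g1 * h3 - g3 * h1))
    + v3 * (g1 * h2 - g2 * h1))) / D).
exists ((f1 * (v2 * h3 - v3 * h2) + (- (f2 * (v1 * h3 - v3 * h1))
    + f3 * (v1 * h2 - v2 * h1))) / D).
exists ((f1 * (g2 * v3 - g3 * v2) + (- (f2 * (g1 * v3 - g3 * v1))
    + f3 * (g1 * v2 - g2 * v1))) / D).
by split; rewrite /D in D0 *; field.
Qed.

(** Cramer's rule gives the combination that agrees with [phi] at the three seeds. The difference is
    invariant and vanishes at the seeds, hence everywhere. *)
Lemma invariant_span phi : uq_invariant tftf phi ->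
  exists c1 c2 c3, forall x, size x = 4%N ->
  phi x = c1 * value tftf span1 (fun=> 1) x + c2 * value tftf span2 (fun=> 1) x
          + c3 * value tftf span3 (fun=> 1) x.
Proof.
move=> inv; move: span_det (@ev_closed_value tftf).
move: (closed_value tftf) => v /(ev_neq0 (qs := qs)) + V; rewrite /ldet3.
rewrite !(ev_ladd, ev_lopp, ev_lmul, V).
move=> D0; have [c1 [c2 [c3 [E1 E2 E3]]]] :=
  cramer3 (phi seed1) (phi seed2) (phi seed3) D0.
exists c1, c2, c3 => x sx; apply/eqP; rewrite -subr_eq0; apply/eqP.
pose val w := value (qs := qs) tftf w (fun=> 1).
pose psi x := c1 * val span1 x + 1 * (c2 * val span2 x + c3 * val span3 x).
have inv_psi : uq_invariant tftf (fun x => 1 * phi x + (-1) * psi x).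
  have I w : top_of tftf w = Some [::] -> uq_invariant tftf (val w).
    exact: value_is_invariant.
  by apply: (invariant_lin 1 (-1) inv (invariant_lin c1 1 (I span1 _)
               (invariant_lin c2 c3 (I span2 _) (I span3 _)))).
have psiE y : 1 * phi y + (-1) * psi y
    = phi y - (c1 * value tftf span1 (fun=> 1) y
       + c2 * value tftf span2 (fun=> 1) y + c3 * value tftf span3 (fun=> 1) y).
  by rewrite /psi /val; ring.
rewrite -psiE; apply: (invariant_vanish inv_psi _ sx) => y.
rewrite !inE !psiE => /or3P[] /eqP ->.
- by rewrite {1}E1 subrr.
- by rewrite {1}E2 subrr.
- by rewrite {1}E3 subrr.
Qed.

End Span.

(** * The invariant of a link *)

Section LinkValue.
Context {K : fieldType} {qs : qsField K}.

Definition cap_form (b : bool) : state -> K :=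
  value [:: b; ~~ b] [:: (0%N, Cap)] (fun=> 1).

Definition multiple_of_cap (b : bool) (w : diagram) (c : K) : Prop :=
  forall x, size x = 2%N -> value [:: b; ~~ b] w (fun=> 1) x = c * cap_form b x.

(* The invariant of a closed diagram is zero: one has to cut the strand at
   its first minimum. *)
Definition link_value (w : diagram) (c : K) : Prop :=
  exists b w', w = (0%N, Cup b) :: w' /\ multiple_of_cap b w' c.

Lemma cap_form_neq0 b : cap_form b [:: X0; X0] != 0.
Proof.
rewrite /cap_form -ev_closed_value; apply: ev_neq0; clear K qs.
by case: b; vm_compute.
Qed.

Lemma multiple_of_cap_uniq b w c d :
  multiple_of_cap b w c -> multiple_of_cap b w d -> c = d.
Proof.
move=> /(_ [:: X0; X0] erefl) Ec /(_ [:: X0; X0] erefl); rewrite Ec.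
exact: (mulIf (cap_form_neq0 b)).
Qed.

Lemma eq_multiple_of_cap b w w' c : same_value [:: b; ~~ b] w w' ->
  multiple_of_cap b w c -> multiple_of_cap b w' c.
Proof. by move=> E H x sx; rewrite -E // H. Qed.

Lemma same_value_sym a l r : same_value a l r -> same_value a r l.
Proof. by move=> E phi x sx; rewrite E. Qed.

Lemma same_value_front a l r v d :
  top_of a l = Some d -> top_of a r = Some d ->
  same_value a l r -> same_value a (l ++ v) (r ++ v).
Proof. exact: (same_value_cat v (u := [::])). Qed.

Lemma same_value_R1_cap b c :
  same_value [:: b; ~~ b] [:: (0%N, Cross c); (0%N, Cap)] [:: (0%N, Cap)].
Proof.
by apply: (value_move (move_R1_cap 0 c) (c := [::])); case: b.
Qed.

(** A kink reverses the two ends of the cut strand without changing the scalar, because the cap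
    absorbs it by Reidemeister I. This reduces all orientations of the cut to one. *)
Lemma multiple_of_cap_flip b c w z :
  multiple_of_cap (~~ b) w z -> multiple_of_cap b ((0%N, Cross c) :: w) z.
Proof.
move=> H x sx; have R1 := @same_value_R1_cap b c (fun=> 1) x sx.
rewrite /cap_form -R1.
have topb : top_of [:: b; ~~ b] [:: (0%N, Cross c)] = Some [:: ~~ b; ~~ ~~ b].
  by case: b {H sx R1}.
have V v : value [:: b; ~~ b] ((0%N, Cross c) :: v) (fun=> 1) x
    = value [:: b; ~~ b] [:: (0%N, Cross c)]
        (value [:: ~~ b; ~~ ~~ b] v (fun=> 1)) x.
  by rewrite -(value_cat v _ topb).
pose phi y := z * cap_form (~~ b) y + 0 * cap_form (~~ b) y.
rewrite !V (eq_value (psi := phi) topb sx).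
  by rewrite value_linear mul0r addr0.
by move=> y sy; rewrite H // /phi mul0r addr0.
Qed.

Lemma multiple_of_cap_unflip b c w z :
  multiple_of_cap b ((0%N, Cross c) :: w) z -> multiple_of_cap (~~ b) w z.
Proof.
rewrite -{1}[b]negbK => /(multiple_of_cap_flip (~~ c)).
apply: eq_multiple_of_cap.
apply: (same_value_front w
  (l := [:: (0%N, Cross (~~ c)); (0%N, Cross c)]) (r := [::])).
- by case: b.
- by [].
rewrite -{2}[c]negbK.
by apply: (value_move (move_R2 0 (~~ c)) (c := [:: ~~ b; ~~ ~~ b])); case: b.
Qed.

(** Two minima side by side below [v] can be drawn in either order, and the lower one is the place
    of the cut. The predicate says that both cuts produce the same scalar. *)
Definition exchangeable (b b' : bool) (v : diagram) : Prop :=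
  exists z, multiple_of_cap b ((2%N, Cup b') :: v) z
    /\ multiple_of_cap b' ((0%N, Cup b) :: v) z.

Lemma exchangeable_flip_left b b' c v :
  exchangeable b b' ((0%N, Cross c) :: v) -> exchangeable (~~ b) b' v.
Proof.
case=> z [H1 H2]; exists z; split.
  apply: (multiple_of_cap_unflip (c := c)); apply: eq_multiple_of_cap H1.
  apply: same_value_sym.
  apply: (same_value_front v (l := [:: (0%N, Cross c); (2%N, Cup b')])
    (r := [:: (2%N, Cup b'); (0%N, Cross c)]) (d := [:: ~~ b; b; b'; ~~ b']));
    [by clear; case: b; case: b' | by clear; case: b; case: b' |].
  by apply: (value_move (move_far 0 0 (Cross c) (Cup b'))
    (c := [:: ~~ b; b; b'; ~~ b'])); clear; case: b; case: b'.
apply: eq_multiple_of_cap H2.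
apply: (same_value_front v (l := [:: (0%N, Cup b); (0%N, Cross c)])
    (r := [:: (0%N, Cup (~~ b))]) (d := [:: ~~ b; b; b'; ~~ b']));
    [by clear; case: b; case: b' | by clear; case: b; case: b' |].
by apply: (value_move (move_R1_cup 0 b c) (c := [:: ~~ b; b; b'; ~~ b']));
  clear; case: b; case: b'.
Qed.

Lemma exchangeable_flip_right b b' c v :
  exchangeable b b' ((2%N, Cross c) :: v) -> exchangeable b (~~ b') v.
Proof.
case=> z [H1 H2]; exists z; split.
  apply: eq_multiple_of_cap H1.
  apply: (same_value_front v (l := [:: (2%N, Cup b'); (2%N, Cross c)])
    (r := [:: (2%N, Cup (~~ b'))]) (d := [:: b; ~~ b; ~~ b'; b']));
    [by clear; case: b; case: b' | by clear; case: b; case: b' |].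
  by apply: (value_move (move_R1_cup 2 b' c) (c := [:: b; ~~ b; ~~ b'; b']));
    clear; case: b; case: b'.
apply: (multiple_of_cap_unflip (c := c)); apply: eq_multiple_of_cap H2.
apply: (same_value_front v (l := [:: (0%N, Cup b); (2%N, Cross c)])
    (r := [:: (0%N, Cross c); (0%N, Cup b)]) (d := [:: b; ~~ b; ~~ b'; b']));
    [by clear; case: b; case: b' | by clear; case: b; case: b' |].
by apply: (value_move (move_far 0 0 (Cup b) (Cross c))
    (c := [:: b; ~~ b; ~~ b'; b'])); clear; case: b; case: b'.
Qed.

Definition cap_check (w : diagram) (z : laurent) : bool :=
  all (fun x => leqb (closed_value [:: true; false] w x)
         (lmul z (closed_value [:: true; false] [:: (0%N, Cap)] x))) (states 2%N).

Lemma cap_checkP w z : cap_check w z -> multiple_of_cap true w (ev z).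
Proof.
move=> /allP H x sx; have /H : x \in states 2%N by rewrite -sx mem_states.
by move/(leqbP (qs := qs)); rewrite ev_lmul !ev_closed_value.
Qed.

(** The cap has value s^-2 at [[:: X0; X0]], so the factor s^2 turns the value at this state into
    the scalar. *)
Definition span_value (w : diagram) : laurent :=
  lmul (lmon 1 0 2) (closed_value [:: true; false] ((2%N, Cup true) :: w)
                       [:: X0; X0]).

(** The independence of the cut, checked on the spanning tangles; linearity extends it to every
    [v]. *)
Lemma span_value_check : all (fun w =>
  cap_check ((2%N, Cup true) :: w) (span_value w)
  && cap_check ((0%N, Cup true) :: w) (span_value w)) [:: span1; span2; span3].
Proof. by vm_compute. Qed.

Lemma exchangeable_true v :
  top_of tftf v = Some [::] -> exchangeable true true v.
Proof.
move=> topv; have inv := value_is_invariant (qs := qs) (fun=> 1) topv.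
have [c1 [c2 [c3 E]]] := invariant_span inv.
have /and4P[] := span_value_check.
move=> /andP[/cap_checkP A1 /cap_checkP B1] /andP[/cap_checkP A2 /cap_checkP B2].
move=> /andP[/cap_checkP A3 /cap_checkP B3] _.
have L i z1 z2 z3 : (i <= 2)%N ->
    multiple_of_cap true ((i, Cup true) :: span1) z1 ->
    multiple_of_cap true ((i, Cup true) :: span2) z2 ->
    multiple_of_cap true ((i, Cup true) :: span3) z3 ->
    i \in [:: 0; 2]%N ->
    multiple_of_cap true ((i, Cup true) :: v) (c1 * z1 + c2 * z2 + c3 * z3).
  move=> i2 H1 H2 H3 Hi x sx.
  have topi : top_of [:: true; false] [:: (i, Cup true)] = Some tftf.
    by move: Hi; rewrite !inE => /orP[] /eqP ->.
  have V w : value [:: true; false] ((i, Cup true) :: w) (fun=> 1) x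
      = value [:: true; false] [:: (i, Cup true)] (value tftf w (fun=> 1)) x :> K.
    by rewrite -(value_cat _ _ topi).
  rewrite V !mulrDl -!mulrA -H1 // -H2 // -H3 // !V.
  pose val w := value (qs := qs) tftf w (fun=> 1).
  rewrite (eq_value (psi := fun y => c1 * val span1 y
    + 1 * (c2 * val span2 y + c3 * val span3 y)) topi sx).
    by rewrite !value_linear mul1r addrA.
  by move=> y sy; rewrite E // /val; ring.
exists (c1 * ev (span_value span1) + c2 * ev (span_value span2)
        + c3 * ev (span_value span3)).
by split; apply: L.
Qed.

Lemma exchange_minima b b' v :
  top_of [:: b; ~~ b; b'; ~~ b'] v = Some [::] -> exchangeable b b' v.
Proof.
have R b0 v0 : top_of [:: true; false; b0; ~~ b0] v0 = Some [::] ->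
    exchangeable true b0 v0.
  case: b0 => top0; first exact: exchangeable_true.
  by apply: (exchangeable_flip_right (b' := true) (c := true));
    apply: exchangeable_true; rewrite /= top0.
case: b => topv; first exact: R.
by apply: (exchangeable_flip_left (b := true) (c := true)); apply: R;
  rewrite /= topv.
Qed.

Lemma top_of_nil_inv i g : slice_step [::] (i, g) <> None ->
  i = 0%N /\ exists b, g = Cup b.
Proof.
case E: slice_step => [d|] // _; move/slice_step_size: E.
by case: g => [b||c] /=; case: i => // _; split=> //; exists b.
Qed.

(** A move at the very bottom can affect the cut. Since a link starts with a minimum at position 0,
    only two moves are possible there: the interchange of two minima, settled by [exchange_minima],
    and a kink in the first minimum. *)
Lemma link_value_bottom l r v z : move l r ->
  is_link (l ++ v) -> is_link (r ++ v) ->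
  link_value (l ++ v) z <-> link_value (r ++ v) z.
Proof.
have N i g w : is_link ((i, g) :: w) -> i = 0%N /\ exists b, g = Cup b.
  move=> H; apply: top_of_nil_inv => E.
  by move: H; rewrite /is_link /is_tangle [top_of _ _]/= E.
have C b c : is_link ((0%N, Cup b) :: (1%N, c) :: v) -> c = Cap -> False.
  by move=> H E; move: H; rewrite E; case: b.
case.
- move=> i k g h /= H1 H2; have [i0 [b Eg]] := N _ _ _ H1.
  have [k0 [b' Eh]] := N _ _ _ H2.
  have {i0 k0} [i0 k0] : i = 0%N /\ k = 0%N by move: k0; rewrite i0 Eg /=; lia.
  subst i k g h; rewrite /= in H1 H2 *.
  have [y [E1 E2]] : exchangeable b b' v by apply: exchange_minima; case: b H1 H2.
  split=> -[b0 [w' [[<- <-] H]]].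
    exists b', ((0%N, Cup b) :: v); split=> //.
    by rewrite (multiple_of_cap_uniq H E1).
  exists b, ((2%N, Cup b') :: v); split=> //.
  by rewrite (multiple_of_cap_uniq H E2).
(* A zigzag cannot be at the bottom: either its cup would be at position i + 1 with no strand below,
   or its cap at position 1 with only two strands. *)
- move=> i b side /= /[dup] H /N[+ _]; case: side H => /= H; first by rewrite addn1.
  rewrite addn0 => i0; move: H; rewrite i0 => H.
  by case: (C _ _ H).
- by move=> i c /N[_ []].
- by move=> i b c /N[].
- by move=> i c /N[_ []].
- move=> i b c /[dup] H /N[i0 _] _; rewrite {}i0 /=.
  split=> -[b0 [w' [[<- <-] {}H]]].
    exists (~~ b), v; split=> //; exact: multiple_of_cap_unflip H.
  exists b, ((0%N, Cross c) :: v); split=> //; exact: multiple_of_cap_flip.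
- by move=> i c /N[_ []].
- by move=> i c /N[_ []].
Qed.

Lemma link_value_move u l r v z : move l r ->
  is_link (u ++ l ++ v) -> is_link (u ++ r ++ v) ->
  link_value (u ++ l ++ v) z <-> link_value (u ++ r ++ v) z.
Proof.
case: u => [|[i g] u] mv; first exact: (link_value_bottom z mv).
rewrite !cat_cons => Hl Hr.
have [i0 [b Eg]] : i = 0%N /\ exists b, g = Cup b.
  apply: top_of_nil_inv => E.
  by move: Hl; rewrite /is_link /is_tangle [top_of _ _]/= E.
subst i g.
have S : same_value [:: b; ~~ b] (u ++ l ++ v) (u ++ r ++ v).
  move: Hl Hr; rewrite /is_link /is_tangle [top_of _ _]/= [X in _ -> X -> _]/=.
  rewrite !top_of_cat; case topu: top_of => [c|] //=; rewrite !top_of_cat.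
  case topl: top_of => [d|] //= _; case topr: top_of => [d'|] //= _.
  have [Ed E] := value_move_top (qs := qs) mv topl topr.
  by rewrite -Ed in topr; apply: same_value_cat topu topl topr E.
split=> -[b0 [w' [[<- <-] H]]].
  by exists b, (u ++ r ++ v); split=> //; apply: eq_multiple_of_cap H.
exists b, (u ++ l ++ v); split=> //; apply: eq_multiple_of_cap H.
exact: same_value_sym.
Qed.

Lemma link_value_isotopic w1 w2 z :
  isotopic w1 w2 -> link_value w1 z <-> link_value w2 z.
Proof.
elim=> [u v l r Hl Hr mv|w|w w' _ IH|w w' w'' _ IH _ IH'] //.
- exact: link_value_move.
- by split=> /IH.
- by rewrite IH.
Qed.

End LinkValue.

(** * Coordinates of tangles *)

Definition full_twist : diagram := [:: (0%N, Cross false); (0%N, Cross false)].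
Definition basis_tangles : seq diagram := [:: [::]; cap_cup; full_twist].

Definition vcomb (a : seq bool) (ws : seq diagram) (cs : seq laurent)
    (x : state) : vec :=
  flatten [seq vscale m.2 (run a m.1 [:: (x, l1)]) | m <- zip ws cs].

Definition coord_check (f : diagram) (cs : seq laurent) : bool :=
  all (fun x => vzero (vsub (run up_down f [:: (x, l1)])
                            (vcomb up_down basis_tangles cs x))) (states 2%N).

(* a_2 is s^2 + q^-2 s^-2, and so on. *)
Definition lau_a (m : Z) : laurent := [:: mon 1 0 m; mon 1 (Z.opp m) (Z.opp m)].
Definition lau_q (cs : seq (Z * Z)) : laurent := [seq mon m.1 m.2 0 | m <- cs].
Definition lau_sum (cs : seq (Z * seq (Z * Z))) : laurent :=
  foldr (fun m => ladd (lmul (if Z.eqb m.1 0 then l1 else lau_a m.1)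
                             (lau_q m.2))) [::] cs.

Definition pairs := seq (Z * Z).
Definition cq (c e : Z) : Z * Z := (c, e).
Definition ca (m : Z) (cs : pairs) : Z * pairs := (m, cs).

Definition box_h : laurent :=
  lau_sum [:: ca 2 [:: cq 1 0]; ca 0 [:: cq (-1) 0; cq (-1) (-2)]].
Definition box1 : laurent :=
  lau_sum [:: ca 2 [:: cq 1 0; cq 1 (-2)]; ca 0 [:: cq (-3) (-2); cq (-1) (-4)]].
Definition box2 : laurent :=
  lau_sum [:: ca 4 [:: cq (-1) 0]; ca 2 [:: cq 3 0; cq 1 (-2)];
              ca 0 [:: cq (-2) 0; cq (-4) (-2)]].
Definition box3 : laurent :=
  lau_sum [:: ca 2 [:: cq 2 0]; ca 0 [:: cq (-3) 0; cq (-1) (-2)]].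

Definition Tp1 : laurent := lau_sum
  [:: ca 2 [:: cq 1 0; cq (-2) (-2); cq 2 (-4); cq (-2) (-6); cq 4 (-8);
               cq (-2) (-10)];
      ca 0 [:: cq (-2) 0; cq 3 (-2); cq (-4) (-4); cq 4 (-6); cq (-8) (-8);
               cq 4 (-10)]].
Definition Tp2 : laurent := lau_sum
  [:: ca 4 [:: cq 2 0; cq (-2) (-2); cq (-4) (-6); cq 4 (-8)];
      ca 2 [:: cq (-5) 0; cq 4 (-2); cq 12 (-6); cq (-8) (-8); cq (-4) (-10)];
      ca 0 [:: cq 4 0; cq 3 (-2); cq (-6) (-4); cq (-6) (-6); cq (-8) (-8);
               cq 16 (-10)]].
Definition Tp3 : laurent := lau_sum
  [:: ca 2 [:: cq 2 (-2); cq (-2) (-4); cq 2 (-6); cq (-4) (-8); cq 2 (-10)];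
      ca 0 [:: cq 1 0; cq (-4) (-2); cq 4 (-4); cq (-4) (-6); cq 8 (-8);
               cq (-4) (-10)]].
Definition Tm1 : laurent := lau_sum
  [:: ca 2 [:: cq 1 2; cq (-2) 0; cq 2 (-2); cq (-2) (-4); cq 4 (-6);
               cq (-2) (-8)];
      ca 0 [:: cq (-1) 0; cq 4 (-2); cq (-4) (-4); cq 4 (-6); cq (-8) (-8);
               cq 4 (-10)]].
Definition Tm2 : laurent := lau_sum
  [:: ca 4 [:: cq 2 2; cq (-2) 0; cq (-4) (-4); cq 4 (-6)];
      ca 2 [:: cq (-3) 2; cq (-4) 0; cq 8 (-2); cq 4 (-4); cq 8 (-6);
               cq (-12) (-8)];
      ca 0 [:: cq 1 2; cq 10 0; cq (-6) (-2); cq (-6) (-4); cq (-16) (-6);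
               cq 8 (-8); cq 8 (-10)]].
Definition Tm3 : laurent := lau_sum
  [:: ca 2 [:: cq 2 0; cq (-2) (-2); cq 2 (-4); cq (-4) (-6); cq 2 (-8)];
      ca 0 [:: cq (-1) 2; cq (-4) (-2); cq 4 (-4); cq (-4) (-6); cq 8 (-8);
               cq (-4) (-10)]].

Definition AS1 : laurent := lau_sum
  [:: ca 6 [:: cq 1 0]; ca 4 [:: cq (-1) 0; cq (-1) (-2)];
      ca 2 [:: cq 1 0; cq 2 (-2)];
      ca 0 [:: cq (-1) 0; cq (-2) (-2); cq (-1) (-4)]].
Definition AS2 : laurent := lau_sum
  [:: ca 4 [:: cq 1 0]; ca 2 [:: cq (-2) 0; cq (-2) (-2)];
      ca 0 [:: cq 1 0; cq 4 (-2); cq 1 (-4)]].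
Definition AS3 : laurent := lau_sum
  [:: ca 6 [:: cq 3 0; cq 1 (-2)];
      ca 4 [:: cq (-7) 0; cq (-8) (-2); cq (-1) (-4)];
      ca 2 [:: cq 7 0; cq 18 (-2); cq 7 (-4)];
      ca 0 [:: cq (-3) 0; cq (-18) (-2); cq (-17) (-4); cq (-2) (-6)]].

Definition l0 : laurent := [::].

Definition box_table (i j : nat) : seq laurent :=
  match i, j with
  | 1, 0 | 0, 1 => [:: l1; l0; l0]
  | 1, 1 => [:: l0; l1; l0]
  | 1, 2 | 2, 1 => [:: l0; l0; l1]
  | 0, 0 => [:: l0; l0; l0]
  | 0, _ | _, 0 => [:: box_h; l0; l0]
  | _, _ => [:: box1; box2; box3]
  end.

(** The doubled trefoils have at most six strands at any level, so their coordinates are verified by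
    evaluating the diagrams outright. *)
Lemma TT_coord_check : coord_check (TT true) [:: Tp1; Tp2; Tp3]
  && coord_check (TT false) [:: Tm1; Tm2; Tm3].
Proof. by vm_compute. Qed.

Definition basis_tangle (i : nat) : diagram := nth [::] basis_tangles i.

Lemma box_coord_check : all (fun i => all (fun j =>
    coord_check (hcat (basis_tangle i) (basis_tangle j)) (box_table i j))
  [:: 0; 1; 2]%N) [:: 0; 1; 2]%N.
Proof. by vm_compute. Qed.

Lemma AS_cap_check : all (fun i =>
    cap_check (behead (AS_closure (basis_tangle i)))
              (nth l0 [:: AS1; AS2; AS3] i)) [:: 0; 1; 2]%N.
Proof. by vm_compute. Qed.

Lemma is_tangle_basis i : (i < 3)%N ->
  is_tangle up_down up_down (basis_tangle i).
Proof. by case: i => [|[|[|]]]. Qed.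

Lemma shift0 w : shift 0 w = w.
Proof. by rewrite /shift -[RHS]map_id; apply: eq_map => -[]. Qed.

Section Coordinates.
Context {K : fieldType} {qs : qsField K}.

Definition has_coords (f : diagram) (c : 'I_3 -> K) : Prop :=
  is_tangle up_down up_down f /\ forall phi x, size x = 2%N ->
  value up_down f phi x = \sum_i c i * value up_down (basis_tangle i) phi x.

Lemma value_sum (I : finType) a w (phi : I -> state -> K) (c : I -> K) x :
  value a w (fun y => \sum_i c i * phi i y) x
  = \sum_i c i * value a w (phi i) x.
Proof.
elim: w a x => [//|e w IHw] a x /=; case: slice_step => [b|]; last first.
  by rewrite big1 // => i _; rewrite mulr0.
rewrite (eq_vdot (psi := fun y => \sum_i c i * value b w (phi i) y)) => [|? _ //].
rewrite /vdot; under eq_bigr do rewrite mulr_sumr.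
rewrite exchange_big; apply: eq_bigr => i _ /=; rewrite mulr_sumr.
by apply: eq_bigr => m _; rewrite mulrCA.
Qed.

(** Coordinates are meaningful because a tangle may be replaced by its linear combination inside any
    diagram. The product of A and the form on the closure come from here. *)
Lemma has_coords_context a u p r f c w phi x : has_coords f c ->
  top_of a u = Some (p ++ up_down ++ r) -> size x = size a ->
  value a (u ++ shift (size p) f ++ w) phi x
  = \sum_i c i * value a (u ++ shift (size p) (basis_tangle i) ++ w) phi x.
Proof.
case=> tf H topu sx; rewrite (value_cat _ _ topu).
under eq_bigr do rewrite (value_cat _ _ topu).
rewrite -value_sum; apply: (eq_value topu sx) => y sy.
have topc g : is_tangle up_down up_down g ->
    top_of (p ++ up_down ++ r) (shift (size p) g) = Some (p ++ up_down ++ r).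
  exact: is_tangle_context.
rewrite (value_cat _ _ (topc _ tf)).
have : (size p + 2 <= size y)%N by rewrite sy !size_cat addnA leq_addr.
case/split_at => y1 [y2 [y3 [-> s1 s2]]].
rewrite (value_context _ _ _ tf) // H //; apply: eq_bigr => i _.
by rewrite (value_cat _ _ (topc _ (is_tangle_basis (ltn_ord i))))
  (value_context _ _ _ (is_tangle_basis (ltn_ord i))).
Qed.

Lemma vdot_vcomb a ws cs x (phi : state -> K) : size cs = size ws ->
  vdot (vcomb a ws cs x) phi
  = \sum_(i < size ws) ev (nth l0 cs i) * value a (nth [::] ws i) phi x.
Proof.
rewrite /vcomb; elim: ws cs => [|w ws IHws] [|c cs] //=.
  by rewrite vdot_nil big_ord0.
by case=> /IHws E; rewrite vdot_cat vdot_scale -value_run E big_ord_recl.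
Qed.

Lemma coord_checkP f cs : is_tangle up_down up_down f -> size cs = 3%N ->
  coord_check f cs -> has_coords f (fun i => ev (nth l0 cs i)).
Proof.
move=> tf sc /allP H; split=> // phi x sx.
have /H H0 : x \in states 2%N by rewrite -sx mem_states.
have := vzeroP (qs := qs) phi H0.
rewrite vdot_sub -value_run vdot_vcomb // => /eqP; rewrite subr_eq0 => /eqP ->.
by [].
Qed.

Lemma hcat_cat f g : hcat f g
  = [:: (1%N, Cup false)] ++ shift 0 f ++ (shift 2 g ++ [:: (1%N, Cap)]).
Proof. by rewrite shift0. Qed.

Lemma has_coords_hcat f g c d : has_coords f c -> has_coords g d ->
  has_coords (hcat f g) (fun k =>
    \sum_i \sum_j c i * d j * ev (nth l0 (box_table i j) k)).
Proof.
move=> Hf Hg; have [tf _] := Hf; have [tg _] := Hg.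
split; first exact: is_tangle_hcat.
move=> phi x sx; rewrite hcat_cat.
rewrite (has_coords_context (p := [::]) (r := up_down) _ _ Hf) //.
transitivity (\sum_i \sum_j c i * d j *
    value up_down (hcat (basis_tangle i) (basis_tangle j)) phi x).
  apply: eq_bigr => i _.
  have topi : top_of up_down ([:: (1%N, Cup false)] ++ basis_tangle i)
      = Some (up_down ++ up_down ++ [::]).
    by case: i => -[|[|[|]]].
  rewrite shift0 catA (has_coords_context (p := up_down) _ _ Hg topi) //.
  rewrite mulr_sumr; apply: eq_bigr => j _; rewrite mulrA; congr (_ * _).
under [RHS]eq_bigr do rewrite mulr_suml.
rewrite [RHS]exchange_big; apply: eq_bigr => i _.
under [RHS]eq_bigr do rewrite mulr_suml.
rewrite [RHS]exchange_big; apply: eq_bigr => j _.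
have mem3 (k : 'I_3) : (k : nat) \in [:: 0; 1; 2]%N by case: k => -[|[|[|]]].
have /allP/(_ _ (mem3 i))/allP/(_ _ (mem3 j)) := box_coord_check.
move=> Hc; have [_ ->] // : has_coords (hcat (basis_tangle i) (basis_tangle j))
    (fun k => ev (nth l0 (box_table i j) k)).
  apply: coord_checkP Hc; first by apply: is_tangle_hcat; apply: is_tangle_basis.
  by case: (i) => -[|[|[|]]] // ?; case: (j) => -[|[|[|]]].
rewrite mulr_sumr; apply: eq_bigr => k _.
by rewrite !mulrA.
Qed.

Definition AS_coef (i : nat) : K := ev (nth l0 [:: AS1; AS2; AS3] i).

Lemma link_value_AS_closure f c : has_coords f c ->
  link_value (AS_closure f) (\sum_i c i * AS_coef i).
Proof.
move=> Hf; exists true, (behead (AS_closure f)); split=> // x sx.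
pose u : diagram := [:: (1%N, Cup true); (0%N, Cup false);
  (1%N, Cross true); (2%N, Cross true); (2%N, Cross true); (1%N, Cross true);
  (0%N, Cap)].
pose w : diagram := [:: (1%N, Cross false); (0%N, Cap); (0%N, Cap)].
have E g : behead (AS_closure g) = u ++ shift (size [:: true]) g ++ w by [].
rewrite E (has_coords_context (r := [:: false]) _ _ Hf) // mulr_suml.
apply: eq_bigr => i _; rewrite -mulrA -E; congr (_ * _).
have mem3 : (i : nat) \in [:: 0; 1; 2]%N by case: i => -[|[|[|]]].
by have /allP/(_ _ mem3)/cap_checkP := AS_cap_check; apply.
Qed.

Definition boxK (c d : 'I_3 -> K) : 'I_3 -> K := fun k =>
  \sum_i \sum_j c i * d j * ev (nth l0 (box_table i j) k).

Definition Tp_coef (i : 'I_3) : K := ev (nth l0 [:: Tp1; Tp2; Tp3] i).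
Definition Tm_coef (i : 'I_3) : K := ev (nth l0 [:: Tm1; Tm2; Tm3] i).
Definition e2_coef (i : 'I_3) : K := (i == 1 :> nat)%:R.

Lemma link_value_AS n : (0 < n)%N -> link_value (AS n)
  (\sum_i iterop n boxK (boxK Tp_coef Tm_coef) e2_coef i * AS_coef i).
Proof.
move=> n0; apply: link_value_AS_closure.
have /andP[P M] := TT_coord_check.
have HP : has_coords (TT true) Tp_coef.
  by apply: coord_checkP P => //; apply: is_tangle_TT.
have HM : has_coords (TT false) Tm_coef.
  by apply: coord_checkP M => //; apply: is_tangle_TT.
have := has_coords_hcat HP HM; rewrite -/(boxK _ _).
move: (hcat _ _) (boxK _ _) => f c Hf; clear -Hf n0.
case: n n0 => // n _; rewrite !iteropS; elim: n => [//|n IHn] /=.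
exact: has_coords_hcat.
Qed.

End Coordinates.

(** * The field of rational functions in q and s *)

Lemma int_of_Z_nat (z : Z) : Z.leb 0 z -> int_of_Z z = Z.to_nat z.
Proof. by case: z => [|p|p] //= _; rewrite Znat.positive_N_nat. Qed.

Lemma int_of_ZM (a b : Z) : int_of_Z (Z.mul a b) = int_of_Z a * int_of_Z b.
Proof. exact: (rmorphM int_of_Z). Qed.

Lemma int_of_ZD (a b : Z) : int_of_Z (Z.add a b) = int_of_Z a + int_of_Z b.
Proof. exact: (rmorphD int_of_Z). Qed.

Lemma int_of_Z_pow (b e : Z) : Z.leb 0 e ->
  int_of_Z (Z.pow b e) = int_of_Z b ^+ Z.to_nat e.
Proof.
move=> /Z.leb_le e0; rewrite -{1}(Znat.Z2Nat.id _ e0).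
elim: (Z.to_nat e) => [//|n IHn].
rewrite Znat.Nat2Z.inj_succ Z.pow_succ_r; last exact: Znat.Nat2Z.is_nonneg.
by rewrite int_of_ZM IHn exprS.
Qed.

Definition shifted_mon (m : monomial) : {poly {poly rat}} :=
  (int_of_Z m.2)%:~R * ('X%:P) ^+ Z.to_nat (Z.add m.1.1 64)
  * 'X ^+ Z.to_nat (Z.add m.1.2 64).

Definition spec_value (p : {poly {poly rat}}) : rat := p.[3%:R].[2%:R].

Lemma spec_value_mon m : Z.leb 0 (Z.add m.1.1 64) -> Z.leb 0 (Z.add m.1.2 64) ->
  spec_value (shifted_mon m)
  = (int_of_Z (Z.mul m.2 (Z.mul (Z.pow 2 (Z.add m.1.1 64))
                               (Z.pow 3 (Z.add m.1.2 64)))))%:~R.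
Proof.
move=> h1 h2; rewrite /shifted_mon.
have M x y : spec_value (x * y) = spec_value x * spec_value y.
  by rewrite /spec_value !hornerM.
have X x n : spec_value (x ^+ n) = spec_value x ^+ n.
  by rewrite /spec_value !horner_exp.
have I (n : int) : spec_value n%:~R = n%:~R.
  have -> : n%:~R = ((n%:~R : rat)%:P)%:P :> {poly {poly rat}}.
    by rewrite !rmorph_int.
  by rewrite /spec_value !hornerC.
have q2 : spec_value 'X%:P = 2%:R by rewrite /spec_value hornerC hornerX.
have s3 : spec_value 'X = 3%:R.
  by rewrite /spec_value hornerX -polyC_natr hornerC.
rewrite !M !X I q2 s3 !int_of_ZM !int_of_Z_pow //.
by rewrite !rmorphM !rmorphXn mulrA.
Qed.

Lemma shifted_exp (K : fieldType) (x : K) i : x != 0 ->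
  Z.leb 0 (Z.add i 64) ->
  x ^+ Z.to_nat (Z.add i 64) = x ^+ 64 * x ^ int_of_Z i.
Proof.
move=> x0 h; rewrite -[RHS]/(x ^ 64%:Z * _) -expfzDr //.
rewrite exprnP -int_of_Z_nat // int_of_ZD addrC.
by [].
Qed.

Lemma shuffle (K : fieldType) (a b c d e : K) :
  c * (a * d) * (b * e) = a * b * (c * d * e).
Proof. by ring. Qed.

(** Multiplication by (q s)^64 makes the element the image of a polynomial, and a polynomial with
    non-zero value at q = 2, s = 3 is non-zero. *)
Lemma Qqs_eval_neq0 p : spec_nonzero p -> laurent_eval q s p != 0.
Proof.
move=> /andP[/allP H nz]; pose P := \sum_(m <- p) shifted_mon m.
have EP : tofrac P = q ^+ 64 * s ^+ 64 * laurent_eval q s p.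
  rewrite rmorph_sum /laurent_eval mulr_sumr.
  apply: eq_big_seq => m /H /andP[h1 h2].
  rewrite /shifted_mon !rmorphM !rmorphXn rmorph_int -/q -/s.
  rewrite (shifted_exp q_neq0 h1) (shifted_exp s_neq0 h2).
  exact: shuffle.
suff : tofrac P != 0 by rewrite EP mulf_eq0 negb_or => /andP[].
rewrite tofrac_eq0; apply: contraNneq nz => P0; apply/eqP.
have : spec_value P = 0 by rewrite P0 /spec_value !horner0.
rewrite /spec_value !horner_sum => {}P0.
set v := foldr _ _ _.
suff E : (int_of_Z v)%:~R = 0 :> rat.
  by move/eqP: E; rewrite intr_eq0 => /eqP Ev; apply: (can_inj int_of_ZK).
rewrite -P0 {P0}/v; clear P EP.
elim: p H => [|m p IHp] H; first by rewrite big_nil.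
rewrite big_cons [foldr _ _ _]/= int_of_ZD intrD IHp => [|x Hx]; last first.
  by apply: H; rewrite inE Hx orbT.
have /andP[h1 h2] := H m (mem_head _ _).
by rewrite -spec_value_mon.
Qed.

Definition Qqs_qsField : qsField Qqs := QsField q_neq0 s_neq0 Qqs_eval_neq0.

Section Coefficients.
Context {K : fieldType} {qs : qsField K}.

Definition a_sym (m : nat) : K := sv ^+ m + qv ^- m * sv ^- m.

Lemma ev_lau_sum cs : ev (lau_sum cs) = \sum_(m <- cs)
  (if Z.eqb m.1 0 then 1 else ev (lau_a m.1)) * ev (lau_q m.2).
Proof.
elim: cs => [|m cs IHcs]; first by rewrite big_nil ev_nil.
by rewrite big_cons -IHcs [LHS]ev_ladd ev_lmul; case: ifP; rewrite ?ev1.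
Qed.

Lemma ev_lau_a2 : ev (lau_a 2) = a_sym 2.
Proof. by rewrite ev_cons !ev_mon /= !mul1r. Qed.
Lemma ev_lau_a4 : ev (lau_a 4) = a_sym 4.
Proof. by rewrite ev_cons !ev_mon /= !mul1r. Qed.
Lemma ev_lau_a6 : ev (lau_a 6) = a_sym 6.
Proof. by rewrite ev_cons !ev_mon /= !mul1r. Qed.

Lemma ev_cons2 m n p : ev (m :: n :: p) = ev [:: m] + ev (n :: p).
Proof. exact: ev_cons. Qed.

(** The exponents appear as images of binary positives and are converted into numerals for
    [ring]. *)
Local Ltac coef_tac :=
  rewrite ev_lau_sum !big_cons big_nil /= ?ev_lau_a2 ?ev_lau_a4 ?ev_lau_a6;
  rewrite ?ev_cons2 ?ev_mon /exprz /intmul /= ?expr0;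
  repeat match goal with |- context [Pos.to_nat ?p] =>
    let n := eval compute in (Pos.to_nat p) in change (Pos.to_nat p) with n end;
  ring.

Lemma ev_Tp1 :
  ev Tp1 = a_sym 2 * (1 - 2 * qv ^- 2 + 2 * qv ^- 4 - 2 * qv ^- 6 + 4 * qv ^-
    8 - 2 * qv ^- 10) - 2 + 3 * qv ^- 2 - 4 * qv ^- 4 + 4 * qv ^- 6 - 8 *
    qv ^- 8 + 4 * qv ^- 10.
Proof. by coef_tac. Qed.

Lemma ev_Tp2 :
  ev Tp2 = a_sym 4 * (2 - 2 * qv ^- 2 - 4 * qv ^- 6 + 4 * qv ^- 8) + a_sym 2 * (-
    5 + 4 * qv ^- 2 + 12 * qv ^- 6 - 8 * qv ^- 8 - 4 * qv ^- 10) + 4 + 3 *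
    qv ^- 2 - 6 * qv ^- 4 - 6 * qv ^- 6 - 8 * qv ^- 8 + 16 * qv ^- 10.
Proof. by coef_tac. Qed.

Lemma ev_Tp3 :
  ev Tp3 = a_sym 2 * (2 * qv ^- 2 - 2 * qv ^- 4 + 2 * qv ^- 6 - 4 * qv ^- 8 +
    2 * qv ^- 10) + 1 - 4 * qv ^- 2 + 4 * qv ^- 4 - 4 * qv ^- 6 + 8 * qv
    ^- 8 - 4 * qv ^- 10.
Proof. by coef_tac. Qed.

Lemma ev_Tm1 :
  ev Tm1 = a_sym 2 * (qv ^+ 2 - 2 + 2 * qv ^- 2 - 2 * qv ^- 4 + 4 * qv ^- 6 -
    2 * qv ^- 8) - 1 + 4 * qv ^- 2 - 4 * qv ^- 4 + 4 * qv ^- 6 - 8 * qv ^-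
    8 + 4 * qv ^- 10.
Proof. by coef_tac. Qed.

Lemma ev_Tm2 :
  ev Tm2 = a_sym 4 * (2 * qv ^+ 2 - 2 - 4 * qv ^- 4 + 4 * qv ^- 6) + a_sym 2 * (-
    3 * qv ^+ 2 - 4 + 8 * qv ^- 2 + 4 * qv ^- 4 + 8 * qv ^- 6 - 12 * qv ^-
    8) + qv ^+ 2 + 10 - 6 * qv ^- 2 - 6 * qv ^- 4 - 16 * qv ^- 6 + 8 * qv
    ^- 8 + 8 * qv ^- 10.
Proof. by coef_tac. Qed.

Lemma ev_Tm3 :
  ev Tm3 = a_sym 2 * (2 - 2 * qv ^- 2 + 2 * qv ^- 4 - 4 * qv ^- 6 + 2 * qv ^-
    8) - qv ^+ 2 - 4 * qv ^- 2 + 4 * qv ^- 4 - 4 * qv ^- 6 + 8 * qv ^- 8 -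
    4 * qv ^- 10.
Proof. by coef_tac. Qed.

Lemma ev_AS1 :
  ev AS1 = a_sym 6 - a_sym 4 * (1 + qv ^- 2) + a_sym 2 * (1 + 2 * qv ^- 2) - 1 - 2 *
    qv ^- 2 - qv ^- 4.
Proof. by coef_tac. Qed.

Lemma ev_AS2 :
  ev AS2 = a_sym 4 - a_sym 2 * (2 + 2 * qv ^- 2) + 1 + 4 * qv ^- 2 + qv ^- 4.
Proof. by coef_tac. Qed.

Lemma ev_AS3 :
  ev AS3 = a_sym 6 * (3 + qv ^- 2) - a_sym 4 * (7 + 8 * qv ^- 2 + qv ^- 4) + a_sym 2 *
    (7 + 18 * qv ^- 2 + 7 * qv ^- 4) - 3 - 18 * qv ^- 2 - 17 * qv ^- 4 - 2
    * qv ^- 6.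
Proof. by coef_tac. Qed.

Lemma ev_box_h :
  ev box_h = sv ^+ 2 + qv ^- 2 * sv ^- 2 - 1 - qv ^- 2.
Proof. by rewrite -/(a_sym 2); coef_tac. Qed.

Lemma ev_box1 :
  ev box1 = a_sym 2 * (1 + qv ^- 2) - 3 * qv ^- 2 - qv ^- 4.
Proof. by coef_tac. Qed.

Lemma ev_box2 :
  ev box2 = - a_sym 4 + a_sym 2 * (3 + qv ^- 2) - 2 - 4 * qv ^- 2.
Proof. by coef_tac. Qed.

Lemma ev_box3 :
  ev box3 = 2 * a_sym 2 - 3 - qv ^- 2.
Proof. by coef_tac. Qed.

End Coefficients.

#[local] Existing Instance Qqs_qsField.

Lemma sum_unit_vectors (R : comNzRingType) (x y z : R) (k : nat) :
  x * [:: 1; 0; 0]`_k + y * [:: 0; 1; 0]`_k + z * [:: 0; 0; 1]`_k = [:: x; y; z]`_k.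
Proof.
by case: k => [|[|[|k]]] /=; rewrite ?nth_nil !mulr0 ?mulr1 ?addr0 ?add0r.
Qed.

Lemma scale_unit_vector (R : comNzRingType) (x : R) (k : nat) :
  x * [:: 1; 0; 0]`_k = [:: x; 0; 0]`_k.
Proof. by case: k => [|[|[|k]]] /=; rewrite ?nth_nil ?mulr0 ?mulr1. Qed.

Lemma basis_boxE (i j k : 'I_3) :
  basis_box i j 0 k = ev (nth l0 (box_table i j) k).
Proof.
have E x y z : [:: x; y; z]`_k = match val k with 0 => x | 1 => y | _ => z end
    :> Qqs by case: k => -[|[|[|]]].
have D (m : 'I_3) : (delta_mx 0 m : coords) 0 k = [:: (m == 0 :> nat)%:R;
    (m == 1 :> nat)%:R; (m == 2 :> nat)%:R]`_k.
  rewrite mxE eqxx /= E -val_eqE eq_sym.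
  by case: k {E} => -[|[|[|]]].
have Eh : (s ^+ 2 + q ^- 2 * s ^- 2 - 1 - q ^- 2) = ev box_h :> Qqs.
  exact: esym ev_box_h.
have E1 : a_ 2 * (1 + q ^- 2) - 3 * q ^- 2 - q ^- 4 = ev box1 :> Qqs.
  exact: esym ev_box1.
have E2 : - a_ 4 + a_ 2 * (3 + q ^- 2) - 2 - 4 * q ^- 2 = ev box2 :> Qqs.
  exact: esym ev_box2.
have E3 : 2 * a_ 2 - 3 - q ^- 2 = ev box3 :> Qqs by exact: esym ev_box3.
rewrite /basis_box Eh E1 E2 E3 {Eh E1 E2 E3}.
have M (u v : coords) : (u + v) 0 k = u 0 k + v 0 k by rewrite mxE.
have Z (x : Qqs) (u : coords) : (x *: u) 0 k = x * u 0 k by rewrite mxE.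
have O : (0 : coords) 0 k = 0 by rewrite mxE.
have V x y z : vec3 x y z 0 k = [:: x; y; z]`_k by rewrite mxE.
have H' (x : Qqs) a b c : (x *: vec3 a b c) 0 k = x * [:: a; b; c]`_k.
  exact: etrans (Z _ _) (congr1 _ (V a b c)).
have C x y z : (x *: e1 + y *: e2 + z *: e3) 0 k = [:: x; y; z]`_k.
  apply: etrans (etrans (M _ _) (congr2 +%R (etrans (M _ _)
    (congr2 +%R (H' x 1 0 0) (H' y 0 1 0))) (H' z 0 0 1))) _.
  exact: sum_unit_vectors.
have H x : (x *: e1) 0 k = [:: x; 0; 0]`_k.
  exact: etrans (H' x 1 0 0) (scale_unit_vector x k).
case: i => -[|[|[|//]]] hi; case: j => -[|[|[|//]]] hj;
  rewrite [box_table _ _]/=.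
- by apply: (etrans O); clear; case: k => -[|[|[|//]]] ?; rewrite ev_nil.
- apply: (etrans (D _)); rewrite E; clear.
  by case: k => -[|[|[|//]]] ?; rewrite /= ?ev_nil ?ev1.
- apply: (etrans (H _)); rewrite E; clear.
  by case: k => -[|[|[|//]]] ?; rewrite /= ?ev_nil.
- apply: (etrans (D _)); rewrite E; clear.
  by case: k => -[|[|[|//]]] ?; rewrite /= ?ev_nil ?ev1.
- apply: (etrans (D _)); rewrite E; clear.
  by case: k => -[|[|[|//]]] ?; rewrite /= ?ev_nil ?ev1.
- apply: (etrans (D _)); rewrite E; clear.
  by case: k => -[|[|[|//]]] ?; rewrite /= ?ev_nil ?ev1.
- apply: (etrans (H _)); rewrite E; clear.
  by case: k => -[|[|[|//]]] ?; rewrite /= ?ev_nil.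
- apply: (etrans (D _)); rewrite E; clear.
  by case: k => -[|[|[|//]]] ?; rewrite /= ?ev_nil ?ev1.
apply: (etrans (C _ _ _)); rewrite E; clear.
by case: k => -[|[|[|//]]] ?.
Qed.

Lemma boxE (x y : coords) k : box x y 0 k = boxK (fun i => x 0 i) (fun i => y 0 i) k.
Proof.
rewrite /box /boxK summxE; apply: eq_bigr => i _; rewrite summxE.
by apply: eq_bigr => j _; rewrite mxE basis_boxE.
Qed.

Lemma TplusE k : Tplus 0 k = Tp_coef k.
Proof.
rewrite /Tplus /vec3 mxE /Tp_coef; case: k => -[|[|[|//]]] hk.
- by symmetry; exact: ev_Tp1.
- by symmetry; exact: ev_Tp2.
- by symmetry; exact: ev_Tp3.
Qed.

Lemma TminusE k : Tminus 0 k = Tm_coef k.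
Proof.
rewrite /Tminus /vec3 mxE /Tm_coef; case: k => -[|[|[|//]]] hk.
- by symmetry; exact: ev_Tm1.
- by symmetry; exact: ev_Tm2.
- by symmetry; exact: ev_Tm3.
Qed.

Lemma sum_ord3 (K : fieldType) (f : 'I_3 -> K) : \sum_i f i = f 0 + f 1 + f 2.
Proof.
rewrite !big_ord_recr big_ord0 /= add0r.
by congr (f _ + f _ + f _); apply: val_inj.
Qed.

Lemma AS_formE (x : coords) : AS_form x = \sum_i x 0 i * AS_coef i.
Proof.
apply: etrans (esym (sum_ord3 _)).
apply: congr2 (congr2 _ (congr1 _ _) (congr1 _ _)) (congr1 _ _).
- by symmetry; exact: ev_AS1.
- by symmetry; exact: ev_AS2.
- by symmetry; exact: ev_AS3.
Qed.

Lemma eq_boxK (c c' d d' : 'I_3 -> Qqs) : c =1 c' -> d =1 d' ->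
  boxK c d =1 boxK c' d'.
Proof.
by move=> Ec Ed k; apply: eq_bigr => i _; apply: eq_bigr => j _; rewrite Ec Ed.
Qed.

Theorem link_value_AS_form n : (0 < n)%N ->
  link_value (AS n) (AS_form (iterop n box (box Tplus Tminus) e2)).
Proof.
move=> n0; rewrite AS_formE.
apply: (eq_ind _ (link_value (AS n)) (link_value_AS n0)).
apply: eq_bigr => i _; apply: (congr1 ( *%R^~ _)).
case: n n0 => // n _; rewrite !iteropS; move: i.
have E0 : boxK Tp_coef Tm_coef =1 (fun i => box Tplus Tminus 0 i).
  move=> i; rewrite boxE; apply: eq_boxK => j; first by rewrite TplusE.
  by rewrite TminusE.
elim: n => [//|n IHn] i; rewrite !iterS boxE.
exact: eq_boxK.
Qed.

(** * The matrix of the braiding *)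

Definition ord_lab (i : 'I_4) : lab := nth X0 labs i.
Definition lab_ord (l : lab) : 'I_4 :=
  match l with X0 => 0 | X1 => 1 | X2 => 2 | X3 => 3 end.

Lemma ord_labK : cancel ord_lab lab_ord.
Proof. by case=> -[|[|[|[|]]]] // h; apply: val_inj. Qed.

Lemma lab_ordK : cancel lab_ord ord_lab.
Proof. by case. Qed.

Definition index_state (u : 'I_(4 * 4)) : state :=
  [:: ord_lab (mxtens_unindex u).1; ord_lab (mxtens_unindex u).2].

Definition state_index (x : state) : 'I_(4 * 4) :=
  mxtens_index (lab_ord (nth X0 x 0), lab_ord (nth X0 x 1)).

Lemma index_stateK : cancel index_state state_index.
Proof.
by move=> u; rewrite /state_index [nth _ _ _]/= [nth _ _ 1]/= !ord_labK
  -[RHS]mxtens_unindexK; congr mxtens_index; case: (mxtens_unindex u).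
Qed.

Lemma state_indexK x : size x = 2%N -> index_state (state_index x) = x.
Proof.
case: x => [|k [|l [|]]] // _.
by rewrite /index_state /state_index mxtens_indexK /= !lab_ordK.
Qed.

Section OperatorMatrices.
Context {K : fieldType} {qs : qsField K}.

Definition delta (y x : state) : K := (x == y)%:R.

Definition opmx (T : state -> vec) : 'M[K]_(4 * 4) :=
  \matrix_(u, v) vdot (T (index_state u)) (delta (index_state v)).

Definition size2 (v : vec) : Prop := forall m, m \in v -> size m.1 = 2%N.

Lemma sum_delta (psi : state -> K) x : size x = 2%N ->
  \sum_u delta (index_state u) x * psi (index_state u) = psi x.
Proof.
move=> sx; rewrite (bigD1 (state_index x)) //= state_indexK // /delta eqxx mul1r.
rewrite big1 ?addr0 // => u ne; case: eqP => [E|_]; last by rewrite mul0r.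
by rewrite E index_stateK eqxx in ne.
Qed.

Lemma vdot_delta v (psi : state -> K) : size2 v ->
  \sum_u vdot v (delta (index_state u)) * psi (index_state u) = vdot v psi.
Proof.
move=> sv; rewrite /vdot; under eq_bigr do rewrite mulr_suml.
rewrite exchange_big /=; apply: eq_big_seq => m Hm.
by rewrite -(sum_delta psi (sv m Hm)) mulr_sumr; under eq_bigr do rewrite -mulrA.
Qed.

Lemma opmxM T1 T2 : (forall x, size x = 2%N -> size2 (T1 x)) ->
  opmx T1 *m opmx T2 = opmx (fun x => vmap T2 (T1 x)).
Proof.
move=> s1; apply/matrixP => u v; rewrite !mxE.
under eq_bigr do rewrite !mxE.
rewrite (vdot_delta (fun x => vdot (T2 x) (delta (index_state v)))); last exact: s1.
by rewrite vdot_vmap.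
Qed.

Lemma eq_opmx T1 T2 : (forall x (phi : state -> K), size x = 2%N ->
    vdot (T1 x) phi = vdot (T2 x) phi) -> opmx T1 = opmx T2.
Proof. by move=> E; apply/matrixP => u v; rewrite !mxE E. Qed.

Lemma opmx_check T1 T2 :
  all (fun x => vzero (vsub (T1 x) (T2 x))) (states 2%N) -> opmx T1 = opmx T2.
Proof.
move=> /allP H; apply: eq_opmx => x phi sx; apply/eqP.
rewrite -subr_eq0 -vdot_sub vzeroP // H // -sx; exact: mem_states.
Qed.

Definition mx4 (f : lab -> seq (lab * laurent)) : 'M[K]_4 :=
  \matrix_(i, j) \sum_(m <- f (ord_lab i)) ev m.2 * (m.1 == ord_lab j)%:R.

Definition dg4 (f : lab -> laurent) : 'M[K]_4 :=
  diag_mx (\row_i ev (f (ord_lab i))).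

Lemma delta_cons k l x y : delta (k :: x) (l :: y) = (l == k)%:R * delta x y.
Proof. by rewrite /delta eqseq_cons; case: (l == k); rewrite ?mul1r ?mul0r. Qed.

Lemma opmx_act X : opmx (act X [:: true; true])
  = mx4 (sk_act X true) *t dg4 (sk_k X true)
    + dg4 (sk_h X true) *t mx4 (sk_act X true).
Proof.
apply/matrixP => u v; rewrite !mxE /index_state.
set i1 := (_ u).1; set i2 := (_ u).2; set j1 := (_ v).1; set j2 := (_ v).2.
have D i j : (ord_lab i == ord_lab j)%:R = (i == j)%:R :> K.
  by rewrite (inj_eq (can_inj ord_labK)).
rewrite /= vdot_cat; congr (_ + _).
  rewrite /vdot big_map mulr_suml; apply: eq_bigr => m _ /=.
  rewrite !ev_lmul ev1 !delta_cons D /delta eqxx.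
  by case: (i2 == j2); rewrite ?mulr1n ?mulr0n; ring.
rewrite /vdot big_map cats0 big_map mulr_sumr; apply: eq_bigr => m _ /=.
rewrite !ev_lmul ev1 !delta_cons D /delta eqxx.
by case: (i1 == j1); rewrite ?mulr1n ?mulr0n; ring.
Qed.

End OperatorMatrices.

Definition tt := [:: true; true].

Section DefinedMatrices.
Context {K : fieldType} {qs : qsField K}.

Local Ltac entries :=
  apply/matrixP => -[[|[|[|[|//]]]] ?] -[[|[|[|[|//]]]] ?]; rewrite !mxE;
  rewrite /= ?big_cons ?big_nil ?ev_cons2 ?ev_mon /exprz /intmul /= ?expr0
          ?mulr1 ?mul1r ?mulr0 ?mul0r ?addr0 ?add0r ?mulr1n ?mulr0n ?addr0 ?add0r.

Lemma mx4_E0 : mx4 (E_act false) = delta_mx 2 1 :> 'M[K]_4.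
Proof. by entries. Qed.

Lemma mx4_E1 : mx4 (E_act true) = (sv - sv^-1) *: delta_mx 1 0
  + (qv * sv - (qv * sv)^-1) *: delta_mx 3 2 :> 'M[K]_4.
Proof. entries => //; rewrite ?invfM; ring. Qed.

Lemma mx4_F0 : mx4 (F_act false) = delta_mx 1 2 :> 'M[K]_4.
Proof. by entries. Qed.

Lemma mx4_F1 : mx4 (F_act true) = delta_mx 0 1 + delta_mx 2 3 :> 'M[K]_4.
Proof. by entries. Qed.

Lemma dg4_const : dg4 (fun=> l1) = 1%:M :> 'M[K]_4.
Proof.
by rewrite -diag_const_mx; congr diag_mx; apply/rowP => i; rewrite !mxE ev1.
Qed.

Lemma dg4_mul f g : dg4 (fun x => lmul (f x) (g x)) = dg4 f *m dg4 g :> 'M[K]_4.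
Proof.
rewrite mulmx_diag; congr diag_mx; apply/rowP => i.
by rewrite !mxE ev_lmul.
Qed.

Lemma opmx_diag f : opmx (fun x => [:: (x, weight (fun=> f) tt x)])
  = dg4 f *t dg4 f :> 'M[K]_(4 * 4).
Proof.
apply/matrixP => u v; rewrite !mxE /index_state.
set i1 := (_ u).1; set i2 := (_ u).2; set j1 := (_ v).1; set j2 := (_ v).2.
have D i j : (ord_lab i == ord_lab j)%:R = (i == j)%:R :> K.
  by rewrite (inj_eq (can_inj ord_labK)).
rewrite vdot_seq1 !ev_lmul ev1 !delta_cons !D /delta eqxx.
by case: (i1 == j1); case: (i2 == j2); rewrite ?mulr1n ?mulr0n; ring.
Qed.

Lemma dg4_row f (r : seq K) :
  [seq ev (f x) | x <- labs] = r -> dg4 f = diag_mx (\row_i r`_i).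
Proof.
move=> <-; congr diag_mx; apply/rowP => i; rewrite !mxE.
by case: i => -[|[|[|[|//]]]].
Qed.

Lemma row_k0 : [seq ev (k_weight false x) | x <- labs] = [:: 1; qv; qv^-1; 1] :> seq K.
Proof. by rewrite /= ?ev1 !ev_mon /exprz /intmul /= ?expr0 ?mulr1 ?mul1r. Qed.

Lemma row_k1 : [seq ev (k_weight true x) | x <- labs]
  = [:: sv; sv; qv * sv; qv * sv] :> seq K.
Proof. by rewrite /= ?ev1 !ev_mon /exprz /intmul /= ?expr0 ?mulr1 ?mul1r. Qed.

Lemma row_ki0 :
  [seq ev (k_weight_inv false x) | x <- labs] = [:: 1; qv^-1; qv; 1] :> seq K.
Proof. by rewrite /= ?ev1 !ev_mon /exprz /intmul /= ?expr0 ?mulr1 ?mul1r. Qed.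

Lemma row_ki1 : [seq ev (k_weight_inv true x) | x <- labs]
  = [:: sv^-1; sv^-1; (qv * sv)^-1; (qv * sv)^-1] :> seq K.
Proof. by rewrite /= !ev_mon /exprz /intmul /= ?expr0 ?mulr1 ?mul1r !invfM. Qed.

Lemma row_sign : [seq ev (odd_sign true x) | x <- labs] = [:: 1; -1; -1; 1] :> seq K.
Proof. by rewrite /= ?ev1 !ev_mon /= !mulr1. Qed.

End DefinedMatrices.

Lemma ord2 (P : 'I_2 -> Prop) : P 0 -> P 1 -> forall i, P i.
Proof.
move=> P0 P1 [[|[|//]] h]; first by rewrite (_ : Ordinal h = 0) //; apply: val_inj.
by rewrite (_ : Ordinal h = 1) //; apply: val_inj.
Qed.

Definition ord_bool (i : 'I_2) : bool := i == 1.

Lemma actKE i : actK i = dg4 (k_weight (ord_bool i)).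
Proof.
move: i; apply: ord2; symmetry; first exact: (dg4_row row_k0).
exact: (dg4_row row_k1).
Qed.

Lemma invmx_actKE i : invmx (actK i) = dg4 (k_weight_inv (ord_bool i)).
Proof.
rewrite invmx_actK; move: i; apply: ord2; symmetry.
  exact: (dg4_row row_ki0).
exact: (dg4_row row_ki1).
Qed.

Lemma koszulE i : koszul i = dg4 (odd_sign (ord_bool i)).
Proof.
move: i; apply: ord2; symmetry; last exact: (dg4_row row_sign).
apply: etrans (@dg4_const _ Qqs_qsField); congr diag_mx; apply/rowP => j.
by rewrite !mxE; case: (ord_lab j).
Qed.

Lemma actFE i : actF i = mx4 (F_act (ord_bool i)).
Proof. by move: i; apply: ord2; symmetry; [exact: mx4_F0 | exact: mx4_F1]. Qed.

(** Undoes the factor q - q^-1 that keeps [E_act] free of denominators. Being non-zero, it affects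
    neither kernels nor commutation. *)
Definition E_scale (i : 'I_2) : Qqs := if ord_bool i then (q - q^-1)^-1 else 1.

Lemma actEE i : actE i = E_scale i *: mx4 (E_act (ord_bool i)).
Proof.
move: i; apply: ord2; rewrite /E_scale /actE [ord_bool _]/=.
  by rewrite scale1r; symmetry; exact: mx4_E0.
apply: esym (etrans (congr1 _ (@mx4_E1 _ Qqs_qsField)) _).
rewrite scalerDr !scalerA; apply: (congr2 +%R); apply: (congr1 ( *:%R^~ _));
  exact: mulrC.
Qed.

Lemma E_scale_neq0 i : E_scale i != 0.
Proof.
rewrite /E_scale; case: ifP => _; last exact: oner_neq0.
rewrite invr_eq0; have : spec_nonzero [:: mon (-1) (-1) 0; mon 1 1 0] by [].
move/(ev_neq0 (qs := Qqs_qsField)); apply: contraNneq => E; apply/eqP.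
rewrite ev_cons2 !ev_mon /exprz /intmul /= !mulr1 mul1r mulN1r addrC.
exact: E.
Qed.

Lemma scale_tens (K : fieldType) m n p r (c : K) (M : 'M_(m, n)) (N : 'M_(p, r)) :
  (c *: M) *t N = c *: (M *t N).
Proof. by apply/matrixP => i j; rewrite !mxE mulrA. Qed.

Lemma tens_scale (K : fieldType) m n p r (c : K) (M : 'M_(m, n)) (N : 'M_(p, r)) :
  M *t (c *: N) = c *: (M *t N).
Proof. by apply/matrixP => i j; rewrite !mxE mulrCA. Qed.

Lemma VV_EE i : VV_E i = E_scale i *: opmx (act (E_skew (ord_bool i)) tt).
Proof.
rewrite opmx_act /VV_E actEE actKE koszulE.
by rewrite scale_tens tens_scale -scalerDr.
Qed.

Lemma VV_FE i : VV_F i = opmx (act (F_skew (ord_bool i)) tt).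
Proof.
rewrite opmx_act /VV_F actFE invmx_actKE koszulE.
rewrite -(@dg4_const _ Qqs_qsField) -dg4_mul.
by [].
Qed.

Lemma VV_KE i :
  VV_K i = opmx (fun x => [:: (x, weight (fun=> k_weight (ord_bool i)) tt x)]).
Proof. by rewrite opmx_diag /VV_K actKE. Qed.

(** * Highest weight vectors and linear elimination *)

Definition R_op (x : state) : vec := local_vec (Cross true) tt x.
Definition K_op (i : bool) (x : state) : vec :=
  [:: (x, weight (fun=> k_weight i) tt x)].

Definition commute_check (S T : state -> vec) : bool :=
  all (fun x => vzero (vsub (vmap T (S x)) (vmap S (T x)))) (states 2%N).

Lemma R_commute_check : all (fun X => commute_check R_op (act X tt)) generators
  && all (fun i => commute_check R_op (K_op i)) [:: false; true].
Proof. by vm_compute. Qed.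

(** An explicit highest weight vector, scaled to have Laurent coefficients, together with its weight
    and its eigenvalue under the braiding. [hw_seed] is a coordinate that determines a highest
    weight vector of this weight. *)
Record hw_data := HwData {
  hw_k0 : laurent; hw_k1 : laurent; hw_eigen : laurent;
  hw_vec : vec; hw_seed : state }.

Definition hw1 : hw_data :=
  HwData l1 (lmon 1 0 2) (lmon 1 0 2) [:: ([:: X0; X0], l1)] [:: X0; X0].
Definition hw2 : hw_data :=
  HwData (lmon 1 1 0) (lmon 1 0 2) (lmon (-1) 0 0)
    [:: ([:: X0; X1], lmon (-1) 0 1); ([:: X1; X0], l1)] [:: X1; X0].
Definition hw3 : hw_data :=
  HwData l1 (lmon 1 1 2) (lmon 1 (-2) (-2))
    [:: ([:: X0; X3], [:: mon (-1) 3 1; mon 1 3 3]);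
        ([:: X3; X0], [:: mon (-1) 1 (-1); mon 1 1 1]);
        ([:: X1; X2], [:: mon 1 1 0; mon (-1) 3 2]);
        ([:: X2; X1], [:: mon (-1) 0 0; mon 1 2 2])] [:: X2; X1].

(* The coefficient of y in the image of a linear combination of states, as a
   linear form in the coefficients of the combination. *)
Definition column (T : state -> vec) (y : state) : vec :=
  flatten [seq [seq (x, m.2) | m <- T x & m.1 == y] | x <- states 2%N].

Definition hw_k (d : hw_data) (i : bool) : laurent :=
  if i then hw_k1 d else hw_k0 d.

Definition hw_equations (d : hw_data) : seq vec :=
  flatten [seq [:: [:: (y, ladd (weight (fun=> k_weight false) tt y) (lopp (hw_k d false)))];
                   [:: (y, ladd (weight (fun=> k_weight true) tt y) (lopp (hw_k d true)))];
                   column (act (E_skew false) tt) y;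
                   column (act (E_skew true) tt) y] | y <- states 2%N].

Definition coef (v : vec) (x : state) : laurent :=
  foldr (fun m => ladd m.2) [::] [seq m <- v | m.1 == x].

Definition lcoef (w : vec) (x : state) : laurent := lnorm (coef w x).

(* Fraction-free elimination: v, with pivot x of coefficient p, is used to
   remove x from w. *)
Definition eliminate (w : vec) (piv : state * laurent * vec) : vec :=
  let: (x, p, v) := piv in
  let c := lcoef w x in
  if c is [::] then w else collect (vsub (vscale p w) (vscale c v)).

Definition echelon_step (pivs : seq (state * laurent * vec)) (v : vec) :=
  (* The oldest pivot comes first: a later row no longer contains the earlier pivots, so removing
     its pivot does not bring them back. *)
  let w := foldl eliminate v (rev pivs) in
  if [seq m <- collect w | spec_nonzero m.2] is m :: _ then
    (m.1, lcoef w m.1, w) :: pivs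
  else pivs.

Definition echelon (vs : seq vec) : seq vec :=
  [seq piv.2 | piv <- foldl echelon_step [::] vs].

(** The newest row comes first in [echelon], so that this is back substitution. *)
Definition solve (vs : seq vec) : seq state :=
  foldl propagate [::] (echelon vs).

(* Not a boolean conjunction, which the conversion test might evaluate. *)
Record hw_ok (d : hw_data) : Prop := {
  hw_covers : covers (solve ([:: (hw_seed d, l1)] :: hw_equations d)) (states 2%N);
  hw_seed_nonzero : spec_nonzero (coef (hw_vec d) (hw_seed d));
  hw_solution : all (fun e => lzero
      (foldr (fun m => ladd (lmul m.2 (coef (hw_vec d) m.1))) [::] e))
    (hw_equations d);
  hw_eigenvector :
    vzero (vsub (vmap R_op (hw_vec d)) (vscale (hw_eigen d) (hw_vec d)));
  hw_size : all (fun m => size m.1 == 2%N) (hw_vec d);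
  hw_E0 : vzero (vmap (act (E_skew false) tt) (hw_vec d));
  hw_E1 : vzero (vmap (act (E_skew true) tt) (hw_vec d));
  hw_K0 : vzero (vsub (vmap (K_op false) (hw_vec d))
                      (vscale (hw_k0 d) (hw_vec d)));
  hw_K1 : vzero (vsub (vmap (K_op true) (hw_vec d))
                      (vscale (hw_k1 d) (hw_vec d))) }.

Lemma hw1_ok : hw_ok hw1. Proof. by split; vm_compute. Qed.
Lemma hw2_ok : hw_ok hw2. Proof. by split; vm_compute. Qed.
Lemma hw3_ok : hw_ok hw3. Proof. by split; vm_compute. Qed.

Fixpoint F_words (n : nat) (v : vec) : seq vec :=
  if n is n'.+1 then
    let ws := F_words n' v in
    [seq vmap (act (F_skew false) tt) w | w <- ws]
    ++ [seq vmap (act (F_skew true) tt) w | w <- ws]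
  else [:: v].

(** Words of length at most four suffice: the longest summand, of dimension 8, has its lowest weight
    four applications of F below the highest one, and the other two need three. *)
Definition words (d : hw_data) : seq vec :=
  flatten [seq F_words n (hw_vec d) | n <- iota 0 5].

Definition generated_vectors : seq vec := words hw1 ++ words hw2 ++ words hw3.

(** In dual form: a functional that vanishes on these vectors is zero. Hence they span V (x) V. *)
Lemma generated_check : covers (solve generated_vectors) (states 2%N).
Proof. by vm_compute. Qed.

Section Elimination.
Context {K : fieldType} {qs : qsField K}.
Variable phi : state -> K.
Local Notation dot v := (vdot (qs := qs) v phi).

Lemma vdot_eliminate w piv : vdot w phi = 0 -> vdot piv.2 phi = 0 ->
  vdot (eliminate w piv) phi = 0.
Proof.
case: piv => [[x p] v] /= w0 v0; case: lcoef => // m r.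
by rewrite vdot_collect vdot_sub !vdot_scale w0 v0 !mulr0 subr0.
Qed.

Lemma vdot_foldl_eliminate w pivs : vdot w phi = 0 ->
  {in pivs, forall piv, vdot piv.2 phi = 0} ->
  vdot (foldl eliminate w pivs) phi = 0.
Proof.
elim: pivs w => [//|piv pivs IH] w w0 H /=; apply: IH => [|p Hp].
  by apply: vdot_eliminate => //; apply: H; rewrite inE eqxx.
by apply: H; rewrite inE Hp orbT.
Qed.

Lemma vdot_echelon vs : {in vs, forall v, vdot v phi = 0} ->
  {in echelon vs, forall v, vdot v phi = 0}.
Proof.
move=> H v /mapP[piv Hp ->].
suff G (pivs : seq (state * laurent * vec)) :
    (forall p, p \in pivs -> dot p.2 = 0) ->
    forall p, p \in foldl echelon_step pivs vs -> dot p.2 = 0.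
  by apply: (G [::] _ _ Hp).
elim: vs pivs H {v piv Hp} => [//|v vs IH] pivs H Hp /=; apply: IH.
  by move=> u Hu; apply: H; rewrite inE Hu orbT.
rewrite /echelon_step; case: filter => // m _ piv; rewrite inE.
case/predU1P=> [->|/Hp //]; apply: vdot_foldl_eliminate.
  by apply: H; rewrite inE eqxx.
by move=> p; rewrite mem_rev => /Hp.
Qed.

Lemma vdot_solve vs : {in vs, forall v, vdot v phi = 0} ->
  {in solve vs, forall x, phi x = 0}.
Proof. by move=> H; apply: vdot_foldl_propagate => //; apply: vdot_echelon. Qed.

Lemma covers_zero Z n x : {in Z, forall x, phi x = 0} ->
  covers Z (states n) -> size x = n -> phi x = 0.
Proof.
by move=> HZ /allP H sx; apply: HZ; apply: H; rewrite -sx; apply: mem_states.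
Qed.

End Elimination.

Section RowVectors.
Context {K : fieldType} {qs : qsField K}.

Definition vrow (v : vec) : 'rV[K]_(4 * 4) :=
  \row_u vdot v (delta (index_state u)).

Lemma vrowM v T : size2 v -> vrow v *m opmx T = vrow (vmap T v).
Proof.
move=> sv; apply/rowP => u; rewrite !mxE.
under eq_bigr do rewrite !mxE.
rewrite (vdot_delta (fun x => vdot (T x) (delta (index_state u)))) //.
by rewrite vdot_vmap.
Qed.

Lemma eq_vrow v w : (forall phi : state -> K, vdot v phi = vdot w phi) ->
  vrow v = vrow w.
Proof. by move=> E; apply/rowP => u; rewrite !mxE E. Qed.

Lemma vrowZ p v : vrow (vscale p v) = ev p *: vrow v.
Proof. by apply/rowP => u; rewrite !mxE vdot_scale. Qed.

Lemma vrow_vzero v : vzero v -> vrow v = 0.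
Proof. by move=> v0; apply/rowP => u; rewrite !mxE vzeroP. Qed.

Lemma vrow_mul v (psi : 'cV[K]_(4 * 4)) : size2 v ->
  vrow v *m psi = (vdot v (fun x => psi (state_index x) 0))%:M.
Proof.
move=> sv; apply/matrixP => i j; rewrite !ord1 !mxE eqxx mulr1n.
rewrite -(vdot_delta _ sv); apply: eq_bigr => u _.
by rewrite !mxE index_stateK.
Qed.

Lemma sum_states (F : state -> K) :
  \sum_(x <- states 2%N) F x = \sum_u F (index_state u).
Proof.
rewrite -(big_map index_state xpredT F); apply: perm_big.
apply: uniq_perm; first by vm_compute.
  by rewrite map_inj_uniq ?index_enum_uniq //; apply: can_inj index_stateK.
move=> x; apply/idP/mapP => [/size_states sx|[u _ ->]].
  by exists (state_index x); rewrite ?mem_index_enum // state_indexK.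
exact: (mem_states (index_state u)).
Qed.

Lemma vdot_column (r : 'rV[K]_(4 * 4)) T y : size y = 2%N ->
  vdot (column T y) (fun x => r 0 (state_index x))
  = (r *m opmx T) 0 (state_index y).
Proof.
move=> sy; rewrite /vdot /column big_flatten big_map sum_states mxE.
apply: eq_bigr => u _; rewrite big_map big_filter [LHS]/= index_stateK mxE mulrC.
rewrite state_indexK // /vdot mulr_suml big_mkcond; apply: eq_bigr => m _.
by rewrite /delta; case: eqP => _; rewrite ?mulr1 ?mulr0 ?mul0r.
Qed.

Lemma ev_coef v x : ev (coef v x) = vdot v (delta x) :> K.
Proof.
rewrite /coef /vdot; elim: v => [|m v IHv] /=; first by rewrite ev_nil big_nil.
rewrite big_cons -IHv /delta; case: eqP => _ /=; first by rewrite ev_ladd mulr1.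
by rewrite mulr0 add0r.
Qed.

End RowVectors.

Section Summands.
Context {K : fieldType} {qs : qsField K}.

Definition Rmx : 'M[K]_(4 * 4) := opmx R_op.

Lemma size2_R x : size2 (R_op x).
Proof. by move=> m /size_local_vec. Qed.

Lemma size2_act X x : size x = 2%N -> size2 (act X tt x).
Proof. by move=> sx m /size_act ->. Qed.

Lemma size2_K i x : size x = 2%N -> size2 (K_op i x).
Proof. by move=> sx m; rewrite inE => /eqP ->. Qed.

Lemma commute_checkP S T :
  (forall x, size x = 2%N -> size2 (S x)) -> (forall x, size x = 2%N -> size2 (T x)) ->
  commute_check S T -> comm_mx (opmx S) (opmx T : 'M[K]_(4 * 4)).
Proof.
by move=> hS hT H; rewrite /comm_mx !opmxM //; apply: opmx_check.
Qed.

Lemma Rmx_comm_E i : comm_mx Rmx (opmx (act (E_skew i) tt)).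
Proof.
apply: commute_checkP; [by move=> x _; apply: size2_R | exact: size2_act |].
by have /andP[+ _] := R_commute_check; case: i => /and5P[].
Qed.

Lemma Rmx_comm_F i : comm_mx Rmx (opmx (act (F_skew i) tt)).
Proof.
apply: commute_checkP; [by move=> x _; apply: size2_R | exact: size2_act |].
by have /andP[+ _] := R_commute_check; case: i => /and5P[].
Qed.

Lemma Rmx_comm_K i : comm_mx Rmx (opmx (K_op i)).
Proof.
apply: commute_checkP; [by move=> x _; apply: size2_R | exact: size2_K |].
by have /andP[_ +] := R_commute_check; case: i => /and3P[].
Qed.

Lemma opmx_K_row (r : 'rV[K]_(4 * 4)) i y : size y = 2%N ->
  (r *m opmx (K_op i)) 0 (state_index y)
  = ev (weight (fun=> k_weight i) tt y) * r 0 (state_index y).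
Proof.
move=> sy; rewrite mxE.
rewrite -(sum_delta (fun x => ev (weight (fun=> k_weight i) tt x)
                               * r 0 (state_index x)) sy).
apply: eq_bigr => u _; rewrite mxE vdot_seq1 index_stateK state_indexK //.
by rewrite /delta eq_sym mulrC mulrAC [RHS]mulrC.
Qed.

End Summands.

Lemma comm_mx_invmx (K : fieldType) n (A B : 'M[K]_n) :
  comm_mx A B -> comm_mx A (invmx B).
Proof.
move=> AB; have [uB|nB] := boolP (B \in unitmx); last by rewrite invmx_out.
rewrite /comm_mx -[LHS]mul1mx -(mulVmx uB) -!mulmxA; congr (_ *m _).
by rewrite mulmxA -AB -mulmxA mulmxV // mulmx1.
Qed.

Definition generator_closed (X : 'M[Qqs]_(4 * 4)) :=
  (X + \sum_(i < 2) (X *m VV_E i + X *m VV_F i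
                     + X *m VV_K i + X *m invmx (VV_K i)))%MS.

Lemma submodule_generatedE W : submodule_generated W = iter 16 generator_closed W.
Proof. by []. Qed.

Lemma Rmx_comm_gen i : [/\ comm_mx Rmx (VV_E i), comm_mx Rmx (VV_F i),
  comm_mx Rmx (VV_K i) & comm_mx Rmx (invmx (VV_K i))].
Proof.
have cK : comm_mx Rmx (VV_K i) by rewrite VV_KE; apply: Rmx_comm_K.
split; [| | exact: cK | exact: comm_mx_invmx cK].
  rewrite VV_EE /comm_mx -scalemxAr -scalemxAl.
  exact: (congr1 _ (Rmx_comm_E _)).
by rewrite VV_FE; apply: Rmx_comm_F.
Qed.

(** The explicit matrix commutes with the action of U_q, so its eigenspaces are submodules. Thus it
    suffices to test the generators of a submodule. *)
Lemma submodule_eigenspace W a : (W <= eigenspace Rmx a)%MS ->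
  (submodule_generated W <= eigenspace Rmx a)%MS.
Proof.
rewrite submodule_generatedE => HW; elim: 16%N => [//|n IHn] /=.
rewrite /generator_closed; set X := iter n _ W in IHn *.
have H A : comm_mx Rmx A -> (X *m A <= eigenspace Rmx a)%MS.
  move=> c; apply/eigenspaceP; rewrite -mulmxA -c mulmxA.
  by move/eigenspaceP: IHn => ->; rewrite scalemxAl.
rewrite addsmx_sub IHn /=; apply/sumsmx_subP => i _.
have [cE cF cK cI] := Rmx_comm_gen i.
rewrite addsmx_sub; apply/andP; split; last exact: H cI.
rewrite addsmx_sub; apply/andP; split; last exact: H cK.
by rewrite addsmx_sub; apply/andP; split; [exact: H cE | exact: H cF].
Qed.

Lemma iter_generator_closed W n k :
  (iter n generator_closed W <= iter (n + k) generator_closed W)%MS.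
Proof.
elim: k => [|k IHk]; first by rewrite addn0.
by rewrite addnS; apply: submx_trans IHk _; apply: addsmxSl.
Qed.

Lemma generator_closed_F X i : (X *m VV_F i <= generator_closed X)%MS.
Proof.
apply: submx_trans (addsmxSr _ _); apply: (sumsmx_sup i); first exact: erefl.
apply: submx_trans (addsmxSl _ _); apply: submx_trans (addsmxSl _ _).
exact: addsmxSr.
Qed.

Definition summand (d : hw_data) : 'M[Qqs]_(4 * 4) :=
  submodule_generated (highest_weight (ev (hw_k0 d)) (ev (hw_k1 d))).

Lemma hw_rowP d (v : 'rV[Qqs]_(4 * 4)) :
  (v <= highest_weight (ev (hw_k0 d)) (ev (hw_k1 d)))%MS ->
  {in hw_equations d, forall e, vdot e (fun x => v 0 (state_index x)) = 0}.
Proof.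
rewrite !sub_capmx -!andbA => /and4P[/sub_kermxP E0 /sub_kermxP E1 /eigenspaceP K0
  /eigenspaceP K1].
have E i : v *m opmx (act (E_skew (ord_bool i)) tt) = 0.
  apply: (scalerI (E_scale_neq0 i)); rewrite scalemxAr -VV_EE scaler0.
  by move: i; apply: ord2; [exact: E0 | exact: E1].
have KK i y : v *m VV_K i = ev (hw_k d (ord_bool i)) *: v -> size y = 2%N ->
    vdot [:: (y, ladd (weight (fun=> k_weight (ord_bool i)) tt y)
      (lopp (hw_k d (ord_bool i))))] (fun x => v 0 (state_index x)) = 0.
  move=> Ki sy; rewrite vdot_seq1 ev_ladd ev_lopp mulrBl -opmx_K_row // -VV_KE Ki.
  by rewrite mxE subrr.
move=> e /flattenP[es /mapP[y /size_states sy ->]].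
have Z (r : 'rV[Qqs]_(4 * 4)) : r = 0 -> r 0 (state_index y) = 0.
  by move=> ->; rewrite mxE.
rewrite !inE => /or4P[] /eqP ->.
- exact: (KK 0 y K0 sy).
- exact: (KK 1 y K1 sy).
- by rewrite vdot_column //; apply: Z; exact: (E 0).
- by rewrite vdot_column //; apply: Z; exact: (E 1).
Qed.

Lemma ev_coef_sum (K : fieldType) (qs : qsField K) (e v : vec) :
  ev (foldr (fun m => ladd (lmul m.2 (coef v m.1))) [::] e)
  = vdot e (fun x => ev (coef v x)) :> K.
Proof.
rewrite /vdot; elim: e => [|m e IHe] /=; first by rewrite ev_nil big_nil.
by rewrite ev_ladd ev_lmul IHe big_cons.
Qed.

Section HighestWeight.
Variable d : hw_data.
Hypothesis Hd : hw_ok d.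

Lemma size2_hw_vec : size2 (hw_vec d).
Proof. by move=> m Hm; apply/eqP; apply: (allP (hw_size Hd) m Hm). Qed.

Lemma hw_vec_eqs :
  {in hw_equations d, forall e, vdot e (fun x => ev (coef (hw_vec d) x)) = 0 :> Qqs}.
Proof.
move=> e He; have H := allP (hw_solution Hd) e He.
by rewrite -ev_coef_sum (lzeroP H).
Qed.

Lemma vrow_Rmx :
  vrow (hw_vec d) *m Rmx = ev (hw_eigen d) *: vrow (hw_vec d) :> 'rV[Qqs]_(4 * 4).
Proof.
rewrite (vrowM _ size2_hw_vec) -vrowZ; apply: eq_vrow => phi; apply/eqP.
by rewrite -subr_eq0 -vdot_sub (vzeroP _ (hw_eigenvector Hd)).
Qed.

(** The multiple is read off at the seed. The difference solves the highest weight equations and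
    vanishes at the seed, so that elimination makes it zero. *)
Lemma hw_unique (v : 'rV[Qqs]_(4 * 4)) :
  (v <= highest_weight (ev (hw_k0 d)) (ev (hw_k1 d)))%MS ->
  exists c, v = c *: vrow (hw_vec d).
Proof.
move=> /hw_rowP Hv.
have s0 := ev_neq0 (qs := Qqs_qsField) (hw_seed_nonzero Hd).
pose phi (x : state) : Qqs := v 0 (state_index x).
pose phi0 (x : state) : Qqs := ev (qs := Qqs_qsField) (coef (hw_vec d) x).
pose c := phi (hw_seed d) / phi0 (hw_seed d).
exists c; apply/rowP => u.
have Z : {in [:: (hw_seed d, l1)] :: hw_equations d,
    forall e, vdot (qs := Qqs_qsField) e (fun x => 1 * phi x + (- c) * phi0 x) = 0}.
  move=> e; rewrite inE vdotD => /predU1P[->|He].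
    by rewrite !vdot_seq1 !ev1 !mul1r mulNr divfK // subrr.
  by rewrite (Hv e He) (hw_vec_eqs He) !mulr0 addr0.
have := covers_zero (vdot_solve Z) (hw_covers Hd) (x := index_state u) erefl.
rewrite mul1r mulNr => /eqP; rewrite subr_eq0 /phi /phi0 index_stateK => /eqP ->.
by rewrite ev_coef !mxE.
Qed.

Lemma hw_eigenspace :
  (highest_weight (ev (hw_k0 d)) (ev (hw_k1 d)) <= eigenspace Rmx (ev (hw_eigen d)))%MS.
Proof.
apply/row_subP => i; have [c ->] := hw_unique (row_sub i _).
by apply: scalemx_sub; apply/eigenspaceP; exact: vrow_Rmx.
Qed.

Lemma summand_eigenspace : (summand d <= eigenspace Rmx (ev (hw_eigen d)))%MS.
Proof. exact: submodule_eigenspace hw_eigenspace. Qed.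

End HighestWeight.

Section GeneratedVectors.
Variable d : hw_data.
Hypothesis Hd : hw_ok d.

Lemma hw_vec_highest :
  (vrow (hw_vec d) <= highest_weight (ev (hw_k0 d)) (ev (hw_k1 d)))%MS.
Proof.
have E i : vzero (vmap (act (E_skew (ord_bool i)) tt) (hw_vec d)) ->
    (vrow (hw_vec d) <= kermx (VV_E i))%MS.
  move=> H; apply/sub_kermxP; rewrite VV_EE -scalemxAr vrowM; last exact: size2_hw_vec Hd.
  by rewrite vrow_vzero // scaler0.
have K i c : vzero (vsub (vmap (K_op (ord_bool i)) (hw_vec d)) (vscale c (hw_vec d))) ->
    (vrow (hw_vec d) <= eigenspace (VV_K i) (ev c))%MS.
  move=> H; apply/eigenspaceP; rewrite VV_KE vrowM; last exact: size2_hw_vec Hd.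
  rewrite -vrowZ; apply: eq_vrow => phi; apply/eqP.
  by rewrite -subr_eq0 -vdot_sub (vzeroP _ H).
rewrite !sub_capmx -!andbA; apply/and4P; split.
- exact: (E 0 (hw_E0 Hd)).
- exact: (E 1 (hw_E1 Hd)).
- exact: (K 0 _ (hw_K0 Hd)).
exact: (K 1 _ (hw_K1 Hd)).
Qed.

End GeneratedVectors.

Lemma size2_vmap T v : (forall x, size x = 2%N -> size2 (T x)) -> size2 v ->
  size2 (vmap T v).
Proof.
move=> hT hv m /flattenP[w /mapP[m' Hm' ->]] /mapP[m'' Hm'' ->].
exact: (hT m'.1 (hv _ Hm')) Hm''.
Qed.

Lemma F_words_generated v n w (W : 'M[Qqs]_(4 * 4)) :
  size2 v -> (vrow v <= W)%MS -> w \in F_words n v ->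
  size2 w /\ (vrow w <= iter n generator_closed W)%MS.
Proof.
move=> hv HW; elim: n w => [|n IHn] w; first by rewrite inE => /eqP ->.
have S i u : u \in F_words n v ->
    size2 (vmap (act (F_skew (ord_bool i)) tt) u)
    /\ (vrow (vmap (act (F_skew (ord_bool i)) tt) u)
        <= iter n.+1 generator_closed W)%MS.
  case/IHn=> hu Hu; split; first by apply: size2_vmap => // x; apply: size2_act.
  rewrite -vrowM // -VV_FE; apply: submx_trans (submxMr _ Hu) _.
  exact: generator_closed_F.
rewrite [F_words _ _]/= mem_cat => /orP[] /mapP[u Hu ->].
  exact: (S 0 u Hu).
exact: (S 1 u Hu).
Qed.

Definition all_summands : 'M[Qqs]_(4 * 4) :=
  (summand hw1 + (summand hw2 + summand hw3))%MS.

Lemma F_words_summand d n w : hw_ok d -> (n <= 16)%N ->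
  w \in F_words n (hw_vec d) -> size2 w /\ (vrow w <= summand d)%MS.
Proof.
move=> Hd n16 Hw.
have [hw Hr] := F_words_generated (size2_hw_vec Hd) (hw_vec_highest Hd) Hw.
split=> //; apply: submx_trans Hr _.
by rewrite /summand submodule_generatedE -(subnKC n16); apply: iter_generator_closed.
Qed.

Lemma words_summand d w : hw_ok d -> w \in words d ->
  size2 w /\ (vrow w <= summand d)%MS.
Proof.
move=> Hd /flattenP[ws /mapP[n Hn ->]]; apply: F_words_summand => //.
by move: Hn; rewrite mem_iota => /andP[_ n5]; rewrite ltnW // (leq_trans n5).
Qed.

Lemma generated_vectors_summands w : w \in generated_vectors ->
  size2 w /\ (vrow w <= all_summands)%MS.
Proof.
rewrite /generated_vectors mem_cat => /orP[Hw|].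
  have [hw Hr] := words_summand hw1_ok Hw; split=> //.
  by apply: submx_trans Hr _; apply: addsmxSl.
rewrite mem_cat => /orP[] Hw.
  have [hw Hr] := words_summand hw2_ok Hw; split=> //.
  by apply: submx_trans Hr (submx_trans _ (addsmxSr _ _)); apply: addsmxSl.
have [hw Hr] := words_summand hw3_ok Hw; split=> //.
by apply: submx_trans Hr (submx_trans _ (addsmxSr _ _)); apply: addsmxSr.
Qed.

(** Each column of the cokernel is a functional that vanishes on all generated vectors, hence is
    zero. No dimension has to be computed. *)
Lemma all_summands_full : row_full all_summands.
Proof.
rewrite -sub1mx submxE mul1mx; apply/eqP/matrixP => u j; rewrite [RHS]mxE.
pose psi : 'cV[Qqs]_(4 * 4) := col j (cokermx all_summands).
have Z w : w \in generated_vectors ->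
    vdot (qs := Qqs_qsField) w (fun x => psi (state_index x) 0) = 0.
  case/generated_vectors_summands => hw; rewrite submxE => /eqP E.
  have -> : vdot w (fun x => psi (state_index x) 0) = (vrow w *m psi) 0 0.
    by rewrite (vrow_mul _ hw) mxE eqxx mulr1n.
  have <- : (vrow w *m cokermx all_summands) 0 j = (vrow w *m psi) 0 0.
    by rewrite [LHS]mxE [RHS]mxE; apply: eq_bigr => k _; rewrite [psi k 0]mxE.
  by rewrite E mxE.
have := covers_zero (vdot_solve Z) generated_check (x := index_state u) erefl.
by rewrite index_stateK /psi mxE.
Qed.

Lemma mulmx_summand d : hw_ok d ->
  summand d *m Rmx = ev (hw_eigen d) *: summand d.
Proof. by move=> Hd; apply/eigenspaceP; apply: summand_eigenspace. Qed.

Lemma summandE1 : summand1 = summand hw1.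
Proof.
apply: (congr2 (fun a b => submodule_generated (highest_weight a b))).
  by rewrite ev1.
by rewrite ev_mon /exprz /intmul /= mulr1 mul1r.
Qed.

Lemma summandE2 : summand2 = summand hw2.
Proof.
apply: (congr2 (fun a b => submodule_generated (highest_weight a b))).
  by rewrite ev_mon /exprz /intmul /= mulr1 mul1r.
by rewrite ev_mon /exprz /intmul /= mulr1 mul1r.
Qed.

Lemma summandE3 : summand3 = summand hw3.
Proof.
apply: (congr2 (fun a b => submodule_generated (highest_weight a b))).
  by rewrite ev1.
by rewrite ev_mon /exprz /intmul /= mul1r.
Qed.

Lemma eigen_direct (K : fieldType) n (R A B C : 'M[K]_n) (a b c : K) :
  A *m R = a *: A -> B *m R = b *: B -> C *m R = c *: C ->
  a != b -> a != c -> (A :&: (B + C))%MS = 0.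
Proof.
move=> EA EB EC ab ac; set W := (A :&: _)%MS.
have EW : W *m R = a *: W.
  by apply/eigenspaceP; apply: submx_trans (capmxSl _ _) _; apply/eigenspaceP.
have /sub_addsmxP[[u1 u2] /= DW] : (W <= B + C)%MS by apply: capmxSr.
(* Multiplication by (R - b)(R - c): it kills [B + C] and acts on [A] by the non-zero scalar (a -
   b)(a - c). *)
pose f (M : 'M[K]_n) := M *m R *m R - (b + c) *: (M *m R) + (b * c) *: M.
have f_eigen (M : 'M[K]_n) d : M *m R = d *: M -> f M = ((d - b) * (d - c)) *: M.
  move=> EM; rewrite /f EM -scalemxAl EM !scalerA -scalerBl -scalerDl.
  by congr (_ *: _); ring.
have fD (M N : 'M[K]_n) : f (M + N) = f M + f N.
  rewrite /f !mulmxDl !scalerDr opprD (addrACA (M *m R *m R)).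
  exact: addrACA.
have := fD (u1 *m B) (u2 *m C); rewrite -DW.
rewrite (f_eigen _ a EW) (f_eigen (u1 *m B) b) ?(f_eigen (u2 *m C) c).
- rewrite !subrr mul0r mulr0 !scale0r addr0 => /eqP.
  by rewrite scaler_eq0 mulf_eq0 !subr_eq0 (negPf ab) (negPf ac) => /eqP.
- by rewrite -mulmxA EC scalemxAr.
by rewrite -mulmxA EB scalemxAr.
Qed.

Lemma proj_eigen (K : fieldType) n (R A B C : 'M[K]_n) (a b c : K) :
  A *m R = a *: A -> B *m R = b *: B -> C *m R = c *: C ->
  a != b -> a != c ->
  [/\ A *m proj_mx A (B + C)%MS = A, B *m proj_mx A (B + C)%MS = 0
    & C *m proj_mx A (B + C)%MS = 0].
Proof.
move=> EA EB EC ab ac; have D := eigen_direct EA EB EC ab ac.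
by split; [apply: proj_mx_id | apply: proj_mx_0; rewrite // addsmxSl
          | apply: proj_mx_0; rewrite // addsmxSr].
Qed.

Lemma row_full_inj_mx (K : fieldType) n (S A B : 'M[K]_n) :
  row_full S -> S *m A = S *m B -> A = B.
Proof. by move=> fS; apply: row_full_inj. Qed.

Lemma eigenvalues_distinct :
  [/\ ev (hw_eigen hw1) != ev (hw_eigen hw2) :> Qqs,
      ev (hw_eigen hw1) != ev (hw_eigen hw3) :> Qqs
    & ev (hw_eigen hw2) != ev (hw_eigen hw3) :> Qqs].
Proof.
have D p r : spec_nonzero (ladd p (lopp r)) -> ev p != ev r :> Qqs.
  by move/(ev_neq0 (qs := Qqs_qsField)); rewrite ev_ladd ev_lopp subr_eq0.
by split; apply: D.
Qed.

Lemma spectral_sum (K : fieldType) n (R A B C : 'M[K]_n) (a c : K) :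
  A *m R = a *: A -> B *m R = (-1) *: B -> C *m R = c *: C ->
  a != -1 -> a != c -> -1 != c -> row_full (A + (B + C))%MS ->
  a *: proj_mx A (B + C)%MS - proj_mx B (A + C)%MS + c *: proj_mx C (A + B)%MS = R.
Proof.
move=> E1 E2 E3 d12 d13 d23 full.
move: (d12) (d13) (d23); rewrite eq_sym => d21; rewrite eq_sym => d31.
rewrite eq_sym => d32.
have [P11 P12 P13] := proj_eigen E1 E2 E3 d12 d13.
have [P22 P21 P23] := proj_eigen E2 E1 E3 d21 d23.
have [P33 P31 P32] := proj_eigen E3 E1 E2 d31 d32.
apply: (row_full_inj_mx full); set M := (X in _ *m X = _).
have HS (X Y : 'M[K]_n) :
    X *m M = X *m R -> Y *m M = Y *m R -> (X + Y)%MS *m M = (X + Y)%MS *m R.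
  move=> eX eY; have : ((X + Y)%MS <= kermx (M - R))%MS.
    rewrite addsmx_sub; apply/andP; split; apply/sub_kermxP.
      by rewrite mulmxBr eX subrr.
    by rewrite mulmxBr eY subrr.
  by move/sub_kermxP/eqP; rewrite mulmxBr subr_eq0 => /eqP.
apply: (@HS A (B + C)%MS); last apply: (@HS B C).
- by rewrite /M mulmxDr mulmxBr -!scalemxAr P11 P21 P31 E1 scaler0 subr0 addr0.
- by rewrite /M mulmxDr mulmxBr -!scalemxAr P12 P22 P32 E2 !scaler0 sub0r addr0 scaleN1r.
by rewrite /M mulmxDr mulmxBr -!scalemxAr P13 P23 P33 E3 scaler0 subr0 add0r.
Qed.

(** The three summands together span, and the explicit matrix acts on them by the three prescribed
    scalars, which are distinct. This makes the sum direct, and the combination of projections has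
    no choice. *)
Theorem sigmaE : sigma = Rmx.
Proof.
have L1 : ev (hw_eigen hw1) = s ^+ 2 :> Qqs.
  by rewrite ev_mon /exprz /intmul /= mulr1 mul1r.
have L2 : ev (hw_eigen hw2) = -1 :> Qqs.
  by rewrite ev_mon /exprz /intmul /= !mulr1.
have L3 : ev (hw_eigen hw3) = q ^- 2 * s ^- 2 :> Qqs.
  by rewrite ev_mon /exprz /intmul /= mul1r.
have := eigenvalues_distinct; rewrite L1 L2 L3 => -[d12 d13 d23].
have E1 := mulmx_summand hw1_ok; have E2 := mulmx_summand hw2_ok.
have E3 := mulmx_summand hw3_ok; rewrite L1 in E1; rewrite L2 in E2.
rewrite L3 in E3; rewrite /sigma summandE1 summandE2 summandE3.
exact: (spectral_sum E1 E2 E3 d12 d13 d23 all_summands_full).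
Qed.

(** * Partial traces *)

Definition crossing_op (e : bool) (x : state) : vec := local_vec (Cross e) tt x.

Lemma crossing_inverse_check : all (fun x =>
  vzero (vsub (vmap (crossing_op false) (crossing_op true x)) [:: (x, l1)]))
  (states 2%N).
Proof. by vm_compute. Qed.

Definition labels (a : seq 'I_4) : state := map ord_lab a.

Lemma uniq_states n : uniq (states n).
Proof.
elim: n => [//|n IHn]; apply: (allpairs_uniq (f := cons)) => //.
by move=> [l x] [m y] _ _ /= [-> ->].
Qed.

Lemma labels_inj : injective labels.
Proof. exact: inj_map (can_inj ord_labK). Qed.

Lemma labels_surj x : labels (map lab_ord x) = x.
Proof. by rewrite /labels -map_comp map_id_in // => l _; apply: lab_ordK. Qed.

Section TupleSums.
Context {K : fieldType} {qs : qsField K}.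

Lemma sum_states_tuple n (F : state -> K) :
  \sum_(x <- states n) F x = \sum_(c : n.-tuple 'I_4) F (labels c).
Proof.
rewrite -(big_map (fun c : n.-tuple 'I_4 => labels c) xpredT F); apply: perm_big.
apply: uniq_perm; first exact: uniq_states.
  by rewrite map_inj_uniq ?index_enum_uniq // => c d /labels_inj/val_inj.
move=> x; apply/idP/mapP => [/size_states sx|[c _ ->]].
  have sz : size (map lab_ord x) == n by rewrite size_map sx.
  by exists (Tuple sz); rewrite ?mem_index_enum //= labels_surj.
by have := mem_states (labels c); rewrite size_map size_tuple.
Qed.

Lemma opmx1 : opmx (fun x => [:: (x, l1)]) = 1%:M :> 'M[K]_(4 * 4).
Proof.
apply/matrixP => u v; rewrite !mxE vdot_seq1 ev1 mul1r /delta.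
by rewrite (inj_eq (can_inj index_stateK)).
Qed.

Lemma crossing_mulmx : opmx (crossing_op true) *m opmx (crossing_op false)
  = 1%:M :> 'M[K]_(4 * 4).
Proof.
rewrite opmxM; last by move=> x _ m /size_local_vec.
by rewrite -opmx1; apply: opmx_check crossing_inverse_check.
Qed.

(* act_at k i (opmx (crossing_op e)), tested against a function of states. *)
Lemma sum_act_at k (i : 'I_k) e (a : k.+1.-tuple 'I_4) (F : state -> K) :
  \sum_c (opmx (crossing_op e)
      (mxtens_index (tnth a (widen_ord (leqnSn k) i), tnth a (lift ord0 i)))
      (mxtens_index (tnth c (widen_ord (leqnSn k) i), tnth c (lift ord0 i)))
    * \prod_(j | (j != widen_ord (leqnSn k) i) && (j != lift ord0 i))
        (tnth a j == tnth c j)%:R) * F (labels c)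
  = vdot (step_vec (nseq k.+1 true) (i : nat, Cross e) (labels a)) F.
Proof.
set l := widen_ord _ i; set r := lift ord0 i.
have ik : (i.+2 <= k.+1)%N by rewrite ltnS.
have : (i + 2 <= size (labels a))%N by rewrite size_map size_tuple addn2.
case/split_at => x [m0 [z [Ea sx sm0]]].
have nthl (c : k.+1.-tuple 'I_4) (j : 'I_k.+1) : nth X0 (labels c) j = ord_lab (tnth c j).
  by rewrite (nth_map (tnth c j)) ?size_tuple // -tnth_nth.
have Em0 : m0 = [:: ord_lab (tnth a l); ord_lab (tnth a r)].
  case: m0 sm0 Ea => [|p [|p' [|]]] // _ Ea; rewrite -!nthl Ea.
  rewrite /= !nth_cat sx ltnn subnn /bump /= add1n ltnNge leqnSn /=.
  by rewrite subSnn.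
have -> : step_vec (nseq k.+1 true) (i : nat, Cross e) (labels a)
    = [seq (x ++ m.1 ++ z, m.2) | m <- crossing_op e m0].
  rewrite /step_vec Ea -sx take_size_cat // drop_size_cat //.
  rewrite take_size_cat // drop_size_cat // sx drop_nseq.
  by rewrite (_ : (k.+1 - i = (k.-1 - i).+2)%N) //; have := ltn_ord i; lia.
have rE : (r : nat) = i.+1 by rewrite /= /bump add1n.
have lE : (l : nat) = i by [].
clearbody l r.
have Y p p' j : nth X0 (x ++ [:: p; p'] ++ z) j
    = if j == i :> nat then p else if j == i.+1 :> nat then p'
      else nth X0 (labels a) j.
  rewrite Ea !nth_cat sx sm0; case: ltnP => ij.
    by rewrite (ltn_eqF ij) (ltn_eqF (leqW ij)).
  rewrite -(subnKC ij); move: (j - i)%N => d; rewrite addKn.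
  have -> : (i + d == i :> nat)%N = (d == 0)%N.
    by rewrite -[X in _ == X]addn0 eqn_add2l.
  have -> : (i + d == i.+1 :> nat)%N = (d == 1)%N by rewrite -addn1 eqn_add2l.
  by case: d => [|[|d]].
have sz p p' : size (x ++ [:: p; p'] ++ z) = k.+1.
  by have := congr1 size Ea; rewrite !size_cat sm0 size_map size_tuple => <-.
have B (m1 : state) (c : k.+1.-tuple 'I_4) : size m1 = 2%N ->
    (m1 == [:: ord_lab (tnth c l); ord_lab (tnth c r)])%:R
    * \prod_(j | (j != l) && (j != r)) (tnth a j == tnth c j)%:R
    = (x ++ m1 ++ z == labels c)%:R :> K.
  case: m1 => [|p [|p' [|]]] // _.
  rewrite -!nthl; case: (_ =P labels c) => [E|nE].
    have Yl : nth X0 (labels c) l = p by rewrite -E Y lE eqxx.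
    have Yr : nth X0 (labels c) r = p'.
      by rewrite -E Y rE (gtn_eqF (ltnSn i)) eqxx.
    rewrite Yl Yr eqxx.
    rewrite mul1r big1 // => j; rewrite -!val_eqE /= rE lE => /andP[/negPf jl /negPf jr].
    have := Y p p' j; rewrite E jl jr !nthl => /(can_inj ord_labK) ->.
    by rewrite eqxx.
  case: eqP => [[Ep Ep']|_]; last by rewrite mul0r.
  rewrite mul1r; apply/eqP/negPn/negP => /prodf_neq0 H; apply: nE.
  apply: (eq_from_nth (x0 := X0)); first by rewrite sz size_map size_tuple.
  move=> j; rewrite sz Y => jk; pose j' := Ordinal jk.
  case: eqP => [->|/eqP ji]; first by rewrite -lE nthl Ep.
  case: eqP => [->|/eqP jr]; first by rewrite -rE nthl Ep'.
  have /H : (j' != l) && (j' != r) by rewrite -!val_eqE /= rE lE ji jr.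
  have -> : nth X0 (labels a) j = ord_lab (tnth a j') by rewrite -nthl.
  have -> : nth X0 (labels c) j = ord_lab (tnth c j') by rewrite -nthl.
  by case: (tnth a j' =P tnth c j') => [->|_] //; rewrite mulr0n eqxx.
rewrite (vdot_map (fun u => x ++ u ++ z)).
have Sc (y : state) : size y = k.+1 ->
    \sum_(c : k.+1.-tuple 'I_4) (y == labels c)%:R * F (labels c) = F y.
  move=> sy; rewrite -(sum_states_tuple k.+1 (fun x => (y == x)%:R * F x)).
  have Hy : y \in states k.+1 by rewrite -sy mem_states.
  rewrite (bigD1_seq y) ?uniq_states //= eqxx mul1r big1 ?addr0 // => t.
  by rewrite eq_sym => /negPf ->; rewrite mul0r.
transitivity (\sum_(m <- crossing_op e m0) ev m.2 *
   \sum_(c : k.+1.-tuple 'I_4) (x ++ m.1 ++ z == labels c)%:R * F (labels c));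
  last first.
  apply: eq_big_seq => m /size_local_vec sm; rewrite Sc //.
  have := congr1 size Ea; rewrite !size_cat sm0 sm size_map size_tuple => <-.
  by [].
under [RHS]eq_bigr do rewrite mulr_sumr.
rewrite exchange_big /=; apply: eq_bigr => c _.
rewrite mxE /index_state !mxtens_indexK /= -Em0 /vdot !mulr_suml.
apply: eq_big_seq => m /size_local_vec sm; rewrite -(B _ _ sm) /delta.
by rewrite !mulrA.
Qed.

(** Each cup is created between the legs of the previous one, so the right legs carry the labels of
    the left ones in reverse order. *)
Lemma value_middle_cups n j x z (phi : state -> K) :
  size x = j -> size z = j ->
  value (nseq j true ++ nseq j false) [seq (i, Cup true) | i <- iota j n] phi (x ++ z)
  = \sum_(c <- states n) phi (x ++ c ++ rev c ++ z).
Proof.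
elim: n j x z => [|n IHn] j x z sx sz; first by rewrite big_seq1.
rewrite [iota _ _]/= map_cons.
have := value_split (qs := qs) (nseq j false) z [seq (i, Cup true) | i <- iota j.+1 n]
  phi (erefl : size [::] = n_in (Cup true)) (erefl : local_step (Cup true) [::]
  = Some [:: true; false]) (x := x) (p := nseq j true) (y := [::]).
rewrite size_nseq => -> //.
have -> : nseq j true ++ [:: true; false] ++ nseq j false
    = nseq j.+1 true ++ nseq j.+1 false.
  by rewrite -[in nseq j.+1 true]addn1 nseqD -catA.
rewrite -[states n.+1]/(flatten [seq [seq l :: c | c <- states n] | l <- labs]).
rewrite big_flatten big_map /vdot big_map.
apply: eq_bigr => l _; rewrite big_map ev1 mul1r.
rewrite -[x ++ _ ++ z]/(x ++ [:: l] ++ l :: z) catA IHn ?size_cat ?sx ?addn1 ?sz //.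
  by apply: eq_bigr => c _; rewrite rev_cons -cats1 -!catA.
by rewrite /= sz.
Qed.

Definition mu_ev (x : state) : K := \prod_(l <- x) ev (mu_laurent l).

Lemma value_middle_caps j x y : size x = j -> size y = j ->
  value (nseq j true ++ nseq j false) [seq (i, Cap) | i <- rev (iota 0 j)]
    (fun=> 1) (x ++ rev y) = (x == y)%:R * mu_ev x :> K.
Proof.
elim: j x y => [|j IHj] x y.
  by move=> /size0nil -> /size0nil ->; rewrite eqxx mul1r /mu_ev big_nil.
case/lastP: x => // x l; case/lastP: y => // y m; rewrite !size_rcons => -[sx] [sy].
rewrite -[j.+1]addn1 iotaD rev_cat [iota _ 1]/= [rev [:: _]]/= add0n cat1s map_cons.
have -> : nseq (j + 1) true ++ nseq (j + 1) false
    = nseq j true ++ [:: true; false] ++ nseq j false.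
  by rewrite nseqD addn1 -catA.
rewrite rev_rcons -cats1 -catA.
have := value_split (qs := qs) (nseq j false) (rev y) [seq (i, Cap) | i <- rev (iota 0 j)]
  (fun=> 1) (erefl : size [:: true; false] = n_in Cap)
  (erefl : local_step Cap [:: true; false] = Some [::])
  (x := x) (p := nseq j true) (y := [:: l; m]).
rewrite size_nseq -[[:: l; m] ++ rev y]/([:: l] ++ m :: rev y) => -> //.
rewrite /local_vec; case: (lab_eqP l m) => [->|ne].
  rewrite vdot_seq1 IHj // cats1 eqseq_rcons eqxx andbT /mu_ev -cats1.
  by rewrite big_cat big_seq1 /=; ring.
rewrite vdot_nil cats1 eqseq_rcons.
by move/eqP/negPf: ne => ->; rewrite andbF mul0r.
Qed.

Lemma slice_step_nseq k (i : 'I_k) e :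
  slice_step (nseq k.+1 true) (i : nat, Cross e) = Some (nseq k.+1 true).
Proof.
have ik := ltn_ord i.
have -> : nseq k.+1 true = nseq i true ++ [:: true; true] ++ nseq (k.-1 - i) true.
  by rewrite -[[:: _; _]]/(nseq 2 true) -!nseqD; congr nseq; lia.
have := slice_step_split (nseq i true) (nseq (k.-1 - i) true)
  (erefl : size [:: true; true] = n_in (Cross e)).
by rewrite size_nseq => ->.
Qed.

Definition crossings k (w : braid_word k) : diagram :=
  [seq (val x.1, Cross x.2) | x <- w].

Lemma top_of_crossings k (w : braid_word k) :
  top_of (nseq k.+1 true) (crossings w) = Some (nseq k.+1 true).
Proof. by elim: w => [//|[i e] w IHw]; rewrite [top_of _ _]/= slice_step_nseq. Qed.

End TupleSums.

Lemma sigmaVE : invmx sigma = opmx (crossing_op false).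
Proof.
have E := @crossing_mulmx _ Qqs_qsField; have [u _] := mulmx1_unit E.
rewrite sigmaE -[Rmx]/(opmx (crossing_op true)).
by rewrite -[LHS]mulmx1 -E mulmxA mulVmx // mul1mx.
Qed.

Lemma psi_value k (w : braid_word k) (a b : k.+1.-tuple 'I_4) :
  psi w a b = value (nseq k.+1 true) (crossings w) (delta (labels b)) (labels a).
Proof.
elim: w a => [|[i e] w IHw] a.
  by rewrite /= /delta (inj_eq labels_inj).
rewrite [RHS]/= slice_step_nseq -sum_act_at [LHS]/=.
apply: eq_bigr => c _; rewrite IHw; apply: (congr1 ( *%R^~ _)).
rewrite /act_at; apply: (congr1 ( *%R^~ _)).
by case: e; rewrite ?sigmaVE ?sigmaE.
Qed.

Lemma ev_mu_laurent i : ev (mu_laurent (ord_lab i)) = mu i.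
Proof.
case: i => -[|[|[|[|//]]]] ?; rewrite ev_mon /mu /exprz /intmul /=;
  by rewrite ?mulr1 ?mul1r ?mulN1r ?mulNr.
Qed.

Lemma top_of_middle_cups n j :
  top_of (nseq j true ++ nseq j false) [seq (i, Cup true) | i <- iota j n]
  = Some (nseq (j + n) true ++ nseq (j + n) false).
Proof.
elim: n j => [|n IHn] j; first by rewrite addn0.
rewrite [iota _ _]/= map_cons [top_of _ _]/=.
have := slice_step_split (nseq j true) (nseq j false)
  (erefl : size [::] = n_in (Cup true)).
rewrite size_nseq => -> /=; rewrite addnS -addSn -IHn.
by rewrite -[in nseq j.+1 true]addn1 nseqD -catA.
Qed.

(** The first minimum of a braid closure is the outermost one and belongs to the first strand, so
    cutting there leaves open exactly the factor over which [partial_trace] does not sum. The last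
    cap contributes [mu v] both to the opened diagram and to [cap_form], and this non-zero factor
    cancels. *)
Theorem partial_trace_link k (w : braid_word k) c :
  link_value (braid_closure w) c -> partial_trace w = c%:M.
Proof.
case=> b [w' [Ew]].
pose cups := [seq (j, Cup true) | j <- iota 1 k].
pose caps := [seq (j, Cap) | j <- rev (iota 0 k.+1)].
move: Ew; rewrite /braid_closure [iota _ _]/= map_cons [_ ++ _]/= => -[<- <-] H.
have mu0 (u : 'I_4) : mu u != 0.
  by rewrite -ev_mu_laurent; case: (ord_lab u); apply: ev_neq0.
have size1 (u : 'I_4) (x : state) : size x = k -> size (ord_lab u :: x) = k.+1.
  by move=> /= ->.
pose n2 : seq bool := nseq k.+1 true ++ nseq k.+1 false.
have topw : top_of n2 (crossings w) = Some n2.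
  have := is_tangle_context [::] (nseq k.+1 false) (top_of_crossings w).
  by rewrite shift0.
have P u v : value (nseq 1 true ++ nseq 1 false) (cups ++ crossings w ++ caps) (fun=> 1)
    [:: ord_lab u; ord_lab v] = mu v * partial_trace w u v.
  rewrite (value_cat _ _ (top_of_middle_cups k 1)) add1n.
  rewrite -[[:: _; _]]/([:: ord_lab u] ++ [:: ord_lab v]) value_middle_cups //.
  rewrite sum_states_tuple [partial_trace w u v]mxE mulr_sumr.
  apply: eq_bigr => t _; rewrite (value_cat _ _ topw).
  have st : size (labels t) = k by rewrite size_map size_tuple.
  have -> : [:: ord_lab u] ++ labels t ++ rev (labels t) ++ [:: ord_lab v]
      = (ord_lab u :: labels t) ++ rev (ord_lab v :: labels t).
    by rewrite rev_cons -cats1.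
  have -> : value n2 (crossings w) (value n2 caps (fun=> 1))
      ((ord_lab u :: labels t) ++ rev (ord_lab v :: labels t))
    = value (nseq k.+1 true) (crossings w)
        (fun y => value n2 caps (fun=> 1) (y ++ rev (ord_lab v :: labels t)))
        (ord_lab u :: labels t).
    have := value_context (qs := Qqs_qsField) (p := [::]) (x := [::])
      (y := ord_lab u :: labels t) (nseq k.+1 false) (rev (ord_lab v :: labels t))
      (value n2 caps (fun=> 1)) (top_of_crossings w).
    by rewrite shift0 /= size_nseq; apply=> //; rewrite st.
  pose dl := delta (K := Qqs) (ord_lab v :: labels t).
  pose m := mu_ev (qs := Qqs_qsField) (ord_lab v :: labels t).
  rewrite (eq_value (psi := fun y => m * dl y + 0 * dl y) (top_of_crossings w)).
  - rewrite value_linear mul0r addr0 /m /mu_ev big_cons ev_mu_laurent -mulrA.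
    congr (_ * _); rewrite psi_value mulrC; congr (_ * _).
    rewrite big_map big_tuple; apply: eq_bigr => j _.
    by rewrite ev_mu_laurent.
  - by rewrite size_nseq /= st.
  move=> y; rewrite size_nseq => sy; rewrite value_middle_caps //; last exact: size1.
  rewrite mul0r addr0 /dl /delta; case: eqP => [->|_]; first by rewrite mulrC.
  by rewrite mul0r mulr0.
apply/matrixP => u v; rewrite [RHS]mxE.
have := etrans (esym (P u v)) (H [:: ord_lab u; ord_lab v] erefl).
have -> : cap_form true [:: ord_lab u; ord_lab v] = (u == v)%:R * mu v :> Qqs.
  have := value_middle_caps (qs := Qqs_qsField) (j := 1) (x := [:: ord_lab u])
    (y := [:: ord_lab v]) erefl erefl.
  rewrite /cap_form => ->; rewrite /mu_ev big_seq1 ev_mu_laurent eqseq_cons eqxx andbT.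
  rewrite (inj_eq (can_inj ord_labK)).
  by case: eqP => [->|_] //; rewrite !mul0r.
rewrite mulrA [X in _ = X]mulrC => /(mulfI (mu0 v)) ->.
by rewrite mulr_natr.
Qed.

(** * Every link is the closure of a braid *)

(* Undefined words are identified, so that most moves hold unconditionally. *)
Inductive eqv (a : seq bool) : diagram -> diagram -> Prop :=
| eqv_step u l r v : top_of a (u ++ l) = top_of a (u ++ r) -> move l r ->
    eqv a (u ++ l ++ v) (u ++ r ++ v)
| eqv_undef w w' : top_of a w = None -> top_of a w' = None -> eqv a w w'
| eqv_refl w : eqv a w w
| eqv_sym w w' : eqv a w w' -> eqv a w' w
| eqv_trans w w' w'' : eqv a w w' -> eqv a w' w'' -> eqv a w w''.

Lemma eqv_top a w w' : eqv a w w' -> top_of a w = top_of a w'.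
Proof.
elim=> [u l r v E _|x y -> ->|x|x y _ ->|x y z _ -> _ ->] //.
by rewrite !catA (top_of_cat _ (u ++ l)) E -top_of_cat.
Qed.

Lemma eqv_isotopic w w' : eqv [::] w w' -> is_link w -> isotopic w w'.
Proof.
elim=> [u l r v E mv|x y ux _|x|x y e IH|x y z e1 IH1 e2 IH2] H.
- apply: isotopic_move => //.
  move: H; rewrite /is_link /is_tangle !catA (top_of_cat _ (u ++ l)) E.
  by rewrite -top_of_cat.
- by move: H; rewrite /is_link /is_tangle ux.
- exact: isotopic_refl.
- by apply: isotopic_sym; apply: IH; rewrite /is_link /is_tangle (eqv_top e).
apply: isotopic_trans (IH1 H) (IH2 _).
by move: H; rewrite /is_link /is_tangle (eqv_top e1).
Qed.

Lemma eqv_catr a v w w' : eqv a w w' -> eqv a (w ++ v) (w' ++ v).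
Proof.
elim=> [u l r t E mv|x y ux uy|x|x y _|x y z _ IH1 _ IH2].
- by rewrite -!catA; apply: eqv_step.
- by apply: eqv_undef; rewrite top_of_cat ?ux ?uy.
- exact: eqv_refl.
- exact: eqv_sym.
- exact: eqv_trans IH1 IH2.
Qed.

Lemma eqv_catl a u w w' : (forall d, top_of a u = Some d -> eqv d w w') ->
  eqv a (u ++ w) (u ++ w').
Proof.
case E: (top_of a u) => [d|] H; last first.
  by apply: eqv_undef; rewrite top_of_cat E.
elim: (H d erefl) => [u' l r v E' mv|x y ux uy|x|x y _|x y z _ IH1 _ IH2].
- rewrite !(catA u u'); apply: eqv_step => //.
  by rewrite -!catA !(top_of_cat _ u) E /= E'.
- by apply: eqv_undef; rewrite top_of_cat E.
- exact: eqv_refl.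
- exact: eqv_sym.
- exact: eqv_trans IH1 IH2.
Qed.

Definition ueq (w w' : diagram) : Prop := forall a, eqv a w w'.

Lemma ueq_refl w : ueq w w. Proof. by move=> a; apply: eqv_refl. Qed.
Lemma ueq_sym w w' : ueq w w' -> ueq w' w.
Proof. by move=> H a; apply: eqv_sym. Qed.
Lemma ueq_trans w w' w'' : ueq w w' -> ueq w' w'' -> ueq w w''.
Proof. by move=> H H' a; apply: eqv_trans (H a) (H' a). Qed.
Lemma ueq_cat u v w w' : ueq w w' -> ueq (u ++ w ++ v) (u ++ w' ++ v).
Proof. by move=> H a; apply: eqv_catl => d _; apply: eqv_catr. Qed.
Lemma ueq_catl u w w' : ueq w w' -> ueq (u ++ w) (u ++ w').
Proof. by move=> H a; apply: eqv_catl. Qed.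
Lemma ueq_catr v w w' : ueq w w' -> ueq (w ++ v) (w' ++ v).
Proof. by move=> H a; apply: eqv_catr. Qed.

Lemma ueq_eqv a w w' : ueq w w' -> eqv a w w'. Proof. by apply. Qed.

Lemma eqv_move a l r b : move l r -> top_of a l = Some b -> top_of a r = Some b ->
  eqv a l r.
Proof.
move=> mv tl tr; have := eqv_step (u := [::]) [::] _ mv (a := a).
by rewrite /= !cats0; apply; rewrite tl tr.
Qed.

Lemma slice_step_small d i g : (size d < i + n_in g)%N ->
  slice_step d (i, g) = None.
Proof.
by case E: slice_step => [b|] //; move/slice_step_size: E; rewrite leqNgt => /negPf ->.
Qed.

Lemma top_of_far d i k g h :
  top_of d [:: (i, g); ((i + n_out g + k)%N, h)]
  = top_of d [:: ((i + n_in g + k)%N, h); (i, g)].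
Proof.
have T (x y : nat * event) : top_of d [:: x; y]
    = obind (slice_step^~ y) (slice_step d x).
  by rewrite /=; case: slice_step => //= e; case: slice_step.
rewrite !T; case: (ltnP (size d) (i + n_in g + k + n_in h)) => [lt|le].
  rewrite (slice_step_small lt) /=; case E: slice_step => [d'|] //=.
  apply: slice_step_small; move: lt.
  have [p [a [b [r [-> -> <- sa /size_local_step sb]]]]] := slice_step_inv E.
  by rewrite !size_cat sa sb; lia.
have [p [a [r [Ed sp sa]]]] : exists p a r,
    [/\ d = p ++ a ++ r, size p = i & size a = n_in g].
  by apply: split_at; move: le; lia.
have [m [a2 [r2 [Er sm sa2]]]] : exists m a2 r2,
    [/\ r = m ++ a2 ++ r2, size m = k & size a2 = n_in h].
  by apply: split_at; move: le; rewrite Ed !size_cat sp sa; lia.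
have C (b u v : seq bool) : p ++ b ++ m ++ u ++ v = (p ++ b ++ m) ++ u ++ v.
  by rewrite -!catA.
have N : (i + n_in g + k)%N = size (p ++ a ++ m) by rewrite !size_cat sp sa sm addnA.
rewrite N Ed Er {2}C slice_step_split // -sp slice_step_split //.
case Eb: (local_step g a) => [b|] /=; last first.
  by case: local_step => //= b2; rewrite -C slice_step_split // Eb.
have -> : (size p + n_out g + k)%N = size (p ++ b ++ m).
  by rewrite !size_cat (size_local_step Eb) sm addnA.
rewrite C slice_step_split //; case: local_step => //= b2.
by rewrite -!C slice_step_split // Eb.
Qed.

Lemma top_of_local n i l r d : fit n l -> fit n r ->
  all (fun a => top_of a l == top_of a r) (bools n) ->
  (forall m, fit m (shift i l) -> (i + n <= m)%N) ->
  (forall m, fit m (shift i r) -> (i + n <= m)%N) ->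
  top_of d (shift i l) = top_of d (shift i r).
Proof.
move=> fl fr /allP H Hl Hr.
case: (ltnP (size d) (i + n)) => [lt|/split_at[p [a [t [-> <- sa]]]]].
  have N w : (forall m, fit m w -> (i + n <= m)%N) -> top_of d w = None.
    move=> Hw; case E: top_of => [c|] //; have := Hw _ (top_of_fit E).
    by rewrite leqNgt lt.
  by rewrite !N.
rewrite -sa in fl fr H; have /eqP E := H a (mem_bools a).
have C w : fit (size a) w -> top_of (p ++ a ++ t) (shift (size p) w)
    = omap (fun b => p ++ b ++ t) (top_of a w).
  move=> fw; case Ew: (top_of a w) => [b|]; first exact: is_tangle_context.
  case E': top_of => [c|] //; have [b] := top_of_context_inv fw E'.
  by rewrite Ew.
by rewrite !C // E.
Qed.

Lemma ueq_move l r : move l r -> (forall d, top_of d l = top_of d r) -> ueq l r.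
Proof.
by move=> mv E a; have := eqv_step (u := [::]) [::] (E a) mv; rewrite /= !cats0.
Qed.

Lemma ueq_far i k g h :
  ueq [:: (i, g); ((i + n_out g + k)%N, h)] [:: ((i + n_in g + k)%N, h); (i, g)].
Proof. by apply: ueq_move (move_far _ _ _ _) _ => d; apply: top_of_far. Qed.

Lemma ueq_slide_cap i c :
  ueq [:: (i, Cross c); (i.+1, Cap)]
      [:: (i.+1, Cross (~~ c)); (i, Cap)].
Proof.
apply: ueq_move (move_slide_cap i c) _ => d.
have := top_of_local (n := 3) (i := i)
  (l := [:: (0%N, Cross c); (1%N, Cap)])
  (r := [:: (1%N, Cross (~~ c)); (0%N, Cap)]) d.
by rewrite /= ?(addn0, addn1) => -> //; first [by vm_compute | move=> m /=; lia].
Qed.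

Lemma ueq_slide_cup i b c :
  ueq [:: (i.+1, Cup b); (i, Cross c)]
      [:: (i, Cup b); (i.+1, Cross (~~ c))].
Proof.
apply: ueq_move (move_slide_cup i b c) _ => d.
have := top_of_local (n := 1) (i := i)
  (l := [:: (1%N, Cup b); (0%N, Cross c)])
  (r := [:: (0%N, Cup b); (1%N, Cross (~~ c))]) d.
by rewrite /= ?(addn0, addn1) => -> //; first [by case: b; case: c | move=> m /=; lia].
Qed.

Lemma ueq_R1_cap i c : ueq [:: (i, Cross c); (i, Cap)] [:: (i, Cap)].
Proof.
apply: ueq_move (move_R1_cap i c) _ => d.
have := top_of_local (n := 2) (i := i)
  (l := [:: (0%N, Cross c); (0%N, Cap)])
  (r := [:: (0%N, Cap)]) d.
by rewrite /= ?(addn0, addn1) => -> //; first [by case: c | move=> m /=; lia].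
Qed.

Lemma ueq_R1_cup i b c : ueq [:: (i, Cup b); (i, Cross c)] [:: (i, Cup (~~ b))].
Proof.
apply: ueq_move (move_R1_cup i b c) _ => d.
have := top_of_local (n := 0) (i := i)
  (l := [:: (0%N, Cup b); (0%N, Cross c)])
  (r := [:: (0%N, Cup (~~ b))]) d.
by rewrite /= ?(addn0, addn1) => -> //; first [by case: b; case: c | move=> m /=; lia].
Qed.

Lemma ueq_R3 i c :
  ueq [:: (i, Cross c); (i.+1, Cross c); (i, Cross c)]
      [:: (i.+1, Cross c); (i, Cross c); (i.+1, Cross c)].
Proof.
apply: ueq_move (move_R3 i c) _ => d.
have := top_of_local (n := 3) (i := i)
  (l := [:: (0%N, Cross c); (1%N, Cross c); (0%N, Cross c)])
  (r := [:: (1%N, Cross c); (0%N, Cross c); (1%N, Cross c)]) d.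
by rewrite /= ?(addn0, addn1) => -> //; first [by case: c | move=> m /=; lia].
Qed.

(** The empty word is defined on any number of strands, two crossings are not; hence the bound, and
    the need to track widths wherever such a pair is inserted. *)
Lemma eqv_R2 i c d : (i + 2 <= size d)%N ->
  eqv d [:: (i, Cross c); (i, Cross (~~ c))] [::].
Proof.
move=> /split_at[p [a [r [-> <- sa]]]]; case: a sa => [|x [|y [|]]] // _.
apply: (eqv_move (b := p ++ [:: x; y] ++ r) (move_R2 _ c)) => //=.
rewrite (slice_step_split p r (a := [:: x; y])) //=.
by rewrite (slice_step_split p r (a := [:: y; x])).
Qed.

Fixpoint outw (n : nat) (w : diagram) : nat :=
  if w is (i, g) :: w' then outw (n - n_in g + n_out g) w' else n.

(** An iterated [move_far]: [w] lies to the right of the [n] strands that enter [v] and of the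
    [outw n v] strands that leave it. *)
Lemma move_past n v w : fit n v ->
  ueq (v ++ shift (outw n v) w) (shift n w ++ v).
Proof.
elim: v n => [|[i g] v IHv] n; first by rewrite cats0 => _; apply: ueq_refl.
rewrite [fit _ _]/= => /andP[le fv]; rewrite [outw _ _]/=.
apply: ueq_trans (ueq_catl [:: (i, g)] (IHv _ fv)) _.
rewrite -[(i, g) :: v]/([:: (i, g)] ++ v) !catA; apply: ueq_catr.
elim: w {v fv IHv} => [|[j h] w IHw]; first exact: ueq_refl.
have F : ueq [:: (i, g); ((n - n_in g + n_out g + j)%N, h)]
             [:: ((n + j)%N, h); (i, g)].
  have := ueq_far i (n - n_in g - i + j) g h.
  rewrite (_ : (i + n_out g + (n - n_in g - i + j) = n - n_in g + n_out g + j)%N); last first.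
    by lia.
  by rewrite (_ : (i + n_in g + (n - n_in g - i + j) = n + j)%N) //; lia.
apply: ueq_trans (ueq_catr (shift (n - n_in g + n_out g) w) F) _.
exact: (ueq_catl [:: ((n + j)%N, h)] IHw).
Qed.

Lemma fit_cross i c (n : nat) w : fit n ((i, Cross c) :: w)
  = (i + 2 <= n)%N && fit n w.
Proof. by rewrite /=; case: leqP => //= le; congr fit; lia. Qed.

Definition crossing_word (b : seq (nat * bool)) : diagram :=
  [seq (x.1, Cross x.2) | x <- b].

Lemma slice_step_cross d i c e :
  slice_step d (i, Cross c) = Some e -> size e = size d.
Proof.
move=> /slice_step_inv[p [a [b [r [-> -> _ sa /size_local_step sb]]]]].
by rewrite !size_cat sa sb.
Qed.

Lemma size_top_of_crossings b d e :
  top_of d (crossing_word b) = Some e -> size e = size d.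
Proof.
elim: b d => [|[i c] b IHb] d /=; first by case=> ->.
by case E: slice_step => [f|] //= /IHb ->; apply: slice_step_cross E.
Qed.

(** When the types differ, a cancelling pair is inserted below, [move_R3] is applied, and a
    cancelling pair is removed on top. *)
Lemma ueq_R3_mixed i x c :
  ueq [:: (i.+1, Cross x); (i, Cross x); (i.+1, Cross c)]
      [:: (i, Cross c); (i.+1, Cross x); (i, Cross x)].
Proof.
have [->|/eqP ne] := eqVneq c x; first by apply: ueq_sym; apply: ueq_R3.
have {ne} -> : c = ~~ x by move: ne; case: c x => -[].
have G d : (i + 3 <= size d)%N ->
  eqv d [:: (i.+1, Cross x); (i, Cross x); (i.+1, Cross (~~ x))]
        [:: (i, Cross (~~ x)); (i.+1, Cross x); (i, Cross x)].
  move=> sd.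
  set w := [:: (i.+1, Cross x); (i, Cross x); (i.+1, Cross (~~ x))].
  apply: (eqv_trans (w' := [:: (i, Cross (~~ x)); (i, Cross x)] ++ w)).
    apply: eqv_sym; apply: (eqv_catr w (w' := [::])).
    by rewrite -{2}[x]negbK; apply: eqv_R2; lia.
  apply: (eqv_trans (w' := [:: (i, Cross (~~ x))]
    ++ [:: (i.+1, Cross x); (i, Cross x); (i.+1, Cross x)] ++ [:: (i.+1, Cross (~~ x))])).
    exact: (ueq_cat [:: (i, Cross (~~ x))] [:: (i.+1, Cross (~~ x))] (ueq_R3 i x)).
  rewrite -[X in eqv d _ X]cats0.
  apply: (eqv_catl (u := [:: (i, Cross (~~ x)); (i.+1, Cross x); (i, Cross x)])
    (w := [:: (i.+1, Cross x); (i.+1, Cross (~~ x))]) (w' := [::])).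
  move=> e top_e;
  have se := size_top_of_crossings (b := [:: (i, ~~ x); (i.+1, x); (i, x)]) top_e.
  apply: eqv_R2.
  by rewrite se; lia.
move=> d; case: (leqP (i + 3) (size d)) => [/G//|lt].
have U w : ~~ fit (size d) w -> top_of d w = None.
  by case E: top_of => [b|] // /negP[]; apply: top_of_fit E.
by apply: eqv_undef; apply: U; rewrite !fit_cross; lia.
Qed.

Lemma eqv_at a u v l r w w' : (forall d, top_of a u = Some d -> eqv d l r) ->
  w = u ++ l ++ v -> w' = u ++ r ++ v -> eqv a w w'.
Proof. by move=> H -> ->; apply: eqv_catl => d /H E; apply: eqv_catr. Qed.

Lemma ueq_at u v l r w w' : ueq l r ->
  w = u ++ l ++ v -> w' = u ++ r ++ v -> ueq w w'.
Proof. by move=> H E E' a; apply: eqv_at E E' => d _; apply: H. Qed.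

Arguments eqv_at {a} u v l r {w w'}.
Arguments ueq_at u v {l r w w'}.

Lemma top_of_shift1 x a w :
  top_of (x :: a) (shift 1 w) = omap (cons x) (top_of a w).
Proof.
elim: w a => [|[i g] w IHw] a //=.
have -> : slice_step (x :: a) ((1 + i)%N, g) = omap (cons x) (slice_step a (i, g)).
  rewrite /slice_step /=; case: g => [b||c]; first by rewrite ltnS; case: ifP.
    by case: (drop i a) => [|y [|z t]] //; case: ifP.
  by case: (drop i a) => [|y [|z t]].
by case: slice_step => //= b.
Qed.

Lemma move_shift1 l r : move l r -> move (shift 1 l) (shift 1 r).
Proof.
case=> [i k g h|i b e|i c|i b c|i c|i b c|i c|i c].
- exact: (move_far i.+1).
- exact: (move_zigzag i.+1).
- exact: move_slide_cap.
- exact: move_slide_cup.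
- exact: move_R1_cap.
- exact: move_R1_cup.
- exact: move_R2.
exact: move_R3.
Qed.

Lemma eqv_shift1 x a w w' :
  eqv a w w' -> eqv (x :: a) (shift 1 w) (shift 1 w').
Proof.
elim=> [u l r v E mv|y z uy uz|y|y z _|y z t _ IH1 _ IH2].
- rewrite /shift !map_cat; apply: eqv_step (move_shift1 mv).
  by rewrite -!map_cat -!/(shift 1 _) !top_of_shift1 E.
- by apply: eqv_undef; rewrite top_of_shift1 ?uy ?uz.
- exact: eqv_refl.
- exact: eqv_sym.
- exact: eqv_trans IH1 IH2.
Qed.

Lemma shift_cat k u v : shift k (u ++ v) = shift k u ++ shift k v.
Proof. exact: map_cat. Qed.

Lemma shift_shift j k w : shift j (shift k w) = shift (j + k) w.
Proof. by rewrite /shift -map_comp; apply: eq_map => x /=; rewrite addnA. Qed.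

(* [sink p] moves the strand p to the left of the first p strands. *)
Fixpoint sink (p : nat) : diagram :=
  if p is p'.+1 then (p', Cross false) :: sink p' else [::].

(** The inverse of [sink p]. *)
Fixpoint raise (p : nat) : diagram :=
  if p is p'.+1 then raise p' ++ [:: (p', Cross true)] else [::].

Lemma sink_add m n : sink (m + n) = shift n (sink m) ++ sink n.
Proof. by elim: m => [|m IHm] //=; rewrite IHm addnC. Qed.

Lemma fit_sink p n : (p < n)%N -> fit n (sink p).
Proof.
elim: p n => [|p IHp] n //= lt; rewrite IHp; last by lia.
by rewrite andbT; lia.
Qed.

Lemma outw_sink p n : (p < n)%N -> outw n (sink p) = n.
Proof. by elim: p n => [|p IHp] n //= lt; rewrite (_ : n - 2 + 2 = n)%N ?IHp; lia. Qed.

Lemma outw_cat n u v : outw n (u ++ v) = outw (outw n u) v.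
Proof. by elim: u n => [|[i g] u IHu] n /=. Qed.

Lemma fit_cat n u v : fit n (u ++ v) = fit n u && fit (outw n u) v.
Proof. by elim: u n => [|[i g] u IHu] n //=; rewrite IHu andbA. Qed.

Lemma outw_raise p n : (p < n)%N -> outw n (raise p) = n.
Proof. by elim: p => [|p IHp] //= lt; rewrite outw_cat IHp /=; lia. Qed.

Lemma fit_raise p n : (p < n)%N -> fit n (raise p).
Proof. by elim: p => [|p IHp] //= lt; rewrite fit_cat IHp ?outw_raise //=; lia. Qed.

Lemma sink_far p i g : (p < i)%N -> ueq (sink p ++ [:: (i, g)]) ((i, g) :: sink p).
Proof.
move=> lt; have := move_past [:: ((i - p.+1)%N, g)] (fit_sink (leqnn p.+1)).
by rewrite outw_sink //= subnKC.
Qed.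

Lemma raise_far p i g : (p < i)%N -> ueq (raise p ++ [:: (i, g)]) ((i, g) :: raise p).
Proof.
move=> lt; have := move_past [:: ((i - p.+1)%N, g)] (fit_raise (leqnn p.+1)).
by rewrite outw_raise //= subnKC.
Qed.

(** In [sink] the moving strand passes over all the others, so it slides across a crossing of either
    type. *)
Lemma sink_cross p i c : (i.+1 < p)%N ->
  ueq (sink p ++ [:: (i.+1, Cross c)]) ((i, Cross c) :: sink p).
Proof.
move=> lt; rewrite -(subnK lt) sink_add /=; set u := shift _ _.
apply: (ueq_trans (w' := u ++ [:: (i.+1, Cross false); (i, Cross false);
  (i.+1, Cross c)] ++ sink i)).
  by apply: (ueq_at (u ++ [:: (i.+1, Cross false); (i, Cross false)]) [::]
    (sink_far (Cross c) (ltnSn i))); rewrite ?cats0 -?catA.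
apply: (ueq_trans (w' := u ++ [:: (i, Cross c); (i.+1, Cross false); (i, Cross false)]
  ++ sink i)).
  exact: ueq_cat (ueq_R3_mixed _ _ _).
have F : fit i.+2 [:: (i, Cross c)] by rewrite /= addn2 leqnn.
have O : outw i.+2 [:: (i, Cross c)] = i.+2 by rewrite /=; lia.
have H := move_past (sink (p - i.+2)) F; rewrite O in H.
apply: ueq_sym.
by apply: (ueq_at [::] ([:: (i.+1, Cross false); (i, Cross false)] ++ sink i) H);
  rewrite /= -?catA.
Qed.

(** * Gathering the upward strands on the left *)

Definition st (p r : nat) : seq bool := nseq p true ++ nseq r false.

Lemma size_st p r : size (st p r) = (p + r)%N.
Proof. by rewrite size_cat !size_nseq. Qed.

Lemma step_st_up p r i c : (i.+1 < p)%N ->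
  slice_step (st p r) (i, Cross c) = Some (st p r).
Proof.
move=> lt; have E : st p r = nseq i true ++ [:: true; true] ++ st (p - i.+2) r.
  rewrite /st -[[:: true; true]]/(nseq 2 true) !catA -!nseqD.
  by congr (nseq _ _ ++ _); lia.
have := slice_step_split (nseq i true) (st (p - i.+2) r) (a := [:: true; true])
  (g := Cross c) erefl.
by rewrite size_nseq -E => -> /=; rewrite [in RHS]E.
Qed.

Lemma step_st_down p r i c : (p <= i)%N -> (i.+1 < p + r)%N ->
  slice_step (st p r) (i, Cross c) = Some (st p r).
Proof.
move=> le lt; have E : st p r
    = st p (i - p) ++ [:: false; false] ++ nseq (p + r - i.+2) false.
  rewrite /st -!catA; congr cat; rewrite -[[:: false; false]]/(nseq 2 false) -!nseqD.
  by congr nseq; lia.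
have := slice_step_split (st p (i - p)) (nseq (p + r - i.+2) false)
  (a := [:: false; false]) (g := Cross c) erefl.
by rewrite size_st subnKC // -E => -> /=; rewrite [in RHS]E.
Qed.

Lemma step_st_cup p r : slice_step (st p r) (p, Cup true) = Some (st p.+1 r.+1).
Proof.
have := slice_step_split (nseq p true) (nseq r false) (a := [::]) (g := Cup true) erefl.
rewrite size_nseq => -> /=; congr Some.
by rewrite /st -addn1 nseqD -catA.
Qed.

Lemma step_st_cap p r : slice_step (st p.+1 r.+1) (p, Cap) = Some (st p r).
Proof.
have := slice_step_split (nseq p true) (nseq r false) (a := [:: true; false])
  (g := Cap) erefl.
by rewrite size_nseq /st -[p.+1]addn1 nseqD -catA.
Qed.

(* Words all of whose levels are p upward strands followed by r downward ones. *)
Inductive nword (p r : nat) : diagram -> nat -> nat -> Prop :=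
| nword_nil : nword p r [::] p r
| nword_up i c w p' r' : (i.+1 < p)%N -> nword p r w p' r' ->
    nword p r ((i, Cross c) :: w) p' r'
| nword_down i c w p' r' : (p <= i)%N -> (i.+1 < p + r)%N -> nword p r w p' r' ->
    nword p r ((i, Cross c) :: w) p' r'
| nword_cup w p' r' : nword p.+1 r.+1 w p' r' -> nword p r ((p, Cup true) :: w) p' r'
| nword_cap p0 r0 w p' r' : p = p0.+1 -> r = r0.+1 -> nword p0 r0 w p' r' ->
    nword p r ((p0, Cap) :: w) p' r'.

Lemma nword_top p r w p' r' : nword p r w p' r' -> top_of (st p r) w = Some (st p' r').
Proof.
elim=> {p r w p' r'} [//|p r i c w p' r' lt _ IH|p r i c w p' r' le lt _ IH|
  p r w p' r' _ IH|p r p0 r0 w p' r' -> -> _ IH]; rewrite /top_of -/top_of.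
- by rewrite step_st_up.
- by rewrite step_st_down.
- by rewrite step_st_cup.
by rewrite step_st_cap.
Qed.

Lemma nword_cat p r w p' r' w' p'' r'' :
  nword p r w p' r' -> nword p' r' w' p'' r'' -> nword p r (w ++ w') p'' r''.
Proof.
by elim=> {p r w p' r'} [//|p r i c w p' r' lt _ IH|p r i c w p' r' le lt _ IH|
  p r w p' r' _ IH|p r p0 r0 w p' r' Ep Er _ IH] /IH H;
  [apply: nword_up|apply: nword_down|apply: nword_cup|apply: nword_cap Ep Er _].
Qed.

Lemma nword_shift p r w p' r' : nword p r w p' r' -> nword p.+1 r (shift 1 w) p'.+1 r'.
Proof.
elim=> {p r w p' r'} [p r|p r i c w p' r' lt _ IH|p r i c w p' r' le lt _ IH|
  p r w p' r' _ IH|p r p0 r0 w p' r' -> -> _ IH]; rewrite /= ?add1n.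
- exact: nword_nil.
- exact: nword_up.
- by apply: nword_down; rewrite ?addSn.
- exact: nword_cup.
exact: (nword_cap (p0 := p0.+1)).
Qed.

Lemma nword_sink p r k : (k < p)%N -> nword p r (sink k) p r.
Proof.
elim: k => [|k IHk] lt; first exact: nword_nil.
by apply: nword_up => //; apply: IHk; lia.
Qed.

Lemma nword_raise p r k : (k < p)%N -> nword p r (raise k) p r.
Proof.
elim: k => [|k IHk] lt; first exact: nword_nil.
apply: nword_cat (IHk _) _; first by lia.
by apply: nword_up => //; apply: nword_nil.
Qed.

(** A downward strand to the left of a sorted word is replaced by one just to the right of the
    upward strands. The sinking strand slides past one event at a time; a cup or a cap costs one
    crossing, between two downward strands. *)
Lemma sink_nword p r w p' r' : nword p r w p' r' ->
  exists2 N, nword p r.+1 N p' r'.+1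
    & eqv (st p r.+1) (sink p ++ shift 1 w) (N ++ sink p').
Proof.
have K p0 r0 x N0 p1 r1 w0 p2 r2 :
    nword p0 r0.+1 N0 p1 r1.+1 ->
    eqv (st p0 r0.+1) (sink p0 ++ shift 1 [:: x]) (N0 ++ sink p1) ->
    (exists2 N, nword p1 r1.+1 N p2 r2.+1
      & eqv (st p1 r1.+1) (sink p1 ++ shift 1 w0) (N ++ sink p2)) ->
    exists2 N, nword p0 r0.+1 N p2 r2.+1
      & eqv (st p0 r0.+1) (sink p0 ++ shift 1 (x :: w0)) (N ++ sink p2).
  move=> n0 e0 [N nN eN]; exists (N0 ++ N); first exact: nword_cat nN.
  have := eqv_catr (shift 1 w0) e0; rewrite -catA /= => e1.
  apply: eqv_trans e1 _; rewrite -!catA; apply: eqv_catl => d.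
  by rewrite (nword_top n0) => -[<-].
elim=> {p r w p' r'} [p r|p r i c w p' r' lt _|p r i c w p' r' le lt _|
  p r w p' r' _|p r p0 r0 w p' r' -> -> _].
- by exists [::]; [apply: nword_nil|rewrite cats0; apply: eqv_refl].
- apply: (K _ _ _ [:: (i, Cross c)]); first by apply: nword_up lt (nword_nil _ _).
  exact: sink_cross.
- apply: (K _ _ _ [:: (i.+1, Cross c)]).
    by apply: nword_down; [lia|lia|apply: nword_nil].
  by apply: sink_far; rewrite /=; lia.
- apply: (K _ _ _ [:: (p, Cup true); (p.+1, Cross false)]).
    by apply: nword_cup; apply: nword_down; [lia|lia|apply: nword_nil].
  apply: eqv_trans (sink_far (Cup true) (ltnSn p) _) _.
  (* A cancelling pair is created; its lower crossing is then slid through the cup. *)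
  apply: (eqv_trans (w' := [:: (p.+1, Cup true); (p, Cross true); (p, Cross false)]
    ++ sink p)).
    apply: eqv_sym; apply: (eqv_at [:: (p.+1, Cup true)] (sink p)
      [:: (p, Cross true); (p, Cross false)] [::]) => // d /=.
    case E: slice_step => [e|] //= [<-]; apply: eqv_R2.
    have := slice_step_inv E => -[p1 [a [b [r1 [Ed -> _ sa /size_local_step sb]]]]].
    have := size_st p r.+1; rewrite Ed !size_cat sb sa /=; lia.
  exact: (ueq_cat [::] ((p, Cross false) :: sink p) (ueq_slide_cup p true true)).
apply: (K _ _ _ [:: (p0.+1, Cross true); (p0, Cap)]).
  apply: nword_down => //; first by lia.
  exact: nword_cap erefl erefl (nword_nil _ _).
rewrite /= add1n.
apply: (eqv_trans (w' := [:: (p0, Cross false); (p0.+1, Cap)] ++ sink p0)).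
  exact: (ueq_catl [:: (p0, Cross false)] (sink_far Cap (ltnSn p0))).
exact: (ueq_catr _ (ueq_slide_cap p0 false)).
Qed.

(* [mix a] carries the upward strands, gathered on the left, to the places
   where [a] has them. *)
Fixpoint mix (a : seq bool) : diagram :=
  if a is x :: a' then
    (if x then [::] else sink (count id a')) ++ shift 1 (mix a')
  else [::].

Definition st_of (a : seq bool) := st (count id a) (count negb a).

Lemma top_of_sink p t :
  top_of (nseq p true ++ false :: t) (sink p) = Some (false :: nseq p true ++ t).
Proof.
elim: p t => [|p IHp] t //.
have H := slice_step_split (nseq p true) t (a := [:: true; false])
  (g := Cross false) erefl.
rewrite size_nseq in H; have E u : nseq p true ++ true :: u = nseq p.+1 true ++ u.
  by elim: (p) => //= k ->.
by rewrite -E [top_of _ _]/= H /= IHp E.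
Qed.

Lemma top_of_mix a : top_of (st_of a) (mix a) = Some a.
Proof.
elim: a => [|[] a IHa] //.
  by rewrite [top_of _ _](top_of_shift1 true (st_of a)) IHa.
by rewrite [mix _]/= top_of_cat (top_of_sink (count id a) (nseq (count negb a) false))
  /= [top_of _ _](top_of_shift1 false (st_of a)) IHa.
Qed.

(** [mix] can be pushed up through [w], which becomes sorted on the way. The condition composes, so
    it has only to be proved for single events, and for a link both [mix] are empty. *)
Definition sortable (a : seq bool) (w : diagram) (b : seq bool) : Prop :=
  exists2 N, nword (count id a) (count negb a) N (count id b) (count negb b)
    & eqv (st_of a) (mix a ++ w) (N ++ mix b).

Lemma sortable_nil a : sortable a [::] a.
Proof. by exists [::]; [apply: nword_nil|rewrite cats0; apply: eqv_refl]. Qed.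

Lemma sortable_cat a w b v c :
  sortable a w b -> sortable b v c -> sortable a (w ++ v) c.
Proof.
move=> [N nN eN] [M nM eM]; exists (N ++ M); first exact: nword_cat nM.
have := eqv_catr v eN; rewrite -!catA => e; apply: eqv_trans e _.
by apply: eqv_catl => d; rewrite (nword_top nN) => -[<-].
Qed.

Lemma sortable_eqv a w w' b : eqv a w w' -> sortable a w b -> sortable a w' b.
Proof.
move=> e [N nN eN]; exists N => //; apply: eqv_trans eN.
by apply: eqv_catl => d; rewrite top_of_mix => -[<-]; apply: eqv_sym.
Qed.

Lemma sortable_shift x a w b :
  sortable a w b -> sortable (x :: a) (shift 1 w) (x :: b).
Proof.
move=> [N nN /(eqv_shift1 x) eN]; rewrite !shift_cat in eN; case: x eN => eN.
  by exists (shift 1 N); [apply: nword_shift|].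
have [M nM eM] := sink_nword nN; exists M => //.
rewrite /= -catA.
apply: (eqv_trans (w' := sink (count id a) ++ shift 1 N ++ shift 1 (mix b))).
  apply: eqv_catl => d.
  by rewrite (top_of_sink (count id a) (nseq (count negb a) false)) => -[<-].
by rewrite !catA; apply: eqv_catr.
Qed.

Lemma shift_sink k : shift 1 (sink k) ++ [:: (0%N, Cross false)] = sink k.+1.
Proof. by rewrite -[k.+1]addn1 sink_add. Qed.

(** A minimum on the far left is obtained from one at position [p] by carrying both of its legs over
    the [p] strands in between. *)
Lemma cup_sink p a : (p <= size a)%N ->
  eqv a [:: (0%N, Cup true)] ((p, Cup true) :: sink p ++ shift 1 (sink p)).
Proof.
elim: p => [|p IHp] le; first exact: eqv_refl.
apply: eqv_trans (IHp (ltnW le)) _.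
apply: (eqv_trans (w' := [:: (p.+1, Cup true); (p, Cross false); (p.+1, Cross false)]
  ++ sink p ++ shift 1 (sink p))).
  apply: (eqv_trans (w' := [:: (p, Cup true)] ++
      [:: (p.+1, Cross true); (p.+1, Cross false)] ++ sink p ++ shift 1 (sink p))).
    apply: eqv_sym; apply: (eqv_at [:: (p, Cup true)] (sink p ++ shift 1 (sink p))
      [:: (p.+1, Cross true); (p.+1, Cross false)] [::]) => // d /=.
    case E: slice_step => [e|] //= [<-]; apply: (eqv_R2 true).
    have := slice_step_inv E => -[p1 [a1 [b [r1 [Ed -> _ sa /size_local_step sb]]]]].
    by move: le; rewrite Ed !size_cat sb sa /=; lia.
  apply: ueq_sym; exact: (ueq_catr ((p.+1, Cross false) :: sink p ++ shift 1 (sink p))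
    (ueq_slide_cup p true false)).
apply: ueq_sym; apply: (ueq_at [:: (p.+1, Cup true); (p, Cross false)]
  (shift 1 (sink p)) (sink_far (Cross false) (ltnSn p))); rewrite /= -?catA //.
Qed.

Lemma sink_cap p :
  ueq (shift 1 (sink p) ++ [:: (0%N, Cap)]) (raise p ++ [:: (p, Cap)]).
Proof.
elim: p => [|p IHp] /=; first exact: ueq_refl.
apply: (ueq_trans (w' := [:: (p.+1, Cross false)] ++ raise p ++ [:: (p, Cap)])).
  exact: (ueq_catl [:: (p.+1, Cross false)] IHp).
apply: (ueq_trans (w' := (raise p ++ [:: (p.+1, Cross false)]) ++ [:: (p, Cap)])).
  rewrite [X in ueq X]catA; apply: ueq_catr; apply: ueq_sym.
  exact: raise_far.
rewrite -!catA; apply: ueq_catl; apply: ueq_sym; exact: (ueq_slide_cap p true).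
Qed.

Lemma event_mix g (w : diagram) :
  ueq ((0%N, g) :: shift (n_out g) w) (shift (n_in g) w ++ [:: (0%N, g)]).
Proof.
have F : fit (n_in g) [:: (0%N, g)] by rewrite /= add0n leqnn.
by have := move_past w F; rewrite /= subnn.
Qed.

Lemma mix_up_down a : mix [:: true, false & a]
  = shift 1 (sink (count id a)) ++ shift 2 (mix a).
Proof. by rewrite [mix _]/= shift_cat shift_shift. Qed.

Lemma mix_down_up a : mix [:: false, true & a]
  = shift 1 (sink (count id a)) ++ [:: (0%N, Cross false)] ++ shift 2 (mix a).
Proof. by rewrite catA shift_sink [mix _]/= shift_shift. Qed.

Lemma sortable_cup b a : sortable a [:: (0%N, Cup b)] [:: b, ~~ b & a].
Proof.
set p := count id a; exists ((p, Cup true) :: sink p).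
  have -> : count id [:: b, ~~ b & a] = p.+1 by case: b.
  have -> : count negb [:: b, ~~ b & a] = (count negb a).+1 by case: b.
  by apply: nword_cup; apply: nword_sink.
have E := event_mix (Cup b) (mix a); rewrite [n_in _]/= shift0 in E.
apply: eqv_trans (ueq_sym E _) _.
have le : (p <= size (st_of a))%N by rewrite size_st leq_addr.
have C := cup_sink le; case: b {E}.
  by have := eqv_catr (shift 2 (mix a)) C; rewrite [~~ true]/= mix_up_down /= -!catA.
(* With the downward leg on the left, a kink reduces to the other case; its crossing is the one by
   which [mix_down_up] differs from [mix_up_down]. *)
have R := ueq_R1_cup 0 true false (st_of a).
have := eqv_trans (eqv_sym R) (eqv_catr [:: (0%N, Cross false)] C).
move/(eqv_catr (shift 2 (mix a))).
by rewrite [~~ false]/= mix_down_up /= -!catA.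
Qed.

Lemma sortable_cap x a : sortable [:: x, ~~ x & a] [:: (0%N, Cap)] a.
Proof.
set p := count id a; exists (raise p ++ [:: (p, Cap)]).
  have -> : count id [:: x, ~~ x & a] = p.+1 by case: x.
  have -> : count negb [:: x, ~~ x & a] = (count negb a).+1 by case: x.
  apply: nword_cat (nword_raise _ _) _ => //.
  by apply: nword_cap => //; apply: nword_nil.
have F : ueq (shift 1 (sink p) ++ shift 2 (mix a) ++ [:: (0%N, Cap)])
             ((raise p ++ [:: (p, Cap)]) ++ mix a).
  apply: ueq_trans (ueq_catl _ (ueq_sym (event_mix Cap (mix a)))) _.
  by rewrite /= shift0; have := ueq_catr (mix a) (sink_cap p); rewrite -!catA.
case: x; first by rewrite [~~ true]/= mix_up_down -catA.
rewrite [~~ false]/= mix_down_up -catA.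
apply: eqv_trans (F _); apply: ueq_eqv.
apply: (ueq_trans (w' := shift 1 (sink p)
  ++ [:: (0%N, Cross false); (0%N, Cap)] ++ mix a)).
  apply: ueq_catl; apply: (ueq_catl [:: (0%N, Cross false)]).
  by have := ueq_sym (event_mix Cap (mix a)); rewrite /= shift0.
apply: ueq_catl; apply: ueq_trans (ueq_catr (mix a) (ueq_R1_cap 0 false)) _.
by have := event_mix Cap (mix a); rewrite /= shift0.
Qed.

Lemma sortable_cross_up c a :
  sortable [:: true, true & a] [:: (0%N, Cross c)] [:: true, true & a].
Proof.
exists [:: (0%N, Cross c)]; first by apply: nword_up => //; apply: nword_nil.
by rewrite /= shift_shift; apply: ueq_sym; apply: (event_mix (Cross c)).
Qed.

Lemma eqv_zigzag a i b (side : bool) :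
  top_of a [:: ((i + side)%N, Cup b); ((i + ~~ side)%N, Cap)] = Some a ->
  eqv a [:: ((i + side)%N, Cup b); ((i + ~~ side)%N, Cap)] [::].
Proof. by move=> E; apply: eqv_move (move_zigzag _ _ _) E _. Qed.

(* Turning a crossing by a quarter reverses one of its strands. *)
Lemma turn_right c y a :
  eqv [:: y, false & a] [:: (0%N, Cup false); (1%N, Cross (~~ c)); (2%N, Cap)]
                        [:: (0%N, Cross c)].
Proof.
apply: eqv_trans (ueq_catr [:: (2%N, Cap)] (ueq_sym (ueq_slide_cup 0 false c)) _) _.
apply: eqv_trans (ueq_catl [:: (1%N, Cup false)] (ueq_far 0 0 (Cross c) Cap) _) _.
apply: (eqv_catr [:: (0%N, Cross c)] (w := [:: (1%N, Cup false); (2%N, Cap)])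
  (w' := [::])).
exact: (@eqv_zigzag _ 1 false false).
Qed.

Lemma turn_left c a :
  eqv [:: false, true & a] [:: (2%N, Cup true); (1%N, Cross (~~ c)); (0%N, Cap)]
                           [:: (0%N, Cross c)].
Proof.
apply: eqv_trans (ueq_catl [:: (2%N, Cup true)] (ueq_sym (ueq_slide_cap 0 c)) _) _.
apply: eqv_trans (ueq_catr [:: (1%N, Cap)]
  (ueq_sym (ueq_far 0 0 (Cross c) (Cup true))) _) _.
apply: (eqv_catl (u := [:: (0%N, Cross c)]) (w := [:: (2%N, Cup true); (1%N, Cap)])
  (w' := [::])) => d /= [<-].
by apply: (@eqv_zigzag _ 1 true true); rewrite /= /slice_step /= take0 drop0.
Qed.

(** Only a crossing of two upward strands is immediate. With one downward strand, a quarter turn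
    makes both strands upward; with two, a turn leads to the case of one. *)
Lemma sortable_cross x y a c :
  sortable [:: x, y & a] [:: (0%N, Cross c)] [:: y, x & a].
Proof.
have P e z t : sortable [:: z, true, true & t] [:: (1%N, Cross e)] [:: z, true, true & t].
  exact: (sortable_shift z (sortable_cross_up e t)).
have tf e t : sortable [:: true, false & t] [:: (0%N, Cross e)] [:: false, true & t].
  apply: sortable_eqv (turn_right e true t) _.
  apply: (sortable_cat (sortable_cup false _)); apply: (sortable_cat (P _ _ _)).
  exact: (sortable_shift _ (sortable_shift _ (sortable_cap true t))).
case: x y => -[].
- exact: sortable_cross_up.
- exact: tf.
- apply: sortable_eqv (turn_left c a) _.
  apply: (sortable_cat (sortable_shift _ (sortable_shift _ (sortable_cup true a)))).
  by apply: (sortable_cat (P _ _ _)); apply: (sortable_cap false).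
apply: sortable_eqv (turn_right c false a) _.
apply: (sortable_cat (sortable_cup false _)).
apply: (sortable_cat (sortable_shift false (tf (~~ c) _))).
exact: (sortable_shift _ (sortable_shift _ (sortable_cap true _))).
Qed.

(** [sortable_shift] removes the strands to the left of the event one by one, so that only position
    0 remains. *)
Lemma sortable_event x a b : slice_step a x = Some b -> sortable a [:: x] b.
Proof.
case: x => i g; elim: i a b => [|i IHi] a b; last first.
  case: a => [|x a] E; first by case: g {IHi} E.
  have := top_of_shift1 x a [:: (i, g)]; rewrite /= add1n E.
  case E': (slice_step a (i, g)) => [b'|] //= -[->].
  exact: (sortable_shift x (IHi _ _ E')).
rewrite /slice_step; case: g => [c||c]; rewrite drop0 take0.
- by case=> <-; apply: sortable_cup.
- case: a => [|x [|y a]] //; case: ifP => // ne [<-].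
  by have -> : y = ~~ x; [move: ne; case: x y => -[]|apply: sortable_cap].
by case: a => [|x [|y a]] // [<-]; apply: sortable_cross.
Qed.

Lemma sortable_word a w b : top_of a w = Some b -> sortable a w b.
Proof.
elim: w a => [|x w IHw] a /=; first by case=> ->; apply: sortable_nil.
case E: slice_step => [d|] //= /IHw; exact: sortable_cat (sortable_event E).
Qed.

(** * Absorbing sorted words into partially closed braids *)

Definition cups (i k : nat) : diagram := [seq (j, Cup true) | j <- iota i k].
Definition caps (i k : nat) : diagram := [seq (j, Cap) | j <- rev (iota i k)].

Lemma cups_add i k l : cups i (k + l) = cups i k ++ cups (i + k) l.
Proof. by rewrite /cups iotaD map_cat. Qed.

Lemma caps_snoc i k : caps i k.+1 = caps i.+1 k ++ [:: (i, Cap)].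
Proof. by rewrite /caps /= rev_cons map_rcons cats1. Qed.

Lemma shift_cups j i k : shift j (cups i k) = cups (j + i) k.
Proof. by rewrite /shift /cups iotaDl -!map_comp. Qed.

Lemma shift_caps j i k : shift j (caps i k) = caps (j + i) k.
Proof. by rewrite /shift /caps iotaDl -map_rev -!map_comp. Qed.

Lemma fit_cups n i k : (i <= n)%N ->
  fit n (cups i k) /\ outw n (cups i k) = (n + k + k)%N.
Proof.
elim: k i n => [|k IHk] i n le; first by rewrite !addn0.
have [] := IHk i.+1 (n + 2)%N; first by lia.
rewrite /cups /= subn0 => -> ->; split; [lia|lia].
Qed.

Lemma fit_caps n i k : (i <= n)%N ->
  fit (n + k + k) (caps i k) /\ outw (n + k + k) (caps i k) = n.
Proof.
elim: k i n => [|k IHk] i n le; first by rewrite !addn0.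
have [] := IHk i.+1 n.+2; first by lia.
rewrite (_ : n.+2 + k + k = n + k.+1 + k.+1)%N; last by lia.
by rewrite caps_snoc fit_cat outw_cat /= => -> ->; split; lia.
Qed.

Definition levels (n : nat) (b : seq (nat * bool)) := all (fun x => x.1.+1 < n)%N b.

Lemma levels_top i c : levels i.+2 [:: (i, c)].
Proof. by rewrite /levels /= leqnn. Qed.

Lemma fit_crossings n b : levels n b ->
  fit n (crossing_word b) /\ outw n (crossing_word b) = n.
Proof.
elim: b => [|[i c] b IHb] //= /andP[lt /IHb]; rewrite addn2 lt /=.
by rewrite (_ : n - 2 + 2 = n)%N //; lia.
Qed.

(* The closure of a braid on [m + k] strands, open on the first [m] ones. *)
Definition partial_closure (m k : nat) (b : seq (nat * bool)) : diagram :=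
  cups 0 (m + k) ++ crossing_word b ++ caps m k.

Lemma nword_partial_closure m k b : levels (m + k) b ->
  nword 0 0 (partial_closure m k b) m m.
Proof.
move=> lev; have C p l : nword p p (cups p l) (p + l) (p + l).
  elim: l p => [|l IHl] p; first by rewrite addn0; apply: nword_nil.
  by apply: nword_cup; rewrite addnS -addSn; apply: IHl.
have B n : levels n b -> nword n n (crossing_word b) n n.
  elim: (b) => [|[i c] b' IHb] /=; first by move=> _; apply: nword_nil.
  by case/andP=> lt /IHb; apply: nword_up.
have D l p : nword (p + l) (p + l) (caps p l) p p.
  elim: l p => [|l IHl] p; first by rewrite addn0; apply: nword_nil.
  rewrite addnS -addSn caps_snoc; apply: nword_cat (IHl _) _.
  by apply: nword_cap => //; apply: nword_nil.
by apply: nword_cat (C 0%N _) _; rewrite add0n; apply: nword_cat (B _ lev) (D _ _).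
Qed.

Definition closes (m : nat) (w : diagram) : Prop :=
  exists k b, levels (m + k) b /\ eqv [::] w (partial_closure m k b).

Lemma closes_catr m m' x w :
  (forall k b, levels (m + k) b -> closes m' (partial_closure m k b ++ x)) ->
  closes m w -> closes m' (w ++ x).
Proof.
move=> H [k [b [/H[k' [b' [lev e']]] e]]]; exists k', b'; split=> //.
exact: eqv_trans (eqv_catr x e) e'.
Qed.

(** The crossing is to the left of all closing caps, so it slips below them and becomes the last
    letter of the braid. *)
Lemma closes_up m i c w : (i.+1 < m)%N -> closes m w ->
  closes m (w ++ [:: (i, Cross c)]).
Proof.
move=> lt; apply: closes_catr => k b lev; exists k, (rcons b (i, c)); split.
  by rewrite /levels all_rcons /= (leq_trans lt (leq_addr _ _)).
apply: ueq_eqv; rewrite /partial_closure -!catA; apply: ueq_catl.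
rewrite /crossing_word map_rcons -cats1 -catA; apply: ueq_catl.
have [F O] := fit_crossings (n := i.+2) (b := [:: (i, c)]) (levels_top i c).
have := move_past (caps (m - i.+2) k) F; rewrite O shift_caps subnKC //.
exact: ueq_sym.
Qed.

(** A crossing between the right legs of two nested minima can be rotated through them to the left
    legs. *)
Lemma cups_cross j c :
  ueq [:: (j, Cup true); (j.+1, Cup true); (j.+2, Cross c)]
      [:: (j, Cup true); (j.+1, Cup true); (j, Cross c)].
Proof.
have S := ueq_catl [:: (j, Cup true)] (ueq_slide_cup j true c).
apply: ueq_sym; apply: ueq_trans S _.
have F := ueq_sym (ueq_far j 0 (Cup true) (Cup true)).
rewrite /= !addn0 addn2 in F.
apply: ueq_trans (ueq_catr [:: (j.+1, Cross (~~ c))] F) _.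
have := ueq_catl [:: (j, Cup true)] (ueq_slide_cup j.+1 true (~~ c)).
by rewrite negbK.
Qed.

(* Crossings of the closing strands are carried around through the minima. *)
Lemma closes_down m i c w : (m <= i)%N -> (i.+1 < m + m)%N -> closes m w ->
  closes m (w ++ [:: (i, Cross c)]).
Proof.
move=> le lt; apply: closes_catr => k b lev; set n := (m + k)%N in lev *.
(* Below the caps the crossing involves strands n + l and n + l + 1 of 2 n. Strand t is joined by a
   minimum to strand 2 n - 1 - t, so these two correspond to j + 1 and j. *)
set l := (k + (i - m))%N; set j := (n - l - 2)%N.
have En : n = (j + 2 + l)%N by rewrite /j /n /l; lia.
exists k, ((j, c) :: b); split; first by apply/andP; split=> //=; rewrite -/n En; lia.
apply: ueq_eqv; rewrite /partial_closure -/n -!catA.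
apply: (ueq_trans (w' := cups 0 n ++ crossing_word b
  ++ [:: ((n + l)%N, Cross c)] ++ caps m k)).
  do 2 apply: ueq_catl; have [F O] := fit_caps k (leqnn m).
  have := move_past [:: ((i - m)%N, Cross c)] F; rewrite O /= subnKC //.
  by rewrite (_ : m + k + k + (i - m) = n + l)%N // /n /l; lia.
rewrite -[crossing_word (_ :: _)]/([:: (j, Cross c)] ++ crossing_word b) !catA.
apply: ueq_catr; have [F O] := fit_crossings lev.
have := move_past [:: (l, Cross c)] F; rewrite O /= => H.
apply: (ueq_trans (w' := (cups 0 n ++ [:: ((n + l)%N, Cross c)]) ++ crossing_word b)).
  by rewrite -!catA; apply: ueq_catl.
apply: ueq_catr; rewrite {1 3}En !(cups_add 0 (j + 2) l) (cups_add 0 j 2) !add0n -!catA.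
apply: ueq_catl; set u := cups (j + 2) l;
have -> : cups j 2 = [:: (j, Cup true); (j.+1, Cup true)] by [].
apply: (ueq_trans (w' := [:: (j, Cup true); (j.+1, Cup true); (j.+2, Cross c)] ++ u)).
  apply: (ueq_catl [:: (j, Cup true); (j.+1, Cup true)]).
  have [Fu Ou] := fit_cups l (leqnn (j + 2)).
  have Hu := move_past [:: (0%N, Cross c)] Fu.
  by rewrite Ou /= !addn0 -En in Hu; rewrite -[j.+2]addn2.
apply: ueq_trans (ueq_catr u (cups_cross j c)) _.
apply: (ueq_catl [:: (j, Cup true); (j.+1, Cup true)]).
have [Fj Oj] := fit_crossings (n := j.+2) (b := [:: (j, c)]) (levels_top j c).
by have := move_past (cups 0 l) Fj; rewrite Oj shift_cups addn0 -addn2.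
Qed.

Lemma closes_cap m w : closes m.+1 w -> closes m (w ++ [:: (m, Cap)]).
Proof.
apply: closes_catr => k b lev; exists k.+1, b; rewrite addnS -addSn; split=> //.
by rewrite /partial_closure caps_snoc addnS -addSn -!catA; apply: eqv_refl.
Qed.

(** A maximum followed by a minimum is rewritten with the minimum first, at the price of two
    crossings of parallel strands. This allows a new minimum to be pushed below a closing cap. *)
Lemma saddle a m : (m < size a)%N ->
  eqv a [:: (m, Cap); (m, Cup true)]
    [:: (m.+1, Cup true); (m, Cross false); (m.+2, Cross true); (m.+1, Cap)].
Proof.
move=> lt; apply: eqv_sym.
apply: eqv_trans (ueq_catr [:: (m.+2, Cross true); (m.+1, Cap)]
  (ueq_slide_cup m true false) _) _.
apply: eqv_trans (ueq_catl [:: (m, Cup true); (m.+1, Cross true)]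
  (ueq_sym (ueq_slide_cap m.+1 false)) _) _.
have F := ueq_far m 0 (Cup true) Cap; rewrite /= !addn0 addn2 in F.
apply: eqv_trans (F a).
apply: (eqv_at [:: (m, Cup true)] [:: (m.+2, Cap)]
  [:: (m.+1, Cross true); (m.+1, Cross false)] [::]) => // d /=.
case E: slice_step => [e|] //= [<-]; apply: (eqv_R2 true).
have := slice_step_inv E => -[p1 [a1 [b [r1 [Ed -> _ sa /size_local_step sb]]]]].
by move: lt; rewrite Ed !size_cat sb sa /=; lia.
Qed.

(** Induction on the number of closed strands. With none, the minimum slips below the braid and adds
    an innermost strand. Otherwise [saddle] trades the last cap and the minimum for a minimum above
    fewer caps, two crossings and a cap, all of which can be absorbed. *)
Lemma closes_cup m w : closes m w -> closes m.+1 (w ++ [:: (m, Cup true)]).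
Proof.
apply: closes_catr => k; elim: k m => [|k IHk] m b lev.
  exists 0%N, b; rewrite !addn0 in lev *; split.
    by apply: sub_all lev => x /ltnW.
  apply: ueq_eqv; rewrite /partial_closure !addn0 -[m.+1]addn1 cups_add !cats0 -!catA.
  apply: ueq_catl.
  have [F O] := fit_crossings lev; have := move_past [:: (0%N, Cup true)] F.
  by rewrite O /= addn0.
have lev' : levels (m.+1 + k) b by rewrite addSnnS.
have [k' [b' [lv e]]] : closes m.+1 (((partial_closure m.+1 k b ++ [:: (m.+1, Cup true)])
    ++ [:: (m, Cross false)]) ++ [:: (m.+2, Cross true)] ++ [:: (m.+1, Cap)]).
  rewrite catA; apply: closes_cap; apply: closes_down; [lia|lia|].
  by apply: closes_up; [lia|apply: IHk].
exists k', b'; split=> //; apply: eqv_trans e; set P := partial_closure m.+1 k b.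
rewrite (_ : partial_closure m k.+1 b = P ++ [:: (m, Cap)]); last first.
  by rewrite /P /partial_closure caps_snoc addSnnS -!catA.
rewrite -(catA P) -(catA (P ++ _)) -(catA P); apply: eqv_catl => d.
rewrite (nword_top (nword_partial_closure lev')) => -[<-].
by apply: saddle; rewrite size_st; lia.
Qed.

Lemma closes_nword p r w p' r' u : nword p r w p' r' -> p = r ->
  closes p u -> closes p' (u ++ w).
Proof.
move=> nw; elim: nw u => {p r w p' r'} [p r|p r i c w p' r' lt _ IH|
  p r i c w p' r' le lt _ IH|p r w p' r' _ IH|p r p0 r0 w p' r' -> -> _ IH] u Er C.
- by rewrite cats0.
- by rewrite -cat1s catA; apply: IH => //; apply: closes_up.
- by rewrite -cat1s catA; apply: IH => //; apply: closes_down; rewrite -?Er in lt *.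
- by rewrite -cat1s catA; apply: IH; [rewrite Er|apply: closes_cup].
by rewrite -cat1s catA; apply: IH; [case: Er|apply: closes_cap].
Qed.

Lemma braid_word_of_levels k b : levels k.+1 b ->
  exists b' : braid_word k, partial_closure 0 k.+1 b = braid_closure b'.
Proof.
move=> lev; suff [b' Eb] : exists b' : braid_word k,
    crossing_word b = [seq (val x.1, Cross x.2) | x <- b'].
  by exists b'; rewrite /partial_closure Eb.
elim: b lev => [|[i c] b IHb] /=; first by exists [::].
by case/andP=> lt /IHb[b' Eb]; exists ((Ordinal (lt : i < k)%N, c) :: b'); rewrite /= Eb.
Qed.

(* Alexander's theorem; the empty diagram is the closure of no braid. *)
Lemma alexander w : is_link w -> ~ isotopic w [::] ->
  exists k (b : braid_word k), isotopic (braid_closure b) w.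
Proof.
move=> lw ne; have [N nN] := sortable_word lw; rewrite /= cats0 => eN.
have C0 : closes 0 [::] by exists 0%N, [::]; split=> //; apply: eqv_refl.
have [n [b [lev e]]] := closes_nword nN erefl C0.
have := eqv_isotopic (eqv_trans eN e) lw.
case: n lev {e} => [|k] lev.
  (* Without strands the braid word is empty and its closure is the empty diagram. *)
  by case: b lev => // _ /ne.
have [b' ->] := braid_word_of_levels lev.
by move/isotopic_sym => iso; exists k, b'.
Qed.

Theorem theorem2p2 (n : nat) (hn : (0 < n)%N) :
  LG_is (AS n) (AS_form (iterop n box (box Tplus Tminus) e2)).
Proof.
have v := link_value_AS_form hn; split.
  apply: (alexander (is_link_AS n)) => iso.
  (* The empty diagram has no [link_value], as it has no minimum to cut, so a link that has one is
     not isotopic to it. *)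
  by case: (proj1 (link_value_isotopic _ iso) v) => b [w []].
by move=> k w iso; apply: partial_trace_link; apply: proj2 (link_value_isotopic _ iso) v.
Qed.
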